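(* Let $N\ge3$, $0<\lambda\le\Lambda$, and let $\mathcal{M}$ be either $\mathcal{M}^+_{\lambda,\Lambda}$ or $\mathcal{M}^-_{\lambda,\Lambda}$. For $p,q>0$ consider the system $$\mathcal{M}(D^2u)+v^p=0,\qquad \mathcal{M}(D^2v)+u^q=0,\qquad u,v>0\quad\text{in }\Omega. \tag{S}$$ Let $\mathcal{C}$ be the set of $(p,q)\in\mathbb{R}^2$ with $p,q>0$, $pq>1$ such that there exists a regular solution $(u,v)$ of (S) in $\Omega=B_R$ with $u=v=0$ on $\partial B_R$, and let $\mathcal{G}$ be the set of $(p,q)\in\mathbb{R}^2$ with $p,q>0$, $pq>1$ such that there exists a regular radial solution $(u,v)$ of (S) in $\Omega=\mathbb{R}^N$. Then $$\{(p,q)\in\mathbb{R}^2:\ p,q>0,\ pq>1\}=\mathcal{C}\sqcup\mathcal{G},$$ where $\sqcup$ denotes a disjoint union.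
   Context: Pucci operators: for a symmetric $N\times N$ matrix $A$ with eigenvalues $e_1,\dots,e_N$, $\mathcal{M}^+_{\lambda,\Lambda}(A)=\Lambda\sum_{e_i>0}e_i+\lambda\sum_{e_i<0}e_i$ and $\mathcal{M}^-_{\lambda,\Lambda}(A)=\lambda\sum_{e_i>0}e_i+\Lambda\sum_{e_i<0}e_i$. Solutions are classical; a solution pair is regular if $u$ and $v$, together with their derivatives, are continuously defined at $x=0$. $B_R$ is the ball of radius $R>0$ centered at $0$; by the scaling $u_\gamma(r)=\gamma^{\alpha}u(\gamma r)$, $v_\gamma(r)=\gamma^\beta v(\gamma r)$ with $\alpha=\frac{2(p+1)}{pq-1}$, $\beta=\frac{2(q+1)}{pq-1}$, the definition of $\mathcal{C}$ does not depend on the choice of $R>0$. *)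

(* Defs.v *)
From mathcomp Require Import all_boot all_order all_algebra.
From mathcomp Require Import all_classical all_reals all_analysis.

Set Implicit Arguments.
Unset Strict Implicit.
Unset Printing Implicit Defensive.

Import Order.TTheory GRing.Theory Num.Theory.
Import numFieldNormedType.Exports.

Local Open Scope classical_set_scope.
Local Open Scope ring_scope.

(* Eigenvalues repeated according to multiplicity, in an unspecified order; the
   default [::] occurs only if the characteristic polynomial does not split
   over R, hence never for a symmetric real matrix. *)
Definition eigenvalues (R : realType) (N : nat) (A : 'M[R]_N) : seq R :=
  xget [::] [set s : seq R | char_poly A = \prod_(e <- s) ('X - e%:P)].

Definition pucci_sup (R : realType) (N : nat) (lam Lam : R) (A : 'M[R]_N) : R :=
  Lam * (\sum_(e <- eigenvalues A | 0 < e) e) +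
  lam * (\sum_(e <- eigenvalues A | e < 0) e).

Definition pucci_inf (R : realType) (N : nat) (lam Lam : R) (A : 'M[R]_N) : R :=
  lam * (\sum_(e <- eigenvalues A | 0 < e) e) +
  Lam * (\sum_(e <- eigenvalues A | e < 0) e).

Definition partial (R : realType) (N : nat) (i : 'I_N) (u : 'rV[R]_N -> R) :
    'rV[R]_N -> R :=
  fun x => 'D_(delta_mx 0 i) u x.

Definition hessian (R : realType) (N : nat) (u : 'rV[R]_N -> R)
    (x : 'rV[R]_N) : 'M[R]_N :=
  \matrix_(i, j) partial j (partial i u) x.

(* C1_on and C2_on are meant for open sets U. *)
Definition C1_on (R : realType) (N : nat) (U : set 'rV[R]_N)
    (u : 'rV[R]_N -> R) : Prop :=
  forall x, U x -> {for x, continuous u} /\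
    forall i : 'I_N, derivable u x (delta_mx 0 i) /\
      {for x, continuous (partial i u)}.

Definition C2_on (R : realType) (N : nat) (U : set 'rV[R]_N)
    (u : 'rV[R]_N -> R) : Prop :=
  C1_on U u /\ forall i : 'I_N, C1_on U (partial i u).

(* The library norm on 'rV[R]_N is the sup norm, so Euclidean balls and
   spheres are defined here; both norms induce the same topology. *)
Definition enorm (R : realType) (N : nat) (x : 'rV[R]_N) : R :=
  Num.sqrt (\sum_(i < N) x 0 i ^+ 2).

Definition eball (R : realType) (N : nat) (rho : R) : set 'rV[R]_N :=
  [set x | enorm x < rho].

Definition ecball (R : realType) (N : nat) (rho : R) : set 'rV[R]_N :=
  [set x | enorm x <= rho].

Definition esphere (R : realType) (N : nat) (rho : R) : set 'rV[R]_N :=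
  [set x | enorm x = rho].

Definition radial (R : realType) (N : nat) (u : 'rV[R]_N -> R) : Prop :=
  forall x y : 'rV[R]_N, enorm x = enorm y -> u x = u y.

(* Classical positive solutions of M(D^2 u) + v^p = 0, M(D^2 v) + u^q = 0 in
   an open set U containing the origin. Regularity at the origin is part of the
   C^2 condition, which holds at every point of U, the origin included. *)
Definition regular_solution (R : realType) (N : nat) (M : 'M[R]_N -> R)
    (p q : R) (U : set 'rV[R]_N) (u v : 'rV[R]_N -> R) : Prop :=
  [/\ C2_on U u, C2_on U v,
      forall x, U x -> 0 < u x /\ 0 < v x &
      forall x, U x -> M (hessian u x) + v x `^ p = 0 /\
                       M (hessian v x) + u x `^ q = 0].

Definition superlinear_pairs (R : realType) : set (R * R) :=
  [set pq | [/\ 0 < pq.1, 0 < pq.2 & 1 < pq.1 * pq.2]].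

Definition calC (R : realType) (N : nat) (M : 'M[R]_N -> R) (rho : R) :
    set (R * R) :=
  [set pq | superlinear_pairs pq /\
    exists u v : 'rV[R]_N -> R,
      [/\ regular_solution M pq.1 pq.2 (@eball R N rho) u v,
          {within @ecball R N rho, continuous u},
          {within @ecball R N rho, continuous v} &
          forall x, @esphere R N rho x -> u x = 0 /\ v x = 0]].

Definition calG (R : realType) (N : nat) (M : 'M[R]_N -> R) : set (R * R) :=
  [set pq | superlinear_pairs pq /\
    exists u v : 'rV[R]_N -> R,
      [/\ regular_solution M pq.1 pq.2 [set: 'rV[R]_N] u v,
          radial u & radial v]].

(* Main.v *)
Require Import Defs.
From mathcomp Require Import all_boot all_order all_algebra.
From mathcomp Require Import all_classical all_reals all_analysis.
From mathcomp Require Import measurable_realfun ring lra.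
Import Order.TTheory GRing.Theory Num.Theory.
Import numFieldNormedType.Exports.

Set Implicit Arguments.
Unset Strict Implicit.
Unset Printing Implicit Defensive.

Local Open Scope classical_set_scope.
Local Open Scope ring_scope.

(* Any solution vanishing on the sphere is radial, by the method of moving
   planes, so both alternatives are about the same radial initial value problem.
   The radial system is ordered: raising v(0) raises v, lowers u, and never lets
   the gap v - V decrease. After scaling so that u(0) agrees, this excludes that
   one radial solution reaches 0 while another one stays positive forever. For
   existence fix u(0) = 1 and shoot on eta = v(0): for large eta the component u
   vanishes first, for small eta the component v does, and each of these two
   conditions is stable under monotone limits in eta. At the supremum of the eta
   for which v vanishes first, neither can hold, so u and v vanish together (a
   solution in a ball, up to scaling) or not at all (a global solution). *)

(** * Pucci operators *)


Section linear_algebra.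
Context {R : realType}.

(** Either of [p], [q] may be less than 1, so uniqueness and linearization can fail where a
    component vanishes. Radial uniqueness is therefore proved only while both components are
    positive, and a sign pattern is carried between solutions with the same data just past the first
    zero. In the moving planes the difference quotient of the power is unbounded as [v] tends to 0;
    the linear growth given by the Hopf lemma controls it. The powers are truncated at 0: radial
    solutions then exist for all radii and keep decreasing past their zeros, and vanishing first is
    a strict sign condition at one radius. The radial equation changes slope with the sign of [u''].
    For [y = - u' / r] it becomes [r y' + (K + 1) y = F(y, v)], and a large [K] makes [F]
    nondecreasing in both arguments, so a monotone iteration of weighted averages converges on the
    whole half-line. Order in [eta] with dominated convergence replaces continuous dependence. The
    Pucci operators are not linear, but a difference of two values is bounded on one side by an
    elliptic linear expression in the difference of the matrices, which suffices for maximum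
    principles. *)

Definition dot n (x y : 'rV[R]_n) : R := \sum_(i < n) x 0 i * y 0 i.
Definition qf n (A : 'M[R]_n) (x : 'rV[R]_n) : R := dot (x *m A) x.

Lemma dotE n (x y : 'rV[R]_n) : dot x y = (x *m y^T) 0 0.
Proof. by rewrite mxE; apply: eq_bigr => i _; rewrite mxE. Qed.

Lemma dotC n (x y : 'rV[R]_n) : dot x y = dot y x.
Proof. by apply: eq_bigr => i _; rewrite mulrC. Qed.

Lemma dotDl n (x y z : 'rV[R]_n) : dot (x + y) z = dot x z + dot y z.
Proof. by rewrite /dot -big_split; apply: eq_bigr => i _ /=; rewrite mxE mulrDl. Qed.

Lemma dotDr n (x y z : 'rV[R]_n) : dot x (y + z) = dot x y + dot x z.
Proof. by rewrite dotC dotDl !(dotC x). Qed.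

Lemma dotZl n a (x y : 'rV[R]_n) : dot (a *: x) y = a * dot x y.
Proof. by rewrite /dot mulr_sumr; apply: eq_bigr => i _; rewrite mxE mulrA. Qed.

Lemma dotZr n a (x y : 'rV[R]_n) : dot x (a *: y) = a * dot x y.
Proof. by rewrite dotC dotZl dotC. Qed.

Lemma dotNl n (x y : 'rV[R]_n) : dot (- x) y = - dot x y.
Proof. by rewrite -scaleN1r dotZl mulN1r. Qed.

Lemma dotNr n (x y : 'rV[R]_n) : dot x (- y) = - dot x y.
Proof. by rewrite dotC dotNl dotC. Qed.

Definition dot_lin := (dotDl, dotDr, dotZl, dotZr, dotNl, dotNr).

Lemma dot_ge0 n (x : 'rV[R]_n) : 0 <= dot x x.
Proof. by apply: sumr_ge0 => i _; rewrite -expr2 sqr_ge0. Qed.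

Lemma dot_eq0 n (x : 'rV[R]_n) : dot x x = 0 -> x = 0.
Proof.
move=> h; apply/rowP => i; rewrite mxE.
have /eqP := h; rewrite psumr_eq0; last by move=> j _; rewrite -expr2 sqr_ge0.
by move=> /allP/(_ i); rewrite mem_index_enum mulf_eq0 orbb => /(_ isT)/eqP.
Qed.

Lemma dot_mul n m (x : 'rV[R]_n) (A : 'M[R]_(n, m)) (y : 'rV[R]_m) : dot (x *m A) y = dot x (y *m A^T).
Proof. by rewrite !dotE trmx_mul trmxK mulmxA. Qed.

Lemma qfE n (A : 'M[R]_n) x : qf A x = \sum_i \sum_j x 0 i * x 0 j * A i j.
Proof.
rewrite /qf /dot; under eq_bigr do rewrite mxE mulr_suml.
rewrite exchange_big; apply: eq_bigr => i _; apply: eq_bigr => j _.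
by rewrite mulrAC.
Qed.

Lemma qfD n (A B : 'M[R]_n) x : qf (A + B) x = qf A x + qf B x.
Proof. by rewrite /qf mulmxDr dotDl. Qed.

Lemma qfN n (A : 'M[R]_n) x : qf (- A) x = - qf A x.
Proof. by rewrite /qf mulmxN dotNl. Qed.

Lemma qfZ n a (A : 'M[R]_n) x : qf (a *: A) x = a * qf A x.
Proof. by rewrite /qf -scalemxAr dotZl. Qed.

Lemma qf1 n (x : 'rV[R]_n) : qf 1%:M x = dot x x.
Proof. by rewrite /qf mulmx1. Qed.

Lemma qf_outer n (y x : 'rV[R]_n) : qf (y^T *m y) x = dot x y ^+ 2.
Proof.
rewrite /qf mulmxA [x *m y^T]mx11_scalar -dotE mul_scalar_mx dotZl (dotC y).
by rewrite expr2.
Qed.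

Lemma enormE n (x : 'rV[R]_n) : enorm x = Num.sqrt (dot x x).
Proof. by []. Qed.

Lemma enorm_sqr n (x : 'rV[R]_n) : enorm x ^+ 2 = dot x x.
Proof. by rewrite enormE sqr_sqrtr ?dot_ge0. Qed.

Lemma enorm_ge0 n (x : 'rV[R]_n) : 0 <= enorm x.
Proof. exact: sqrtr_ge0. Qed.

Definition reflmx n (e : 'rV[R]_n) : 'M[R]_n := 1%:M - 2 *: (e^T *m e).

Lemma mul_reflmx n (e x : 'rV[R]_n) : x *m reflmx e = x - (2 * dot x e) *: e.
Proof.
rewrite mulmxBr mulmx1 -scalemxAr mulmxA [x *m e^T]mx11_scalar -dotE.
by rewrite mul_scalar_mx scalerA.
Qed.

Lemma reflmx_tr n (e : 'rV[R]_n) : (reflmx e)^T = reflmx e.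
Proof. by rewrite /reflmx linearB linearZ /= trmx1 trmx_mul trmxK. Qed.

Lemma reflmx_orth n (e : 'rV[R]_n) : dot e e = 1 -> reflmx e *m (reflmx e)^T = 1%:M.
Proof.
move=> e1; rewrite reflmx_tr; apply/row_matrixP => i.
rewrite !rowE mulmxA !mul_reflmx mulmx1 !dot_lin e1 mulr1; set a := dot _ _.
by rewrite (_ : 2 * (a - 2 * a) = - (2 * a)) ?scaleNr ?opprK ?subrK//; ring.
Qed.

(** The Householder reflection along [d0 - x] exchanges [x] and the first basis vector, so [x] is
    its first row. *)
Lemma orth_complete n (x : 'rV[R]_n.+1) : dot x x = 1 ->
  exists S : 'M[R]_n.+1, S *m S^T = 1%:M /\ row 0 S = x.
Proof.
move=> x1; pose d0 : 'rV[R]_n.+1 := delta_mx 0 0.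
have d01 : dot d0 d0 = 1.
  rewrite /dot (bigD1 ord0)//= big1 ?mxE ?eqxx ?mulr1 ?addr0// => i i0.
  by rewrite !mxE (negbTE i0) andbF mulr0.
have [xd|xd] := eqVneq x d0.
  exists 1%:M; rewrite trmx1 mulmx1; split=> //.
  by rewrite row1.
pose z := d0 - x; pose c := dot z z.
have c0 : 0 < c.
  rewrite lt_neqAle dot_ge0 andbT eq_sym; apply: contra_neq xd => /dot_eq0.
  by rewrite /z => /eqP; rewrite subr_eq0 => /eqP.
pose e := (Num.sqrt c)^-1 *: z.
have sc : (Num.sqrt c)^-1 * (Num.sqrt c)^-1 = c^-1.
  by rewrite -invfM -expr2 sqr_sqrtr ?ltW.
have e1 : dot e e = 1 by rewrite /e dotZl dotZr mulrA sc mulVf// gt_eqF.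
exists (reflmx e); split; first exact: reflmx_orth.
rewrite rowE mul_reflmx /e dot_lin scalerA -mulrA mulrCA.
have c2 : 2 * dot d0 z = c.
  by rewrite /c /z dotDr dotNr dotDl dotDr dotNl dotNr dotDr dotNr x1 d01 (dotC x); ring.
have -> : (Num.sqrt c)^-1 * dot d0 z * (2 / Num.sqrt c) = 1.
  rewrite [LHS](_ : _ = 2 * dot d0 z * ((Num.sqrt c)^-1 * (Num.sqrt c)^-1)); last by ring.
  by rewrite sc c2 divff// gt_eqF.
by rewrite scale1r /z opprB addrC subrK.
Qed.

Lemma sum_continuous (T : topologicalType) (I : Type) (r : seq I) (f : I -> T -> R) x :
  (forall i, {for x, continuous (f i)}) ->
  {for x, continuous (fun y => \sum_(i <- r) f i y)}.
Proof.
move=> cf; elim: r => [|i r IH].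
  rewrite (_ : (fun _ => _) = cst 0); first exact: cst_continuous.
  by apply/funext => y; rewrite big_nil.
rewrite (_ : (fun _ => _) = (fun y => f i y + \sum_(i <- r) f i y)).
  exact: (continuousD (cf i) IH).
by apply/funext => y; rewrite big_cons.
Qed.

Lemma dot_continuous n (T : topologicalType) (f g : T -> 'rV[R]_n) x :
  {for x, continuous f} -> {for x, continuous g} ->
  {for x, continuous (fun y => dot (f y) (g y))}.
Proof.
move=> cf cg; apply: sum_continuous => i.
apply: continuousM.
  apply: (@continuous_comp _ _ _ f (fun y : 'rV[R]_n => y 0 i)) => //.
  exact: coord_continuous.
apply: (@continuous_comp _ _ _ g (fun y : 'rV[R]_n => y 0 i)) => //.
exact: coord_continuous.
Qed.

Lemma enorm_continuous n : continuous (@enorm R n).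
Proof.
move=> x; rewrite (_ : @enorm R n = Num.sqrt \o (fun y => dot y y)) //.
apply: continuous_comp; last exact: sqrt_continuous.
by apply: dot_continuous; exact: cvg_id.
Qed.

Lemma coord_le_enorm n (x : 'rV[R]_n) i : `|x 0 i| <= enorm x.
Proof.
rewrite -ler_sqr ?nnegrE ?enorm_ge0// enorm_sqr real_normK ?num_real//.
rewrite /dot (bigD1 i)//= -expr2 lerDl; apply: sumr_ge0 => j _.
by rewrite -expr2 sqr_ge0.
Qed.

Lemma norm_le_enorm n (x : 'rV[R]_n) : `|x| <= enorm x.
Proof.
rewrite [leLHS]/Num.Def.normr /= mx_normrE; apply: bigmax_le; first exact: enorm_ge0.
by move=> [i j] _; rewrite (ord1 i); exact: coord_le_enorm.
Qed.

Lemma closed_enorm_le n (f : 'rV[R]_n -> R) (a : R) : continuous f ->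
  closed [set x | f x <= a].
Proof.
move=> cf; rewrite (_ : [set x | _] = f @^-1` [set y | y <= a])//.
by apply: preimage_closed; [move=> x _; exact: cf|exact: closed_le].
Qed.

Lemma ecball_compact n (a : R) : compact (@ecball R n a).
Proof.
apply: bounded_closed_compact; last exact: closed_enorm_le (@enorm_continuous n).
exists a; split; first exact: num_real.
move=> M aM x /= xa; exact: le_trans (norm_le_enorm _) (le_trans xa (ltW aM)).
Qed.

Lemma eball_open n (a : R) : open (@eball R n a).
Proof.
rewrite (_ : eball _ = (@enorm R n) @^-1` [set y | y < a])//.
by apply: open_comp; [move=> x _; exact: enorm_continuous|exact: open_lt].
Qed.

Lemma rV_continuous n (T : topologicalType) (f : T -> 'rV[R]_n) x :
  (forall i, {for x, continuous (fun y => f y 0 i)}) -> {for x, continuous f}.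
Proof.
move=> cf; apply/cvg_ballP => e e0.
have h i : \forall y \near x, ball (f x 0 i) e (f y 0 i).
  by have /cvg_ballP/(_ _ e0) := cf i.
have H := filter_forall _ h; near=> y; split=> // i j.
by rewrite (ord1 i); move: j; near: y; exact: H.
Unshelve. all: by end_near.
Qed.

Lemma mulmx_rV_continuous n (A : 'M[R]_n) (x : 'rV[R]_n) :
  {for x, continuous (fun x : 'rV[R]_n => x *m A)}.
Proof.
apply: rV_continuous => i.
rewrite (_ : (fun _ => _) = (fun y : 'rV[R]_n => \sum_j y 0 j * A j i)).
  apply: sum_continuous => j; apply: continuousM; last exact: cst_continuous.
  exact: coord_continuous.
by apply/funext => y; rewrite mxE.
Qed.

(** A maximizer of the quadratic form on the unit sphere is an eigenvector. Completing it to an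
    orthonormal basis makes the matrix block diagonal, and the induction applies to the remaining
    block. *)
Lemma real_spectral n (A : 'M[R]_n) : A^T = A ->
  exists (S : 'M[R]_n) (d : 'rV[R]_n),
    S *m S^T = 1%:M /\ A = S^T *m diag_mx d *m S.
Proof.
elim: n => [|n IH] in A *.
  by move=> _; exists 1%:M, 0; split; rewrite ?trmx1 ?mulmx1//; apply/matrixP => -[].
move=> Asym.
have cq : continuous (qf A).
  move=> x; apply: (@dot_continuous n.+1 'rV[R]_n.+1 (fun y => y *m A) id x).
    exact: mulmx_rV_continuous.
  exact: cvg_id.
pose d0 : 'rV[R]_n.+1 := delta_mx 0 0.
have d01 : dot d0 d0 = 1.
  rewrite /dot (bigD1 ord0)//= big1 ?mxE ?eqxx ?mulr1 ?addr0// => i i0.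
  by rewrite !mxE (negbTE i0) andbF mulr0.
have [] := @EVT_max_rV R n.+1 (qf A) (@esphere R n.+1 1).
- by exists d0; rewrite /esphere /= enormE d01 sqrtr1.
- apply: bounded_closed_compact.
    exists 1; split; first exact: num_real.
    by move=> M aM x /= xa; apply: le_trans (norm_le_enorm _) _; rewrite xa ltW.
  rewrite (_ : esphere _ = (@enorm R n.+1) @^-1` [set 1])//.
  apply: preimage_closed; last exact: closed_eq.
  by move=> x _; exact: enorm_continuous.
- by apply: continuous_subspaceT => x; exact: cq.
move=> x; rewrite inE /esphere /= => x1 xmax.
have {}x1 : dot x x = 1 by rewrite -enorm_sqr x1 expr1n.
pose mu := qf A x.
have pos y : qf A y <= mu * dot y y.
  have [y0|y0] := eqVneq (dot y y) 0.
    by rewrite y0 (dot_eq0 y0) /qf mul0mx /dot big1 ?mulr0// => i _; rewrite mxE mul0r.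
  have yp : 0 < dot y y by rewrite lt_neqAle eq_sym y0 dot_ge0.
  pose s := (Num.sqrt (dot y y))^-1.
  have s2 : s * s = (dot y y)^-1 by rewrite -invfM -expr2 sqr_sqrtr// ltW.
  have := xmax (s *: y); rewrite inE /esphere /= enormE dotZl dotZr mulrA s2 mulVf//.
  rewrite sqrtr1 => /(_ erefl); rewrite /qf -scalemxAl dotZl dotZr mulrA s2.
  by rewrite mulrC ler_pdivrMr.
have key h : dot (x *m A) h = mu * dot x h.
  have bil a b : qf A (x + (a * b) *: h) =
      mu + 2 * (a * b) * dot (x *m A) h + (a * b) ^+ 2 * qf A h.
    rewrite /qf mulmxDl -scalemxAl !dot_lin -/(qf A x) -/mu.
    by rewrite [dot (h *m A) x]dot_mul Asym [dot h _]dotC; ring.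
  pose D := mu * dot x h - dot (x *m A) h.
  pose E := `|mu * dot h h - qf A h| + 1.
  have E0 : 0 < E by rewrite ltr_wpDl.
  (* With the step [- D / E] the linear term is [- 2 D^2 / E], while the quadratic one stays below
     [D^2 / E] by the choice of [E]; so [D] must vanish. *)
  have := pos (x + (- 1 * (D / E)) *: h); rewrite bil !dot_lin x1 (dotC h x) => posx.
  have {}E1 : mu * dot h h - qf A h < E by rewrite /E ltr_pwDr// ler_norm.
  suff : D = 0 by rewrite /D => /eqP; rewrite subr_eq0 => /eqP.
  apply/eqP; apply: contraT => D0.
  have D2 : 0 < D ^+ 2 / E by rewrite divr_gt0// exprn_even_gt0.
  have h1 : (D / E) ^+ 2 * (mu * dot h h - qf A h) < D ^+ 2 / E.
    rewrite [ltRHS](_ : _ = (D / E) ^+ 2 * E); last by field; rewrite gt_eqF.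
    by rewrite ltr_pM2l// exprn_even_gt0//= mulf_neq0// invr_eq0 gt_eqF.
  have h2 : D / E * D = D ^+ 2 / E by field; rewrite gt_eqF.
  move: posx; rewrite -subr_ge0; set X := (X in 0 <= X).
  have -> : X = (D / E) ^+ 2 * (mu * dot h h - qf A h) - 2 * (D / E * D).
    by rewrite /X /D; ring.
  by rewrite h2 leNgt subr_lt0 (lt_trans h1)// ltr_pMl// ltr1n.
have [T [TT Tx]] := orth_complete x1.
have TT' : T^T *m T = 1%:M by apply: mulmx1C.
pose B := T *m A *m T^T.
have Bsym : B^T = B by rewrite /B !trmx_mul trmxK Asym mulmxA.
have B0 j : B 0 j = mu *+ (0 == j).
  have -> : B 0 j = dot (row 0 (T *m A)) (row j T).
    by rewrite !mxE; apply: eq_bigr => k _; rewrite !mxE.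
  rewrite row_mul Tx key -mulr_natr; congr (_ * _); rewrite -Tx.
  have /matrixP/(_ 0 j) := TT; rewrite !mxE => <-.
  by rewrite /dot; apply: eq_bigr => k _; rewrite !mxE.
(* The dimensions [n.+1] and [1 + n] are convertible; the second one exposes the blocks. *)
pose B' : 'M[R]_(1 + n) := B.
have B'0 (i : 'I_1) k : B' (lshift n i) k = mu *+ (0%N == k :> nat).
  have -> : lshift n i = (ord0 : 'I_(1 + n)) by apply/val_inj; rewrite /= (ord1 i).
  by rewrite /B' B0.
have B'0' (i : 'I_1) k : B' k (lshift n i) = mu *+ (0%N == k :> nat).
  by rewrite -(B'0 i) {1}/B' -Bsym mxE.
have B'E : B' = block_mx mu%:M 0 0 (drsubmx B').
  rewrite -[LHS]submxK; congr block_mx.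
  - by apply/matrixP => i j; rewrite 2![LHS]mxE B'0 mxE (ord1 i) (ord1 j) !eqxx.
  - by apply/matrixP => i j; rewrite 2![LHS]mxE B'0 mxE.
  - by apply/matrixP => i j; rewrite 2![LHS]mxE B'0' mxE.
have [|S [d [SS dE]]] := IH (drsubmx B').
  by rewrite trmx_drsub /B' Bsym.
pose S' : 'M[R]_(1 + n) := block_mx 1%:M 0 0 S.
pose d' : 'rV[R]_(1 + n) := row_mx mu%:M d.
have S'T : S'^T = block_mx 1%:M 0 0 S^T :> 'M[R]_(1 + n).
  by rewrite /S' tr_block_mx !trmx0 trmx1.
have SS' : S' *m S'^T = 1%:M :> 'M[R]_(1 + n).
  rewrite S'T /S' mulmx_block SS !mulmx0 !mul0mx !mulmx1 !addr0 !add0r.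
  exact/esym/(@scalar_mx_block _ 1 n 1).
have BE : B' = S'^T *m diag_mx d' *m S' :> 'M[R]_(1 + n).
  rewrite B'E S'T /S' /d' diag_mx_row !mulmx_block !mulmx0 !mul0mx.
  rewrite !mulmx1 !mul1mx !addr0 !add0r mul0mx -dE.
  congr block_mx; apply/matrixP => i j.
  by rewrite (ord1 i) (ord1 j) !mxE eqxx !mulr1n.
exists ((S' : 'M[R]_n.+1) *m T), d'; split.
  rewrite trmx_mul mulmxA -[X in X *m _]mulmxA TT mulmx1.
  exact: SS'.
have -> : A = T^T *m B *m T.
  by rewrite /B !mulmxA TT' mul1mx -mulmxA TT' mulmx1.
rewrite trmx_mul -!mulmxA; congr (_ *m _); rewrite !mulmxA; congr (_ *m _).
exact: BE.
Qed.

Lemma qf_diag n (S : 'M[R]_n) (d : 'rV[R]_n) x :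
  qf (S^T *m diag_mx d *m S) x = \sum_i d 0 i * dot (row i S) x ^+ 2.
Proof.
rewrite /qf !mulmxA dot_mul /dot; apply: eq_bigr => i _.
have -> : (x *m S^T) 0 i = dot (row i S) x.
  by rewrite mxE; apply: eq_bigr => j _; rewrite !mxE mulrC.
have -> : (x *m S^T *m diag_mx d) 0 i = (x *m S^T) 0 i * d 0 i.
  by rewrite mul_mx_diag mxE.
have -> : (x *m S^T) 0 i = dot (row i S) x.
  by rewrite mxE; apply: eq_bigr => j _; rewrite !mxE mulrC.
by rewrite mulrC mulrA expr2 mulrC mulrA.
Qed.

Lemma parseval n (S : 'M[R]_n) x : S *m S^T = 1%:M ->
  \sum_i dot (row i S) x ^+ 2 = dot x x.
Proof.
move=> /mulmx1C SS; rewrite -qf1 -SS.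
have -> : S^T *m S = S^T *m diag_mx (const_mx 1) *m S.
  by rewrite diag_const_mx mulmx1.
by rewrite qf_diag; apply: eq_bigr => i _; rewrite mxE mul1r.
Qed.

Lemma row_orth n (S : 'M[R]_n) i j : S *m S^T = 1%:M ->
  dot (row i S) (row j S) = (i == j)%:R.
Proof.
move=> /matrixP/(_ i j); rewrite !mxE => <-.
by apply: eq_bigr => k _; rewrite !mxE.
Qed.

Lemma char_poly_diag n (S : 'M[R]_n) (d : 'rV[R]_n) : S *m S^T = 1%:M ->
  char_poly (S^T *m diag_mx d *m S) = \prod_i ('X - (d 0 i)%:P).
Proof.
move=> SS; have SS' := mulmx1C SS.
transitivity (char_poly (diag_mx d)); last first.
  rewrite char_poly_trig ?diag_mx_is_trig//; apply: eq_bigr => i _.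
  by rewrite mxE eqxx mulr1n.
pose f := map_mx (@polyC R).
have fS : f _ _ (S^T) *m f _ _ S = 1%:M by rewrite -map_mxM SS' map_mx1.
have -> : char_poly (S^T *m diag_mx d *m S) =
    \det (f _ _ (S^T) *m char_poly_mx (diag_mx d) *m f _ _ S).
  congr (\det _); rewrite /char_poly_mx !map_mxM mulmxBr mulmxBl; congr (_ - _).
  by rewrite mul_mx_scalar -scalemxAl fS scalemx1.
rewrite !det_mulmx mulrAC -det_mulmx fS det1 mul1r.
by [].
Qed.

(** The factorization of the characteristic polynomial determines the chosen list up to permutation
    only, which a sum does not see. The diagonalization shows that the default value of [xget] does
    not occur. *)
Lemma eigenvalues_sum n (S : 'M[R]_n) (d : 'rV[R]_n) (f : R -> R) :
  S *m S^T = 1%:M ->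
  \sum_(e <- eigenvalues (S^T *m diag_mx d *m S)) f e = \sum_i f (d 0 i).
Proof.
move=> SS; set A := _ *m S.
have : char_poly A = \prod_(e <- eigenvalues A) ('X - e%:P).
  rewrite /eigenvalues; case: xgetP => [s _ //|/(_ [seq d 0 i | i : 'I_n])] /=.
  rewrite (char_poly_diag _ SS) /image_mem big_map enumT.
  by move=> [].
rewrite (char_poly_diag _ SS).
have -> : \prod_i ('X - (d 0 i)%:P) = \prod_(e <- [seq d 0 i | i : 'I_n]) ('X - e%:P).
  by rewrite big_map enumT.
move=> /prod_XsubC_eq /(perm_big _) <-.
by rewrite big_map enumT.
Qed.

(** Two free slopes treat both extremal operators at once: [(cp, cm)] is [(Lam, lam)] for the
    maximal operator and [(lam, Lam)] for the minimal one. *)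
Definition pm (cp cm s : R) : R := if 0 < s then cp * s else cm * s.

Definition pucci (cp cm : R) n (A : 'M[R]_n) : R :=
  \sum_(e <- eigenvalues A) pm cp cm e.

Lemma pucciE cp cm n (A : 'M[R]_n) : pucci cp cm A =
  cp * (\sum_(e <- eigenvalues A | 0 < e) e) +
  cm * (\sum_(e <- eigenvalues A | e < 0) e).
Proof.
rewrite /pucci !mulr_sumr [X in _ = X + _]big_mkcond [X in _ = _ + X]big_mkcond.
rewrite -big_split; apply: eq_bigr => e _ /=; rewrite /pm.
by case: ltgtP => [_|_|<-]; rewrite ?addr0 ?add0r ?mulr0.
Qed.

Lemma pucci_supE lam Lam n : @pucci_sup R n lam Lam = @pucci Lam lam n.
Proof. by apply/funext => A; rewrite pucciE. Qed.

Lemma pucci_infE lam Lam n : @pucci_inf R n lam Lam = @pucci lam Lam n.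
Proof. by apply/funext => A; rewrite pucciE. Qed.

Lemma pucci_diag cp cm n (S : 'M[R]_n) (d : 'rV[R]_n) : S *m S^T = 1%:M ->
  pucci cp cm (S^T *m diag_mx d *m S) = \sum_i pm cp cm (d 0 i).
Proof. exact: eigenvalues_sum. Qed.

Lemma pucci_orth cp cm n (S A : 'M[R]_n) : A^T = A -> S *m S^T = 1%:M ->
  pucci cp cm (S *m A *m S^T) = pucci cp cm A.
Proof.
move=> /real_spectral[T [d [TT ->]]] SS.
rewrite pucci_diag//.
have -> : S *m (T^T *m diag_mx d *m T) *m S^T =
    (T *m S^T)^T *m diag_mx d *m (T *m S^T).
  by rewrite trmx_mul trmxK !mulmxA.
rewrite pucci_diag// trmx_mul trmxK mulmxA -[X in X *m _]mulmxA.
by rewrite (mulmx1C SS) mulmx1.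
Qed.

(** The Hessian of a radial function in dimension [n + 1] has this form: [a + b] is the radial
    eigenvalue, and [a] is the tangential one, of multiplicity [n]. *)
Lemma pucci_scalar_outer cp cm n (a b : R) (x : 'rV[R]_n.+1) : dot x x = 1 ->
  pucci cp cm (a%:M + b *: (x^T *m x)) = pm cp cm (a + b) + n%:R * pm cp cm a.
Proof.
move=> /orth_complete[S [SS Sx]].
pose d : 'rV[R]_n.+1 := \row_i (a + b *+ (i == 0)).
have -> : a%:M + b *: (x^T *m x) = S^T *m diag_mx d *m S.
  have -> : diag_mx d = a%:M + b *: delta_mx 0 0.
    apply/matrixP => i j; rewrite !mxE mulrnDl; congr (_ + _).
    have [->|i0] := eqVneq i 0; last by rewrite mulr0n mul0rn mulr0.
    by rewrite eq_sym /= mulr1n mulr_natr.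
  rewrite mulmxDr mulmxDl mul_mx_scalar -scalemxAl (mulmx1C SS) scalemx1.
  congr (_ + _); rewrite -scalemxAr -scalemxAl; congr (_ *: _).
  rewrite -Sx; apply/matrixP => i j.
  rewrite mxE big_ord1 !mxE (bigD1 0)//= [X in _ + X]big1 ?addr0; last first.
    move=> k k0; rewrite !mxE big1 ?mul0r// => l _.
    by rewrite !mxE (negbTE k0) andbF mulr0.
  rewrite !mxE (bigD1 0)//= [X in _ + X]big1 ?addr0 ?mxE ?eqxx ?mulr1//.
  by move=> l l0; rewrite !mxE (negbTE l0) mulr0.
rewrite pucci_diag// big_ord_recl mxE eqxx mulr1n; congr (_ + _).
under eq_bigr do rewrite mxE /= mulr0n addr0.
by rewrite sumr_const card_ord mulr_natl.
Qed.

Lemma pmZ cp cm a s : 0 <= a -> pm cp cm (a * s) = a * pm cp cm s.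
Proof.
rewrite le_eqVlt => /predU1P[<-|a0]; first by rewrite !mul0r /pm ltxx mulr0.
by rewrite /pm pmulr_rgt0//; case: ifP => _; ring.
Qed.

Lemma pm_lip cp cm lam s t : 0 < lam -> lam <= cp -> lam <= cm -> s <= t ->
  pm cp cm s + lam * (t - s) <= pm cp cm t.
Proof.
by move=> l0 lp lm st; rewrite /pm; case: ltP => s0; case: ltP => t0; nra.
Qed.

(* [pm Lam lam] is the maximum and [pm lam Lam] the minimum of the linear
   functions of slope in [lam, Lam]: freezing the slopes of one of the two
   matrices linearizes the difference from one side. *)
Lemma pucci_sub cp cm lam Lam n (A B : 'M[R]_n) :
  0 < lam -> lam <= Lam -> (cp = Lam /\ cm = lam) \/ (cp = lam /\ cm = Lam) ->
  A^T = A -> B^T = B ->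
  exists (S : 'M[R]_n) (c : 'I_n -> R), [/\ S *m S^T = 1%:M,
    forall k, lam <= c k <= Lam &
    pucci cp cm A - pucci cp cm B <= \sum_k c k * qf (A - B) (row k S)].
Proof.
move=> l0 lL; have L0 := lt_le_trans l0 lL.
pose sl (e : R) := if 0 < e then cp else cm.
have pmE e : pm cp cm e = sl e * e by rewrite /pm /sl; case: ifP.
have own (C S : 'M[R]_n) (d : 'rV[R]_n) : S *m S^T = 1%:M ->
    C = S^T *m diag_mx d *m S ->
    pucci cp cm C = \sum_k sl (d 0 k) * qf C (row k S).
  move=> SS CE; rewrite {1}CE pucci_diag//; apply: eq_bigr => k _.
  rewrite pmE; congr (_ * _); rewrite CE qf_diag (bigD1 k)//= big1 ?addr0.
    by rewrite row_orth// eqxx expr1n mulr1.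
  by move=> i ik; rewrite row_orth// (negbTE ik) expr0n mulr0.
have other (C S T : 'M[R]_n) (d : 'rV[R]_n) (c : 'I_n -> R) :
    S *m S^T = 1%:M -> T *m T^T = 1%:M -> C = T^T *m diag_mx d *m T ->
    (forall k, lam <= c k <= Lam) ->
    exists kap : 'I_n -> R, (forall j, lam <= kap j <= Lam) /\
      \sum_k c k * qf C (row k S) = \sum_j kap j * d 0 j.
  move=> SS TT CE cb.
  (* By Parseval each weight is a convex combination of the [c k], hence again a slope between [lam]
     and [Lam]. *)
  exists (fun j => \sum_k c k * dot (row j T) (row k S) ^+ 2); split.
    move=> j; have Sj : \sum_k dot (row j T) (row k S) ^+ 2 = 1.
      under eq_bigr do rewrite dotC.
      by rewrite parseval// row_orth// eqxx.
    rewrite -[lam]mulr1 -[Lam]mulr1 -Sj !mulr_sumr.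
    by apply/andP; split; apply: ler_sum => k _; rewrite ler_wpM2r ?sqr_ge0//;
      have /andP[] := cb k.
  rewrite CE; under eq_bigr do rewrite qf_diag mulr_sumr.
  rewrite exchange_big; apply: eq_bigr => j _ /=.
  by rewrite mulr_suml; apply: eq_bigr => k _; ring.
have slb e : (cp = Lam /\ cm = lam) \/ (cp = lam /\ cm = Lam) -> lam <= sl e <= Lam.
  by rewrite /sl => -[] [-> ->]; case: ifP => _; rewrite lexx lL.
move=> hc /real_spectral[S [d [SS AE]]] /real_spectral[T [e [TT BE]]].
(* The maximal operator dominates every such linear function, so the slopes of [A] are frozen and
   tested on [B]; for the minimal operator the roles are exchanged. *)
case: (hc) => -[cpE cmE].
- have [kap [kb kE]] := other B S T e (fun k => sl (d 0 k)) SS TT BE (fun k => slb _ hc).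
  exists S, (fun k => sl (d 0 k)); split=> //; first by move=> k; exact: slb.
  under [leRHS]eq_bigr do rewrite qfD qfN mulrBr.
  rewrite sumrB -(own A S d)// lerD2l lerN2 kE {1}BE pucci_diag//.
  apply: ler_sum => j _; have /andP[k1 k2] := kb j; rewrite /pm cpE cmE.
  by case: ltP => ej; nra.
- have [kap [kb kE]] := other A T S d (fun k => sl (e 0 k)) TT SS AE (fun k => slb _ hc).
  exists T, (fun k => sl (e 0 k)); split=> //; first by move=> k; exact: slb.
  under [leRHS]eq_bigr do rewrite qfD qfN mulrBr.
  rewrite sumrB -(own B T e)// lerD2r kE {1}AE pucci_diag//.
  apply: ler_sum => j _; have /andP[k1 k2] := kb j; rewrite /pm cpE cmE.
  by case: ltP => ej; nra.
Qed.

End linear_algebra.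

(** * Directional derivatives *)


Section calculus.
Context {R : realType}.

Lemma nbhs_eps (V : normedModType R) (x : V) (P : V -> Prop) :
  nbhs x P <-> exists2 d : R, 0 < d & forall y, `|y - x| < d -> P y.
Proof.
split=> [/nbhs_normP[d /= d0 dP]|[d d0 dP]].
  by exists d => // y; rewrite distrC => yx; apply: dP.
by apply/nbhs_normP; exists d => // y /= yx; apply: dP; rewrite distrC.
Qed.

Lemma continuous_eps (V : normedModType R) (f : V -> R) (x : V) :
  {for x, continuous f} <->
  forall e : R, 0 < e -> exists2 d : R, 0 < d & forall y, `|y - x| < d -> `|f y - f x| < e.
Proof.
split=> [/cvgrPdist_lt cf e e0|H].
  have /nbhs_eps[d d0 dP] := cf e e0.
  by exists d => // y /dP; rewrite distrC.
apply/cvgrPdist_lt => e e0; apply/nbhs_eps.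
by have [d d0 dP] := H e e0; exists d => // y /dP; rewrite distrC.
Qed.

Lemma is_derive_eps (V : normedModType R) (f : V -> R) (x v : V) (d : R) :
  is_derive x v f d <->
  forall e : R, 0 < e -> exists2 del : R, 0 < del & forall h : R, `|h| < del ->
    `|f (x + h *: v) - f x - h * d| <= e * `|h|.
Proof.
have E (h : R) : h != 0 -> d - h^-1 *: ((f \o shift x) (h *: v) - f x) =
    - (h^-1 * (f (x + h *: v) - f x - h * d)).
  by move=> h0; rewrite /= (addrC (h *: v)) /GRing.scale /=; field.
split.
- move=> [df dE] e e0.
  have : h^-1 *: ((f \o shift x) (h *: v) - f x) @[h --> 0^'] --> d.
    by rewrite -dE.
  move=> /cvgrPdist_le/(_ e e0); rewrite /dnbhs /within /= => /nbhs_eps[del del0 H].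
  exists del => // h hd.
  have [->|h0] := eqVneq h 0.
    by rewrite scale0r addr0 mul0r subr0 subrr normr0 mulr0.
  have := H h; rewrite subr0 => /(_ hd h0); rewrite E// normrN normrM normfV.
  by rewrite mulrC ler_pdivrMr ?normr_gt0.
- move=> H.
  have c : h^-1 *: ((f \o shift x) (h *: v) - f x) @[h --> 0^'] --> d.
    apply/cvgrPdist_le => e e0; rewrite /dnbhs /within /=; apply/nbhs_eps.
    have [del del0 Hd] := H e e0; exists del => // h; rewrite subr0 => hd h0.
    rewrite E// normrN normrM normfV mulrC ler_pdivrMr ?normr_gt0//.
    exact: Hd.
  split; last exact/cvg_lim.
  by apply/cvg_ex; exists d.
Qed.

Lemma is_derive_line (V : normedModType R) (f : V -> R) (x v : V) (t d : R) :
  is_derive (x + t *: v) v f d <-> is_derive t 1 (fun s : R => f (x + s *: v)) d.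
Proof.
split=> /is_derive_eps H; apply/is_derive_eps => e /H[del del0 Hd];
  exists del => // h /Hd.
  by rewrite [h *: 1]mulr1 scalerDl addrA.
by rewrite [h *: 1]mulr1 scalerDl addrA.
Qed.

Lemma is_derive_cont (g : R -> R) (t d : R) : is_derive t 1 g d -> {for t, continuous g}.
Proof. by move=> [/derivable1_diffP/differentiable_continuous]. Qed.

Lemma MVT_le (g dg : R -> R) (a b : R) : a <= b ->
  (forall t : R, a <= t <= b -> is_derive t 1 g (dg t)) ->
  exists2 c, a <= c <= b & g b - g a = dg c * (b - a).
Proof.
move=> ab H; have [||c cab ce] := @MVT_segment R g dg a b ab.
- by move=> t; rewrite in_itv /= => /andP[t1 t2]; apply: H; rewrite !ltW.
- apply: derivable_within_continuous => t; rewrite in_itv /= => tab.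
  by have [] := H t tab.
- by exists c => //; move: cab; rewrite in_itv.
Qed.

Lemma MVT_lt (g dg : R -> R) (a b : R) : a < b ->
  (forall t : R, a <= t <= b -> is_derive t 1 g (dg t)) ->
  exists2 c, a < c < b & g b - g a = dg c * (b - a).
Proof.
move=> ab H; have [||c cab ce] := @MVT R g dg a b ab.
- by move=> t; rewrite in_itv /= => /andP[t1 t2]; apply: H; rewrite !ltW.
- apply: derivable_within_continuous => t; rewrite in_itv /= => tab.
  by have [] := H t tab.
- by exists c => //; move: cab; rewrite in_itv.
Qed.

Lemma MVT_two (g dg : R -> R) (a b : R) :
  (forall t : R, `|t - a| <= `|b - a| -> is_derive t 1 g (dg t)) ->
  exists2 c, `|c - a| <= `|b - a| & g b - g a = dg c * (b - a).
Proof.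
move=> H; have [ab|ba] := leP a b.
  have [t /andP[t1 t2]|c /andP[c1 c2] ce] := @MVT_le g dg a b ab.
    by apply: H; rewrite !ger0_norm ?subr_ge0// lerD2r.
  by exists c => //; rewrite !ger0_norm ?subr_ge0// lerD2r.
have [t /andP[t1 t2]|c /andP[c1 c2] ce] := @MVT_le g dg b a (ltW ba).
  by apply: H; rewrite !ler0_norm ?subr_le0 ?(ltW ba)// lerN2 lerD2r.
exists c; first by rewrite !ler0_norm ?subr_le0 ?(ltW ba)// lerN2 lerD2r.
by rewrite -opprB ce -mulrN opprB.
Qed.

(** The derivative [g1] vanishes at the minimum. A negative [d] would make it negative just to the
    right of 0, and the mean value theorem would bring [g] below its minimum. Differentiability of
    [g1] at the single point 0 suffices. *)
Lemma second_order_min (g g1 : R -> R) (d : R) :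
  (\forall t \near (0 : R), is_derive (t : R) 1 g (g1 t)) ->
  is_derive (0 : R) 1 g1 d -> (\forall t \near (0 : R), g 0 <= g t) -> 0 <= d.
Proof.
move=> /nbhs_eps[a a0 Ha] dg1 /nbhs_eps[b b0 Hb].
pose c := Num.min a b.
have c0 : 0 < c by rewrite lt_min a0 b0.
have Hc (t : R) : `|t| < c -> is_derive t 1 g (g1 t) /\ g 0 <= g t.
  by rewrite lt_min => /andP[ta tb]; split; [apply: Ha|apply: Hb]; rewrite subr0.
have g10 : g1 0 = 0.
  have [] := @derive1_at_min R g (- c) c 0.
  - by rewrite ge0_cp// ltW.
  - by move=> t; rewrite in_itv /= -ltr_norml => /Hc[[]].
  - by rewrite in_itv /= oppr_lt0 c0.
  - by move=> t; rewrite in_itv /= -ltr_norml => /Hc[].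
  have h00 : `|0 : R| < c by rewrite normr0.
  by have [[_ E] _] := Hc 0 h00; move=> _ D0; rewrite -E.
rewrite leNgt; apply/negP => d0.
have [|del del0 Hd] := (is_derive_eps _ _ _ _).1 dg1 (- d / 2); first by rewrite divr_gt0// oppr_gt0.
pose t := Num.min c del / 2.
have t0 : 0 < t by rewrite divr_gt0// lt_min c0 del0.
have tm : t < Num.min c del by rewrite ltr_pdivrMr// ltr_pMr ?ltr1n// lt_min c0 del0.
have [tc td] : t < c /\ t < del by move: tm; rewrite lt_min => /andP[].
have [s /andP[s0 st]|s /andP[s0 st] gE] := @MVT_lt g g1 0 t t0.
  by have [] := Hc s; rewrite ?ger0_norm// (le_lt_trans st).
have neg (u : R) : 0 < u -> u < del -> g1 u < 0.
  move=> u0 ud; have := Hd u; rewrite gtr0_norm// => /(_ ud).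
  rewrite g10 subr0 add0r [_%:A]mulr1 => /(le_trans (ler_norm _)) => h.
  have : u * (d / 2) < 0 by rewrite pmulr_rlt0// pmulr_llt0// invr_gt0.
  by nra.
have [_ gt0] : is_derive t 1 g (g1 t) /\ g 0 <= g t by apply: Hc; rewrite gtr0_norm.
have g1s := neg s s0 (lt_trans st td).
have : g1 s * (t - 0) < 0 by rewrite nmulr_rlt0// subr0.
by rewrite -gE subr_lt0 ltNge gt0.
Qed.

End calculus.

(** * Chain rule along lines and symmetry of the Hessian *)

Section multivariate.
Context {R : realType} {n : nat}.
Implicit Types (x y xi : 'rV[R]_n) (U : set 'rV[R]_n) (f : 'rV[R]_n -> R).

Local Notation e_ i := (delta_mx (0 : 'I_1) i : 'rV[R]_n).

Lemma norm_delta (i : 'I_n) : `|e_ i| <= 1.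
Proof.
rewrite [leLHS]/Num.Def.normr /= mx_normrE; apply: bigmax_le => // -[k j] _ /=.
by rewrite mxE; case: (_ && _); rewrite ?normr1 ?normr0 ?ler01.
Qed.

Lemma C1_on_derive U f x i : C1_on U f -> U x -> is_derive x (e_ i) f (partial i f x).
Proof. by move=> Uf Ux; have [_ /(_ i)[df _]] := Uf x Ux; exact: derivableP. Qed.

Lemma line_derive f x xi (t d : R) : is_derive (x + t *: xi) xi f d ->
  is_derive t 1 (fun s : R => f (x + s *: xi)) d.
Proof. exact: (is_derive_line f x xi t d).1. Qed.

(** [C1_on] speaks of derivatives along the axes only. The increment is telescoped over the
    coordinates, and each term is a one-variable mean value theorem whose partial derivative is
    close to its value at [x]. *)
Lemma C1_chain U f x xi : open U -> C1_on U f -> U x ->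
  is_derive x xi f (\sum_i xi 0 i * partial i f x).
Proof.
move=> oU Uf Ux; apply/is_derive_eps.
pose P (s : seq 'I_n) : 'rV[R]_n := \sum_(i <- s) xi 0 i *: e_ i.
have claim (s : seq 'I_n) (e : R) : 0 < e ->
  exists2 del : R, 0 < del & forall h : R, `|h| < del ->
    `|f (x + h *: P s) - f x - h * \sum_(i <- s) xi 0 i * partial i f x| <= e * `|h|.
  elim: s e => [|i s IH] e e0.
    exists 1 => // h _; rewrite /P !big_nil scaler0 addr0 mulr0 subr0 subrr normr0.
    by rewrite mulr_ge0// ltW.
  have e20 : 0 < e / 2 by rewrite divr_gt0.
  have [d1 d10 H1] := IH _ e20.
  pose e' := e / 2 / (`|xi 0 i| + 1).
  have e'0 : 0 < e' by rewrite divr_gt0// ltr_wpDl.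
  have [_ /(_ i)[_ /continuous_eps/(_ e' e'0)[d2 d20 H2]]] := Uf x Ux.
  have [d3 d30 H3] := (nbhs_eps _ _).1 (open_nbhs_nbhs (conj oU Ux)).
  pose L := `|P s| + `|xi 0 i| + 1.
  have L0 : 0 < L by rewrite ltr_wpDl// addr_ge0.
  pose m := Num.min d2 d3.
  have m0 : 0 < m by rewrite lt_min d20 d30.
  exists (Num.min d1 (m / L)); first by rewrite lt_min d10 divr_gt0.
  move=> h; rewrite lt_min => /andP[hd1 hm].
  have hm' : `|h| * L < m by rewrite -ltr_pdivlMr.
  pose y := x + h *: P s.
  have close t : `|t - 0| <= `|h * xi 0 i - 0| -> `|y + t *: e_ i - x| < m.
    rewrite !subr0 => th; rewrite /y addrC addrA addKr.
    apply: le_lt_trans (ler_normD _ _) _; rewrite !normrZ.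
    apply: le_lt_trans hm'; rewrite /L 2!mulrDr mulr1 -addrA; apply: lerD => //.
    rewrite -normrM; apply: ler_wpDr => //; rewrite -[leRHS]mulr1.
    by apply: ler_pM => //; exact: norm_delta.
  have [t tc|c cc ce] := @MVT_two R (fun t : R => f (y + t *: e_ i))
      (fun t : R => partial i f (y + t *: e_ i)) 0 (h * xi 0 i).
    apply: line_derive; apply: C1_on_derive Uf _; apply: H3.
    by have := close t tc; rewrite /m lt_min => /andP[].
  have := close c cc; rewrite /m lt_min => /andP[/H2 cd _].
  have := H1 h hd1; rewrite /P !big_cons -/(P s) => H1h.
  move: ce; rewrite scale0r addr0 subr0 => ce.
  have -> : x + h *: (xi 0 i *: e_ i + P s) = y + (h * xi 0 i) *: e_ i.
    by rewrite /y scalerDr scalerA -addrA [h *: P s + _]addrC.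
  set S := \sum_(_ <- _) _ in H1h *.
  have -> : f (y + (h * xi 0 i) *: e_ i) - f x - h * (xi 0 i * partial i f x + S) =
      (f y - f x - h * S) + h * xi 0 i * (partial i f (y + c *: e_ i) - partial i f x).
    by rewrite -(subrK (f y) (f (y + _ *: _))) ce; ring.
  apply: le_trans (ler_normD _ _) _; rewrite [e]splitr mulrDl; apply: lerD => //.
  rewrite !normrM -mulrA mulrC; apply: ler_wpM2r => //.
  apply: (@le_trans _ _ (`|xi 0 i| * e')); first by apply: ler_wpM2l => //; exact: ltW.
  by rewrite /e' mulrA ler_pdivrMr ?ltr_wpDl// mulrC ler_pM2l// lerDl.
move=> e /(claim (index_enum 'I_n))[del del0 H]; exists del => // h /H.
have -> // : P (index_enum 'I_n) = xi.
by rewrite /P [RHS]row_sum_delta.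
Qed.

Lemma C1_chain_line U f x xi t : open U -> C1_on U f -> U (x + t *: xi) ->
  is_derive t 1 (fun s : R => f (x + s *: xi)) (\sum_i xi 0 i * partial i f (x + t *: xi)).
Proof. by move=> oU Uf Ux; apply: line_derive; exact: C1_chain Uf Ux. Qed.

Lemma C2_chain_line U f x xi t : open U -> C2_on U f -> U (x + t *: xi) ->
  is_derive t 1 (fun s : R => \sum_i xi 0 i * partial i f (x + s *: xi))
    (qf (hessian f (x + t *: xi)) xi).
Proof.
move=> oU [_ Uf] Ux.
have H i : is_derive t 1 (fun s : R => xi 0 i * partial i f (x + s *: xi))
    (xi 0 i * \sum_j xi 0 j * partial j (partial i f) (x + t *: xi)).
  by apply: is_deriveZ; exact: C1_chain_line (Uf i) Ux.
have -> : (fun s : R => \sum_i xi 0 i * partial i f (x + s *: xi)) =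
    \sum_i (fun s : R => xi 0 i * partial i f (x + s *: xi)).
  by apply/funext => s; rewrite fct_sumE.
apply: (is_derive_eq (is_derive_sum H)).
rewrite qfE; apply: eq_bigr => i _; rewrite mulr_sumr; apply: eq_bigr => j _.
by rewrite mxE mulrA.
Qed.

(** The second difference over a small square, computed by two mean value theorems in either order,
    equals [h^2] times each of the two mixed derivatives at nearby points; continuity closes the
    gap. *)
Lemma hessian_sym U f x : open U -> C2_on U f -> U x -> (hessian f x)^T = hessian f x.
Proof.
move=> oU [Uf Uff] Ux; apply/matrixP => i j; rewrite !mxE.
apply/eqP; rewrite -subr_eq0 -normr_le0; apply/ler_addgt0Pr => e e0; rewrite add0r.
have e20 : 0 < e / 2 by rewrite divr_gt0.
have [_ /(_ j)[_ /continuous_eps/(_ _ e20)[d1 d10 H1]]] := Uff i x Ux.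
have [_ /(_ i)[_ /continuous_eps/(_ _ e20)[d2 d20 H2]]] := Uff j x Ux.
have [d3 d30 H3] := (nbhs_eps _ _).1 (open_nbhs_nbhs (conj oU Ux)).
pose m := Num.min d1 (Num.min d2 d3).
have m0 : 0 < m by rewrite !lt_min d10 d20 d30.
pose h := m / 3.
have h0 : 0 < h by rewrite divr_gt0.
have close (a b : R) (k l : 'I_n) : 0 <= a <= h -> 0 <= b <= h ->
    `|x + a *: e_ k + b *: e_ l - x| < m.
  move=> /andP[a0 ah] /andP[b0 bh]; rewrite addrAC [x + _]addrC addrK.
  apply: le_lt_trans (ler_normD _ _) _; rewrite !normrZ !ger0_norm//.
  have h1 := ler_wpM2l a0 (norm_delta k); have h2 := ler_wpM2l b0 (norm_delta l).
  have m3 : m = h * 3 by rewrite /h mulfVK.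
  by rewrite m3; lra.
have inU a b k l : 0 <= a <= h -> 0 <= b <= h -> U (x + a *: e_ k + b *: e_ l).
  by move=> ha hb; apply: H3; have := close a b k l ha hb; rewrite !lt_min => /and3P[].
have key (k l : 'I_n) : exists a b, [/\ 0 <= a <= h, 0 <= b <= h &
    f (x + h *: e_ k + h *: e_ l) - f (x + h *: e_ k) - (f (x + h *: e_ l) - f x) =
    h * h * partial l (partial k f) (x + a *: e_ k + b *: e_ l)].
  have hh : 0 <= h <= h by rewrite lexx ltW.
  have h00 : 0 <= (0 : R) <= h by rewrite lexx ltW.
  have [t th|a ah aE] := @MVT_le R (fun s : R => f (x + h *: e_ l + s *: e_ k) - f (x + s *: e_ k))
     (fun s : R => partial k f (x + h *: e_ l + s *: e_ k) - partial k f (x + s *: e_ k)) 0 h (ltW h0).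
    apply: is_deriveB; apply: line_derive; apply: C1_on_derive Uf _; first exact: inU.
    by have := inU t 0 k l th h00; rewrite scale0r addr0.
  have [t th|b bh bE] := @MVT_le R (fun s : R => partial k f (x + a *: e_ k + s *: e_ l))
     (fun s : R => partial l (partial k f) (x + a *: e_ k + s *: e_ l)) 0 h (ltW h0).
    by apply: line_derive; apply: C1_on_derive (Uff k) _; exact: inU.
  exists a, b; split=> //; move: aE bE.
  rewrite !scale0r !addr0 subr0 (addrAC x (h *: e_ l)) (addrAC x (h *: e_ l) (a *: _)).
  by move=> -> ->; ring.
have [a [b [ah bh abE]]] := key i j.
have [c [d [ch dh cdE]]] := key j i.
have E : partial j (partial i f) (x + a *: e_ i + b *: e_ j) =
    partial i (partial j f) (x + c *: e_ j + d *: e_ i).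
  apply: (@mulfI _ (h * h)); first by rewrite mulf_neq0// gt_eqF.
  have ac (p q r t : R) : p - q - (r - t) = p - r - (q - t) by ring.
  by rewrite -[LHS]abE -[RHS]cdE ac (addrAC x (h *: e_ j)).
have := close a b i j ah bh; rewrite lt_min => /andP[/H1 k1 _].
have := close c d j i ch dh; rewrite !lt_min => /and3P[_ /H2 k2 _].
move: k1 k2; rewrite E.
set u := partial i (partial j f) _; set v := partial j _ _; set w := partial i _ x.
move=> k1 k2; rewrite [e]splitr.
rewrite (_ : w - v = (u - v) - (u - w)); last by ring.
exact: le_trans (ler_normB _ _) (lerD (ltW k1) (ltW k2)).
Qed.

End multivariate.

(** * Radial functions *)


Section radial_calculus.
Context {R : realType} {n : nat}.
Implicit Types (x xi : 'rV[R]_n) (f : R -> R).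

Local Notation e_ i := (delta_mx (0 : 'I_1) i : 'rV[R]_n).

Lemma quad_derive (a b c t : R) : is_derive t 1 (fun s : R => a + b * s + c * s ^+ 2) (b + 2 * c * t).
Proof.
apply/is_derive_eps => e e0; exists (e / (`|c| + 1)); first by rewrite divr_gt0// ltr_wpDl.
move=> h; rewrite [h *: 1]mulr1 ltr_pdivlMr ?ltr_wpDl// => he.
rewrite (_ : _ - _ - _ = c * h * h); last by ring.
rewrite !normrM; apply: ler_wpM2r => //; apply: le_trans (ltW he).
by rewrite mulrC ler_wpM2l// lerDl.
Qed.

Lemma dot_line x xi (t : R) :
  dot (x + t *: xi) (x + t *: xi) = dot x x + (2 * dot x xi) * t + dot xi xi * t ^+ 2.
Proof. by rewrite !dot_lin (dotC xi x); ring. Qed.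

Lemma dot_delta x i : dot x (e_ i) = x 0 i.
Proof.
rewrite /dot (bigD1 i)//= big1 ?addr0; first by rewrite mxE !eqxx mulr1.
by move=> j ji; rewrite mxE (negbTE ji) andbF mulr0.
Qed.

Lemma enorm_gt0 x : x != 0 -> 0 < enorm x.
Proof.
move=> x0; rewrite lt_neqAle enorm_ge0 andbT eq_sym; apply: contra_neq x0 => h.
by apply: dot_eq0; rewrite -enorm_sqr h expr0n.
Qed.

Lemma enorm0 : enorm (0 : 'rV[R]_n) = 0.
Proof.
by rewrite enormE (_ : dot _ _ = 0) ?sqrtr0// /dot big1// => i _; rewrite mxE mul0r.
Qed.

Lemma enorm_derive x xi : 0 < enorm x -> is_derive x xi (@enorm R n) (dot x xi / enorm x).
Proof.
move=> x0; rewrite -[x]addr0 -(scale0r xi); apply/is_derive_line.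
rewrite scale0r addr0.
have -> : (fun s : R => enorm (x + s *: xi)) =
    Num.sqrt \o (fun t : R => dot x x + (2 * dot x xi) * t + dot xi xi * t ^+ 2).
  by apply/funext => s /=; rewrite enormE dot_line.
have x2 : 0 < dot x x by rewrite -enorm_sqr exprn_gt0.
have q0 : 0 < dot x x + 2 * dot x xi * 0 + dot xi xi * 0 ^+ 2 by rewrite mulr0 addr0 expr0n mulr0 addr0.
have H := @is_derive1_comp R Num.sqrt _ 0 _ _ (is_derive1_sqrt q0)
  (quad_derive (dot x x) (2 * dot x xi) (dot xi xi) 0).
apply: (is_derive_eq H).
by rewrite mulr0 addr0 expr0n mulr0 addr0 mulr0 addr0 -enormE; field; rewrite gt_eqF.
Qed.

Lemma radial_derive f x xi d : 0 < enorm x -> is_derive (enorm x) 1 f d ->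
  is_derive x xi (fun y => f (enorm y)) (d * (dot x xi / enorm x)).
Proof.
move=> x0 fd; rewrite -[x]addr0 -(scale0r xi); apply/is_derive_line.
have h : is_derive (0 : R) 1 (fun s : R => enorm (x + s *: xi)) (dot x xi / enorm x).
  by apply: line_derive; rewrite scale0r addr0; exact: enorm_derive.
rewrite scale0r addr0.
apply: (@is_derive1_comp _ f (fun s : R => enorm (x + s *: xi))) h.
by rewrite scale0r addr0.
Qed.

Lemma coord_derive x i j : is_derive x (e_ j) (fun y : 'rV[R]_n => y 0 i) ((i == j)%:R).
Proof.
apply/is_derive_eps => e e0; exists 1 => // h _.
have -> : (x + h *: e_ j : 'rV[R]_n) 0 i = x 0 i + h * (i == j)%:R.
  by rewrite !mxE eqxx.
rewrite (_ : _ - _ - _ = 0); last by ring.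
by rewrite normr0 mulr_ge0// ltW.
Qed.

Lemma partial_eq (u : 'rV[R]_n -> R) x i d : is_derive x (e_ i) u d -> partial i u x = d.
Proof. by case. Qed.

Lemma partial_near (u w : 'rV[R]_n -> R) x i : (\near x, u x = w x) ->
  \near x, partial i u x = partial i w x.
Proof.
move=> H; have := (near_join H); apply: filterS => y uw.
exact: near_eq_derive.
Qed.

Lemma radial_hessian (u : 'rV[R]_n -> R) (f f1 : R -> R) x (f2 : R) : 0 < enorm x ->
  (\forall s \near enorm x, is_derive (s : R) 1 f (f1 s)) ->
  is_derive (enorm x) 1 f1 f2 ->
  (\near x, u x = f (enorm x)) ->
  hessian u x = (f1 (enorm x) / enorm x)%:M +
    (f2 - f1 (enorm x) / enorm x) *: (((enorm x)^-1 *: x)^T *m ((enorm x)^-1 *: x)).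
Proof.
move=> x0 df df1 uf; set r := enorm x.
have cx : \forall y \near x, 0 < enorm y /\ is_derive (enorm y) 1 f (f1 (enorm y)).
  have H : \forall s \near enorm x, 0 < (s : R) /\ is_derive (s : R) 1 f (f1 s).
    apply: filterS2 df (lt_nbhsr x0) => s ? ?; by split.
  exact: (@enorm_continuous R n x _ H).
have p1 i : \near x, partial i u x = f1 (enorm x) / enorm x * x 0 i.
  have := partial_near i uf; apply: filterS2 cx => y [y0 dy] ->.
  by rewrite (partial_eq (@radial_derive _ _ (e_ i) _ y0 dy)) dot_delta; ring.
apply/matrixP => i j; rewrite mxE.
have -> : partial j (partial i u) x =
    partial j (fun y => f1 (enorm y) / enorm y * y 0 i) x.
  by apply: near_eq_derive; exact: p1.
have dg : is_derive r 1 (fun s : R => f1 s / s) (f2 / r - f1 r / r ^+ 2).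
  have r0 : r != 0 by rewrite gt_eqF.
  have dV : is_derive r 1 (fun s : R => s^-1) (- r ^- 2).
    apply: (is_derive_eq (@is_deriveV R id r 1 1 r0 (is_derive_id _ _))).
    by rewrite [_ *: 1]mulr1.
  apply: (is_derive_eq (is_deriveM df1 dV)).
  by rewrite -/r /GRing.scale /=; field.
have H := is_deriveM (@radial_derive _ _ (e_ j) _ x0 dg) (coord_derive x i j).
rewrite (partial_eq H) dot_delta !mxE big_ord1 !mxE /GRing.scale /=.
by rewrite -/r -mulr_natr; field; rewrite gt_eqF.
Qed.

(* With f' = - r y, the gradient - y(|x|) x and the Hessian
   - y(|x|) I - (y'(|x|) / |x|) x^T x extend continuously to the origin, the
   rank-one term being O(r y'). *)
Lemma radial_C2 (f y y1 : R -> R) (C : R) :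
  (forall r : R, 0 < r -> is_derive r 1 f (- (r * y r))) ->
  (forall r : R, 0 < r < 1 -> `|f r - f 0| <= C * r ^+ 2) ->
  (forall r : R, 0 < r -> is_derive r 1 y (y1 r)) ->
  (forall r : R, 0 < r -> {for r, continuous y1}) ->
  (forall e : R, 0 < e -> exists2 d : R, 0 < d & forall r : R, 0 < r < d ->
     `|y r - y 0| < e /\ `|r * y1 r| < e) ->
  C2_on setT (fun x : 'rV[R]_n => f (enorm x)) /\
  forall x, hessian (fun x : 'rV[R]_n => f (enorm x)) x =
    (- y (enorm x))%:M - (y1 (enorm x) / enorm x) *: (x^T *m x).
Proof.
move=> df f0 dy cy1 H0.
pose u x := f (enorm x); pose c x := y (enorm x).
have eh (h : R) i : enorm (h *: e_ i) = `|h|.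
  rewrite enormE dotZl dotZr dot_delta mxE !eqxx mulr1 -expr2.
  exact: sqrtr_sqr.
have eC (T : R -> R) x : x != 0 -> {for enorm x, continuous T} ->
    {for x, continuous (fun x : 'rV[R]_n => T (enorm x))}.
  by move=> x0 cT; apply: (continuous_comp (@enorm_continuous R n x)).
have cz (T : 'rV[R]_n -> R) : (forall e : R, 0 < e ->
    exists2 d : R, 0 < d & forall z, 0 < enorm z < d -> `|T z - T 0| < e) ->
    {for (0 : 'rV[R]_n), continuous T}.
  move=> H; apply/continuous_eps => e e0; have [d d0 Hd] := H e e0.
  have /continuous_eps/(_ d d0)[del del0 Hdel] := @enorm_continuous R n 0.
  exists del => // z /Hdel; rewrite enorm0 subr0 ger0_norm ?enorm_ge0// => zd.
  have [z0|z0] := eqVneq (z : 'rV[R]_n) 0.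
    have -> : T z - T 0 = 0 by rewrite z0 subrr.
    by rewrite normr0.
  by apply: Hd; rewrite enorm_gt0.
have cy x : {for x, continuous c}.
  have [->|x0] := eqVneq x 0; last first.
    by apply: (eC _ _ x0); exact: is_derive_cont (dy _ (enorm_gt0 x0)).
  apply: cz => e /H0[d d0 Hd]; exists d => // z /Hd[+ _].
  by rewrite /c enorm0.
have d1 x i : is_derive x (e_ i) u (- (c x * x 0 i)).
  have [->|x0] := eqVneq x 0.
    rewrite mxE mulr0 oppr0; apply/is_derive_eps => e e0.
    exists (Num.min 1 (e / (`|C| + 1))).
      by rewrite lt_min ltr01 divr_gt0// ltr_wpDl.
    move=> h; rewrite lt_min ltr_pdivlMr ?ltr_wpDl// => /andP[h1 he].
    rewrite add0r mulr0 subr0 /u eh enorm0.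
    have [->|h0] := eqVneq h 0; first by rewrite normr0 subrr normr0 mulr0.
    have h0' : 0 < `|h| by rewrite normr_gt0.
    apply: le_trans (f0 _ _) _; first by rewrite h0' h1.
    rewrite expr2 mulrA ler_wpM2r// (le_trans _ (ltW he))// mulrC.
    by rewrite ler_wpM2l// (le_trans (ler_norm _))// lerDl.
  have r0 := enorm_gt0 x0.
  apply: (is_derive_eq (@radial_derive _ _ (e_ i) _ r0 (df _ r0))).
  by rewrite dot_delta /c; field; rewrite gt_eqF.
have p1 i : partial i u = fun x => - (c x * x 0 i).
  by apply/funext => x; exact: partial_eq (d1 x i).
pose k x := y1 (enorm x) / enorm x.
have d2 x i j : is_derive x (e_ j) (partial i u)
    (- (c x * (i == j)%:R + k x * (x 0 i * x 0 j))).
  rewrite p1; have [->|x0] := eqVneq x 0.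
    rewrite !mxE mulr0 mulr0 addr0; apply/is_derive_eps => e e0.
    have /continuous_eps/(_ e e0)[d d0 Hd] := cy 0.
    exists d => // h hd; rewrite add0r !mxE eqxx /= mulr0 oppr0 subr0.
    rewrite (_ : _ - _ = - (h * (i == j)%:R * (c (h *: e_ j) - c 0))); last by ring.
    rewrite normrN normrM mulrC; apply: ler_pM => //.
      apply: ltW; apply: Hd; rewrite subr0 normrZ.
      by apply: le_lt_trans hd; rewrite ler_piMr// norm_delta.
    by case: eqP; rewrite ?mulr1 ?mulr0 ?normr0.
  have r0 := enorm_gt0 x0.
  have H := is_deriveN (is_deriveM (@radial_derive _ _ (e_ j) _ r0 (dy _ r0)) (coord_derive x i j)).
  apply: (is_derive_eq H).
  by rewrite dot_delta /c /k /GRing.scale /=; field; rewrite gt_eqF.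
have p2 i j : partial j (partial i u) = fun x => - (c x * (i == j)%:R + k x * (x 0 i * x 0 j)).
  by apply/funext => x; exact: partial_eq (d2 x i j).
have cc x i : {for x, continuous (fun x : 'rV[R]_n => x 0 i)} by exact: coord_continuous.
have cp1 x i : {for x, continuous (partial i u)}.
  by rewrite p1; apply: continuousN; apply: continuousM; [exact: cy|exact: cc].
have cp2 x i j : {for x, continuous (partial j (partial i u))}.
  rewrite p2; apply: continuousN; apply: continuousD.
    by apply: continuousM; [exact: cy|exact: cst_continuous].
  have [->|x0] := eqVneq x 0; last first.
    have r0 := enorm_gt0 x0.
    apply: continuousM; last by apply: continuousM; exact: cc.
    apply: continuousM; first exact: eC x0 (cy1 _ r0).
    by apply: continuousV; [rewrite gt_eqF|exact: enorm_continuous].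
  apply: cz => e /H0[d d0 Hd]; exists d => // z zd; have [_ Hz] := Hd _ zd.
  have z0i l : (0 : 'rV[R]_n) 0 l = 0 by rewrite mxE.
  rewrite !z0i !mulr0 subr0; apply: le_lt_trans Hz.
  have /andP[z0 _] := zd.
  have -> : `|k z * (z 0 i * z 0 j)| = `|y1 (enorm z)| * (`|z 0 i| * `|z 0 j| / enorm z).
    by rewrite /k !normrM normfV (gtr0_norm z0); field; rewrite gt_eqF.
  rewrite normrM (gtr0_norm z0) [leRHS]mulrC; apply: ler_wpM2l => //.
  by rewrite ler_pdivrMr//; apply: ler_pM => //; exact: coord_le_enorm.
have cu x : {for x, continuous u}.
  have [->|x0] := eqVneq x 0; last first.
    by apply: (eC _ _ x0); exact: is_derive_cont (df _ (enorm_gt0 x0)).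
  apply: cz => e e0; exists (Num.min 1 (e / (`|C| + 1))).
    by rewrite lt_min ltr01 divr_gt0// ltr_wpDl.
  move=> z; rewrite lt_min ltr_pdivlMr ?ltr_wpDl// => /and3P[z0 z1 ze].
  rewrite /u enorm0; apply: le_lt_trans (f0 _ _) _; first by rewrite z0 z1.
  apply: le_lt_trans ze; rewrite expr2 mulrA mulrC.
  apply: ler_wpM2l; first exact: ltW.
  apply: (@le_trans _ _ `|C|); last by rewrite lerDl.
  apply: (@le_trans _ _ (`|C| * enorm z)); first by rewrite ler_pM2r// ler_norm.
  by rewrite ler_piMr// ltW.
split; last first.
  move=> x; apply/matrixP => i j; rewrite mxE p2 !mxE big_ord1 !mxE /c /k.
  by rewrite -mulr_natr; ring.
split.
  by move=> x _; split=> // i; split=> //; have [] := d1 x i.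
by move=> i x _; split=> // j; split=> //; have [] := d2 x i j.
Qed.

End radial_calculus.

(** * Radial comparison principles *)


Section one_variable.
Context {R : realType}.
Implicit Types (f g h dh D : R -> R) (a b r s t e d : R).

(** Profiles matter on [[0, T)] only, so continuity at the left end is one-sided. *)
Definition rcont f a := forall e, 0 < e ->
  exists2 d, 0 < d & forall r, a <= r < a + d -> `|f r - f a| < e.

Lemma rcont_of_derive f a d : is_derive a 1 f d -> rcont f a.
Proof.
move=> /is_derive_cont/continuous_eps cf e /cf[del del0 H]; exists del => // r /andP[ar rd].
by apply: H; rewrite ger0_norm ?subr_ge0// ltrBlDl.
Qed.

Lemma rcontB f g a : rcont f a -> rcont g a -> rcont (fun r => f r - g r) a.
Proof.
move=> cf cg e e0; have e2 : 0 < e / 2 by rewrite divr_gt0.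
have [d d0 Hd] := cf _ e2; have [d' d'0 Hd'] := cg _ e2.
exists (Num.min d d'); first by rewrite lt_min d0 d'0.
move=> r /andP[ar]; rewrite -ltrBlDl lt_min !ltrBlDl => /andP[r1 r2].
rewrite (_ : _ - _ - _ = (f r - f a) - (g r - g a)); last by ring.
rewrite [e]splitr; apply: le_lt_trans (ler_normB _ _) _.
by apply: ltrD; [apply: Hd|apply: Hd']; rewrite ar.
Qed.

Lemma rcont_lin c a : rcont (fun r => c * r) a.
Proof.
apply: (@rcont_of_derive _ _ c); apply/is_derive_eps => e e0; exists 1 => // h _.
rewrite [h *: 1]mulr1 (_ : _ - _ - _ = 0); last by ring.
by rewrite normr0 mulr_ge0// ltW.
Qed.

Lemma lin_derive c r : is_derive r 1 (fun r : R => c * r) c.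
Proof.
apply/is_derive_eps => e e0; exists 1 => // h _.
rewrite [h *: 1]mulr1 (_ : _ - _ - _ = 0); last by ring.
by rewrite normr0 mulr_ge0// ltW.
Qed.

(** Continuous induction: the set of points up to which [P] holds contains its supremum by the
    closing hypothesis, and by the opening one this supremum is not less than [b]. *)
Lemma real_ind (P : R -> Prop) b :
  P 0 -> (forall r, 0 <= r < b -> (forall t, 0 <= t <= r -> P t) ->
    exists2 d, 0 < d & forall t, r < t < r + d -> P t) ->
  (forall r, 0 < r <= b -> (forall t, 0 <= t < r -> P t) -> P r) ->
  forall r, 0 <= r <= b -> P r.
Proof.
move=> P0 Po Pc r /andP[r0 rb].
pose S : set R := [set s | 0 <= s <= b /\ forall t, 0 <= t <= s -> P t].
have b0 := le_trans r0 rb.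
have S0 : S 0.
  by split; [rewrite lexx b0|move=> t t0; have -> : t = 0 by apply/eqP; rewrite eq_le andbC].
have supS : has_sup S.
  by split; [exists 0|exists b => s [/andP[]]].
have s0 : 0 <= sup S by apply: ub_le_sup => //; case: supS.
have sb : sup S <= b by apply: ge_sup; [exists 0|move=> s [/andP[]]].
have below t : 0 <= t < sup S -> P t.
  move=> /andP[t0 ts]; have ts' : 0 < sup S - t by rewrite subr_gt0.
  have [s [_ sP] st] := sup_adherent ts' supS.
  by apply: sP; rewrite t0/= ltW// (le_lt_trans _ st)// subKr.
have Ps : P (sup S).
  have [->//|sn0] := eqVneq (sup S) 0.
  by apply: Pc => //; rewrite sb andbT lt_neqAle eq_sym sn0.
have upto t : 0 <= t <= sup S -> P t.
  by move=> /andP[t0]; rewrite le_eqVlt => /predU1P[->//|ts]; apply: below; rewrite t0.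
have [sE|sltb] := eqVneq (sup S) b; first by apply: upto; rewrite r0 sE.
have {}sltb : sup S < b by rewrite lt_neqAle sltb.
have [|d d0 Hd] := Po (sup S) _ upto; first by rewrite s0.
pose s' := sup S + Num.min (d / 2) (b - sup S).
have m0 : 0 < Num.min (d / 2) (b - sup S) by rewrite lt_min divr_gt0//= subr_gt0.
suff : S s'.
  move=> /(ub_le_sup supS.2); rewrite /s' gerDl => /(lt_le_trans m0).
  by rewrite ltxx.
split.
  rewrite /s' addr_ge0 ?(ltW m0)//=.
  by rewrite -lerBrDl ge_min lexx orbT.
move=> t /andP[t0 ts']; have [ts|st] := leP t (sup S); first by apply: upto; rewrite t0.
apply: Hd; rewrite st/=; apply: le_lt_trans ts' _; rewrite ltrD2l gt_min.
by rewrite ltr_pdivrMr// ltr_pMr// ltr1n.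
Qed.

Lemma geom_le (x c q : R) : 0 <= q < 1 -> (forall m, x <= c * q ^+ m) -> x <= 0.
Proof.
move=> /andP[q0 q1] H; apply/ler_addgt0Pr => e e0; rewrite add0r.
have /cvgrPdist_lt/(_ (e / (`|c| + 1))) : @GRing.exp R q @ \oo --> (0 : R).
  by apply: cvg_expr; rewrite ger0_norm.
have c1 : 0 < `|c| + 1 by rewrite ltr_wpDl.
move=> /(_ (divr_gt0 e0 c1))[m _ /(_ m (leqnn m))] /=.
rewrite sub0r normrN ger0_norm ?exprn_ge0// ltr_pdivlMr// => h.
apply: le_trans (H m) _; apply: le_trans (ltW h).
rewrite mulrC ler_wpM2l ?exprn_ge0//.
by apply: le_trans (ler_norm _) _; rewrite lerDl.
Qed.

Lemma right_nincr h dh a b : a <= b -> rcont h a ->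
  (forall r, a < r <= b -> is_derive r 1 h (dh r)) ->
  (forall r, a < r <= b -> dh r <= 0) -> h b <= h a.
Proof.
move=> ab ch ddh dh0; have [->//|anb] := eqVneq a b.
have {anb}ab : a < b by rewrite lt_neqAle anb.
apply/ler_addgt0Pr => e /ch[d d0 Hd].
pose c := a + Num.min (d / 2) (b - a).
have m0 : 0 < Num.min (d / 2) (b - a) by rewrite lt_min divr_gt0//= subr_gt0.
have ac : a < c by rewrite ltrDl.
have cb : c <= b by rewrite -lerBrDl ge_min lexx orbT.
have [t /andP[t1 t2]|t /andP[t1 t2] tE] := @MVT_le R h dh c b cb.
  by apply: ddh; rewrite t2 (lt_le_trans ac).
have hbc : h b <= h c.
  rewrite -subr_le0 tE mulr_le0_ge0 ?subr_ge0//.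
  by apply: dh0; rewrite t2 (lt_le_trans ac).
have : `|h c - h a| < e.
  apply: Hd; rewrite (ltW ac) ltrD2l gt_min.
  by rewrite ltr_pdivrMr// ltr_pMr// ltr1n.
by move=> /(le_lt_trans (ler_norm _)); rewrite ltrBlDl => /ltW/(le_trans hbc).
Qed.

(** Right of the last point where [D] is nonpositive, [D] is positive, hence nonincreasing, so it
    cannot have left the nonpositive range. The sign of the derivative is needed only where [D] is
    positive, which is all that the comparison of two equations provides. *)
Lemma nonpos_of_deriv D dh s : 0 <= s -> rcont D 0 -> D 0 <= 0 ->
  (forall r, 0 < r <= s -> is_derive r 1 D (dh r)) ->
  (forall r, 0 < r <= s -> 0 < D r -> dh r <= 0) -> D s <= 0.
Proof.
move=> s0 cD D0 dD neg; rewrite leNgt; apply/negP => Ds.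
have sn0 : 0 < s.
  by rewrite lt_neqAle s0 andbT; apply: contraTneq Ds => <-; rewrite -leNgt.
pose S : set R := [set r | 0 <= r <= s /\ D r <= 0].
have S0 : S 0 by split; rewrite ?lexx.
have supS : has_sup S by split; [exists 0|exists s => r [/andP[]]].
have a0 : 0 <= sup S by apply: ub_le_sup => //; case: supS.
have as_ : sup S <= s by apply: ge_sup; [exists 0|move=> r [/andP[]]].
have pos r : sup S < r <= s -> 0 < D r.
  move=> /andP[ar rs]; rewrite ltNge; apply/negP => Dr.
  have : S r by split=> //; rewrite rs (le_trans a0 (ltW ar)).
  by move=> /(ub_le_sup supS.2); rewrite leNgt ar.
have Da : D (sup S) <= 0.
  have [->//|an0] := eqVneq (sup S) 0.
  have {}an0 : 0 < sup S by rewrite lt_neqAle eq_sym an0.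
  have /dD/is_derive_cont/continuous_eps cDa : 0 < sup S <= s by rewrite an0.
  rewrite leNgt; apply/negP => /cDa[d d0 Hd].
  have [r [rs Dr] ra] := sup_adherent d0 supS.
  have rsup : r <= sup S by apply: ub_le_sup => //; case: supS.
  have := Hd r; rewrite ler0_norm ?subr_le0// opprB ltrBlDr -ltrBlDl => /(_ ra).
  rewrite ltr_norml => /andP[+ _]; rewrite ltrBrDl subrr => /lt_le_trans/(_ Dr).
  by rewrite ltxx.
have := @right_nincr D dh (sup S) s as_.
have [aE|an0] := eqVneq (sup S) 0.
  move=> /(_ _)/[dup]; rewrite aE => H _.
  have : D s <= D 0.
    apply: H => // r rs; apply: neg => //; apply: pos; rewrite aE//.
  by move=> /le_trans/(_ D0); rewrite leNgt Ds.
have {}an0 : 0 < sup S by rewrite lt_neqAle eq_sym an0.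
move=> H; have : D s <= D (sup S).
  apply: H => [|r /andP[ar rs]|r /andP[ar rs]].
  - by apply: rcont_of_derive (dD _ _); rewrite an0.
  - by apply: dD; rewrite rs (lt_trans an0 ar).
  - by apply: neg; rewrite ?rs ?(lt_trans an0 ar)//; apply: pos; rewrite ar.
by move=> /le_trans/(_ Da); rewrite leNgt Ds.
Qed.

End one_variable.

(** * Comparison and uniqueness for radial profiles *)

Section profiles.
Context {R : realType} (cp cm lam : R) (n : nat).
Hypotheses (lam0 : 0 < lam) (lamp : lam <= cp) (lamm : lam <= cm) (n0 : (0 < n)%N).
Implicit Types (f g h k : R -> R) (T r s t d : R).

Local Notation pm := (pm cp cm).

(* The radial form of M(D^2 u) + g = 0 on (0, T), u = f(|x|), in dimension n + 1. *)
Definition profile T f (f1 f2 : R -> R) g :=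
  [/\ f1 0 = 0, rcont f 0, rcont f1 0 & forall r : R, 0 < r < T ->
    [/\ is_derive r 1 f (f1 r), is_derive r 1 f1 (f2 r) &
        pm (f2 r) + n%:R * pm (f1 r / r) = - g r]].

(** The response of [f1 r / r] to a unit change of the right-hand side: the [n] tangential terms
    have slope at least [lam] each. *)
Definition kap : R := (n%:R * lam)^-1.

Lemma kap_gt0 : 0 < kap.
Proof. by rewrite invr_gt0 mulr_gt0// ltr0n. Qed.

Lemma pm_le s t : s <= t -> pm s <= pm t.
Proof.
move=> st; apply: le_trans (pm_lip lam0 lamp lamm st).
by rewrite lerDl mulr_ge0 ?subr_ge0// ltW.
Qed.

Lemma pm_lt s t : s < t -> pm s < pm t.
Proof.
move=> st; apply: lt_le_trans (pm_lip lam0 lamp lamm (ltW st)).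
by rewrite ltrDl mulr_gt0 ?subr_gt0.
Qed.

Lemma pm_le_inv s t : pm s <= pm t -> s <= t.
Proof. by apply: contraTT; rewrite -!ltNge; exact: pm_lt. Qed.

(** Where [f1] exceeds the bound, the tangential terms of [f] exceed those of [h] by at least [d],
    which outweighs the defect of the sources; the equations then give [f2 <= h2], so the excess
    does not grow. *)
Lemma profile_le T f f1 f2 g h h1 h2 k s d : profile T f f1 f2 g ->
  profile T h h1 h2 k -> 0 <= s < T -> 0 <= d ->
  (forall r, 0 < r <= s -> k r - d <= g r) -> f1 s <= h1 s + kap * d * s.
Proof.
move=> [f10 _ cf1 Hf] [h10 _ ch1 Hh] /andP[s0 sT] d0 kg.
have inT r : 0 < r <= s -> 0 < r < T by move=> /andP[-> rs]; exact: le_lt_trans sT.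
suff : f1 s - h1 s - kap * d * s <= 0 by rewrite -addrA -opprD subr_le0.
apply: (@nonpos_of_deriv _ (fun r => f1 r - h1 r - kap * d * r)
    (fun r => f2 r - h2 r - kap * d)) => //.
- by apply: rcontB; [exact: rcontB|exact: rcont_lin].
- by rewrite f10 h10 mulr0 !subr0.
- move=> r /inT rT; have [_ df1 _] := Hf r rT; have [_ dh1 _] := Hh r rT.
  exact: (is_deriveB (is_deriveB df1 dh1) (lin_derive _ _)).
- move=> r rs; have rT := inT r rs; have [_ _ fE] := Hf r rT; have [_ _ hE] := Hh r rT.
  have r0 : 0 < r by case/andP: rs.
  rewrite subr_gt0 ltrBrDl => /ltW D0.
  have : f2 r <= h2 r.
    apply: pm_le_inv; move: fE hE => /eqP; rewrite -subr_eq0 => /eqP fE /eqP.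
    rewrite -subr_eq0 => /eqP hE.
    have q : h1 r / r + kap * d <= f1 r / r.
      by rewrite ler_pdivlMr// mulrDl divfK ?gt_eqF.
    have kd : 0 <= kap * d by rewrite mulr_ge0// ltW// kap_gt0.
    have q1 : h1 r / r <= f1 r / r by apply: le_trans q; rewrite lerDl.
    have q2 := pm_lip lam0 lamp lamm q1.
    have q3 : lam * (kap * d) <= lam * (f1 r / r - h1 r / r).
      by rewrite ler_pM2l// lerBrDl.
    have nn : 0 <= n%:R :> R by [].
    have q4 : n%:R * (pm (h1 r / r) + lam * (kap * d)) <= n%:R * pm (f1 r / r).
      by rewrite ler_wpM2l// (le_trans _ q2)// lerD2l.
    have q5 : n%:R * (lam * (kap * d)) = d.
      by rewrite /kap; field; rewrite !gt_eqF ?ltr0n.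
    have := kg r rs; move: q4; rewrite mulrDr q5; lra.
  move=> f2h2; rewrite subr_le0; apply: (@le_trans _ _ 0); first by rewrite subr_le0.
  by rewrite mulr_ge0// ltW// kap_gt0.
Qed.

Lemma profile_sub T f f1 f2 g h h1 h2 k a b : profile T f f1 f2 g ->
  profile T h h1 h2 k -> 0 <= a <= b -> b < T ->
  (forall r, a < r <= b -> f1 r <= h1 r) -> f b - h b <= f a - h a.
Proof.
move=> [f10 cf cf1 Hf] [h10 ch ch1 Hh] /andP[a0 ab] bT le1.
have inT r : a < r <= b -> 0 < r < T.
  by move=> /andP[ar rb]; rewrite (le_lt_trans a0 ar) (le_lt_trans rb bT).
apply: (@right_nincr _ (fun r => f r - h r) (fun r => f1 r - h1 r)) => //.
- have [->|an0] := eqVneq a 0; first exact: rcontB.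
  have aT : 0 < a < T by rewrite lt_neqAle eq_sym an0 a0 (le_lt_trans ab).
  have [df _ _] := Hf a aT; have [dh _ _] := Hh a aT.
  by apply: rcontB; exact: rcont_of_derive.
- move=> r /inT rT; have [df _ _] := Hf r rT; have [dh _ _] := Hh r rT.
  exact: is_deriveB.
- by move=> r /le1; rewrite subr_le0.
Qed.

Lemma profile_rcont T f f1 f2 g a : profile T f f1 f2 g -> 0 <= a < T -> rcont f a.
Proof.
move=> [_ cf _ Hf] /andP[a0 aT]; have [->//|an0] := eqVneq a 0.
have [|df _ _] := Hf a; first by rewrite lt_neqAle eq_sym an0 a0 aT.
exact: rcont_of_derive df.
Qed.

Lemma profile_lcont T f f1 f2 g a : profile T f f1 f2 g -> 0 < a < T ->
  {for a, continuous f}.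
Proof. by move=> [_ cf _ Hf] /Hf[df _ _]; exact: is_derive_cont df. Qed.

Lemma left_lim_le f a c : 0 < a -> {for a, continuous f} ->
  (forall r, 0 <= r < a -> f r <= c) -> f a <= c.
Proof.
move=> a0 /continuous_eps cf H; apply/ler_addgt0Pr => e /cf[d d0 Hd].
pose r := a - Num.min (d / 2) a.
have m0 : 0 < Num.min (d / 2) a by rewrite lt_min divr_gt0.
have ra : 0 <= r < a by rewrite subr_ge0 ge_min lexx orbT gtrBl m0.
have := H r ra; have := Hd r; rewrite ler0_norm; last by rewrite subr_le0 ltW; case/andP: ra.
rewrite opprB /r subKr gt_min ltr_pdivrMr// ltr_pMr// ltr1n => /(_ isT).
by rewrite ltr_norml => /andP[+ _] => h1 h2; lra.
Qed.

(* The system is cooperative, but the signs of u' and v' reverse the order: a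
   larger v lowers u, which raises v further. *)
Lemma system_order (P Q : R -> R) T u u1 u2 v v1 v2 U U1 U2 V V1 V2 :
  {homo P : x y / x <= y} -> {homo Q : x y / x <= y} ->
  profile T u u1 u2 (P \o v) -> profile T v v1 v2 (Q \o u) ->
  profile T U U1 U2 (P \o V) -> profile T V V1 V2 (Q \o U) ->
  u 0 <= U 0 -> V 0 < v 0 ->
  forall r, 0 <= r < T ->
    [/\ u r <= U r, v 0 - V 0 <= v r - V r, u1 r <= U1 r & V1 r <= v1 r].
Proof.
move=> mP mQ pu pv pU pV u0 v0.
(* A weak order of [v] and [V] on [[0, s]] already yields the full gap [v 0 - V 0] at [s]. *)
have step s : 0 <= s < T -> (forall r, 0 <= r < s -> V r <= v r) -> V s <= v s ->
    [/\ u s <= U s, v 0 - V 0 <= v s - V s, u1 s <= U1 s & V1 s <= v1 s].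
  move=> /andP[s0 sT] H Hs.
  have H' r : 0 < r <= s -> V r <= v r.
    by move=> /andP[r0]; rewrite le_eqVlt => /predU1P[->//|rs]; apply: H; rewrite ltW.
  have u1U r : 0 <= r <= s -> u1 r <= U1 r.
    move=> /andP[r0 rs]; have := profile_le (s := r) (d := 0) pu pU.
    rewrite mulr0 mul0r addr0; apply => //; first by rewrite r0 (le_lt_trans rs).
    by move=> t /andP[t0 tr]; rewrite subr0 /= mP// H'// t0 (le_trans tr).
  have uU r : 0 <= r <= s -> u r <= U r.
    move=> /andP[r0 rs]; have := profile_sub (a := 0) (b := r) pu pU.
    rewrite lexx r0 => /(_ isT (le_lt_trans rs sT)) h.
    rewrite -subr_le0; apply: le_trans (h _) _; last by rewrite subr_le0.
    by move=> t /andP[t0 tr]; apply: u1U; rewrite (ltW t0) (le_trans tr).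
  have V1v r : 0 <= r <= s -> V1 r <= v1 r.
    move=> /andP[r0 rs]; have := profile_le (s := r) (d := 0) pV pv.
    rewrite mulr0 mul0r addr0; apply => //; first by rewrite r0 (le_lt_trans rs).
    by move=> t /andP[t0 tr]; rewrite subr0 /= mQ// uU// ltW//= (le_trans tr).
  have ss : 0 <= s <= s by rewrite s0 lexx.
  split; [exact: uU| |exact: u1U|exact: V1v].
  have := profile_sub (a := 0) (b := s) pV pv; rewrite lexx s0 => /(_ isT sT).
  have V1v' r : 0 < r <= s -> V1 r <= v1 r by move=> /andP[/ltW r0 rs]; rewrite V1v ?r0.
  move=> /(_ V1v').
  by rewrite -opprB -[X in _ <= X]opprB lerN2.
(* The strict order persists: at a first contact the weak order would hold up to that point, and
   [step] would give a positive gap there. *)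
have main s : 0 <= s < T -> forall r, 0 <= r <= s -> V r < v r.
  move=> /andP[s0 sT]; apply: real_ind => //.
  - move=> r /andP[r0 rs] H.
    have rT : 0 <= r < T by rewrite r0 (lt_trans rs).
    have c := rcontB (profile_rcont pv rT) (profile_rcont pV rT).
    have [|d d0 Hd] := c (v r - V r); first by rewrite subr_gt0 H// r0 lexx.
    exists d => // t /andP[rt td]; have := Hd t; rewrite (ltW rt) td => /(_ isT).
    by rewrite ltr_norml => /andP[+ _]; rewrite ltrBrDl subrr subr_gt0.
  - move=> r /andP[r0 rs] H.
    have rT : 0 < r < T by rewrite r0 (le_lt_trans rs).
    have Vr : V r - v r <= 0.
      apply: (@left_lim_le (fun r => V r - v r)) => //.
        by apply: continuousB; [exact: profile_lcont pV rT|exact: profile_lcont pv rT].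
      by move=> t /H/ltW; rewrite subr_le0.
    have [|||_ + _ _] := step r.
    + by case/andP: rT => ? ->; rewrite ltW.
    + by move=> t /H/ltW.
    + by rewrite -subr_le0.
    by rewrite -subr_gt0; apply: lt_le_trans; rewrite subr_gt0.
move=> r rT; have H := main r rT; apply: step => //.
  by move=> t /andP[t0 tr]; rewrite ltW// H// t0 ltW.
by rewrite ltW// H// lexx andbT; case/andP: rT.
Qed.

(** Lipschitz near positive points only, since powers with exponent below 1 are not Lipschitz at
    0. *)
Definition loc_lip (P : R -> R) := forall x, 0 < x -> exists L d, [/\ 0 < L, 0 < d &
  forall a b, `|a - x| < d -> `|b - x| < d -> `|P a - P b| <= L * `|a - b|].

(** [profile_le] in both directions bounds [f1 - h1] by [kap d t] up to [t]; integrating from [r],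
    where the values agree, gives the factor [t - r] that makes short intervals contractive. *)
Lemma profile_diff T f f1 f2 g h h1 h2 k r t d : profile T f f1 f2 g ->
  profile T h h1 h2 k -> 0 <= r <= t -> t < T -> 0 <= d -> f r = h r ->
  (forall s, 0 < s <= t -> `|g s - k s| <= d) ->
  `|f t - h t| <= kap * d * t * (t - r).
Proof.
move=> pf ph /andP[r0 rt] tT d0 fh gk.
have one f' f1' f2' g' h' h1' h2' k' : profile T f' f1' f2' g' -> profile T h' h1' h2' k' ->
    f' r = h' r -> (forall s, 0 < s <= t -> k' s - d <= g' s) ->
    f' t - h' t <= kap * d * t * (t - r).
  move=> pf' ph' fh' gk'.
  have le1 s : 0 <= s <= t -> f1' s <= h1' s + kap * d * t.
    move=> /andP[s0 st]; have := profile_le (s := s) (d := d) pf' ph'.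
    move=> /(_ _ d0) h0; apply: le_trans (h0 _ _) _.
    - by rewrite s0 (le_lt_trans st).
    - by move=> x /andP[x0 xs]; apply: gk'; rewrite x0 (le_trans xs).
    - by rewrite lerD2l ler_wpM2l// mulr_ge0// ltW// kap_gt0.
  case: pf' ph' => [_ cf _ Hf] [_ ch _ Hh].
  have := @right_nincr _ (fun s => f' s - h' s - kap * d * t * s)
    (fun s => f1' s - h1' s - kap * d * t) r t rt.
  rewrite fh' subrr sub0r => H; rewrite mulrBr lerBrDr -lerBrDl.
  have inT s : r < s <= t -> 0 < s < T.
    by move=> /andP[rs st]; rewrite (le_lt_trans r0 rs) (le_lt_trans st).
  suff : f' t - h' t - kap * d * t * t <= - (kap * d * t * r) by lra.
  apply: H.
  - apply: rcontB; last exact: rcont_lin.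
    have [->|rn0] := eqVneq r 0; first exact: rcontB.
    have [|df _ _] := Hf r; first by rewrite lt_neqAle eq_sym rn0 r0 (le_lt_trans rt).
    have [|dh _ _] := Hh r; first by rewrite lt_neqAle eq_sym rn0 r0 (le_lt_trans rt).
    by apply: rcontB; exact: rcont_of_derive.
  - move=> s /inT sT; have [df _ _] := Hf s sT; have [dh _ _] := Hh s sT.
    exact: (is_deriveB (is_deriveB df dh) (lin_derive _ _)).
  - move=> s /andP[rs st]; rewrite -addrA -opprD subr_le0.
    by apply: le1; rewrite (le_trans r0 (ltW rs)) st.
rewrite ler_norml; apply/andP; split; last first.
  apply: one pf ph fh _ => s /gk; rewrite ler_norml => /andP[]; lra.
rewrite -[X in _ <= X]opprB lerN2.
apply: one ph pf (esym fh) _ => s /gk; rewrite ler_norml => /andP[]; lra.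
Qed.

(** Continuation: beyond a point up to which the solutions agree, the local Lipschitz constants and
    [profile_diff] halve any bound on the differences over a short interval, so the differences
    vanish there. Positivity keeps the arguments of the nonlinearities where they are Lipschitz. *)
Lemma system_unique (P Q : R -> R) T u u1 u2 v v1 v2 U U1 U2 V V1 V2 :
  loc_lip P -> loc_lip Q ->
  profile T u u1 u2 (P \o v) -> profile T v v1 v2 (Q \o u) ->
  profile T U U1 U2 (P \o V) -> profile T V V1 V2 (Q \o U) ->
  u 0 = U 0 -> v 0 = V 0 ->
  (forall r, 0 <= r < T -> 0 < u r /\ 0 < v r) ->
  forall r, 0 <= r < T -> u r = U r /\ v r = V r.
Proof.
move=> lP lQ pu pv pU pV u0 v0 pos s /andP[s0 sT].
apply: (@real_ind _ (fun r => u r = U r /\ v r = V r) s); rewrite ?s0 ?lexx//; last first.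
  move=> r /andP[r0 rs] H.
  have rT : 0 < r < T by rewrite r0 (le_lt_trans rs).
  have eql f f1 f2 g h h1 h2 k : profile T f f1 f2 g -> profile T h h1 h2 k ->
      (forall t, 0 <= t < r -> f t = h t) -> f r = h r.
    move=> pf ph fh; apply/eqP; rewrite eq_le -subr_le0 -[X in _ && X]subr_le0.
    apply/andP; split.
      apply: (@left_lim_le (fun r => f r - h r)) => //.
        by apply: continuousB; [exact: profile_lcont pf rT|exact: profile_lcont ph rT].
      by move=> t /fh ->; rewrite subrr.
    apply: (@left_lim_le (fun r => h r - f r)) => //.
      by apply: continuousB; [exact: profile_lcont ph rT|exact: profile_lcont pf rT].
    by move=> t /fh ->; rewrite subrr.
  by split; [apply: eql pu pU _ => t /H[]|apply: eql pv pV _ => t /H[]].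
move=> r /andP[r0 rs] H.
have rT : 0 <= r < T by rewrite r0 (lt_trans rs).
have [ur vr] := pos r rT; have [uU vV] := H r (introT andP (conj r0 (lexx r))).
have [LP [dP [LP0 dP0 HP]]] := lP _ vr; have [LQ [dQ [LQ0 dQ0 HQ]]] := lQ _ ur.
have [e1 e10 He1] := profile_rcont pu rT dQ0.
have [e2 e20 He2] := profile_rcont pU rT dQ0.
have [e3 e30 He3] := profile_rcont pv rT dP0.
have [e4 e40 He4] := profile_rcont pV rT dP0.
pose L := Num.max LP LQ.
have LL : 0 < L by rewrite lt_max LP0.
pose C := kap * L * T.
have T0 : 0 < T by rewrite (le_lt_trans s0).
have C0 : 0 < C by rewrite !mulr_gt0// kap_gt0.
(* On an interval of length at most [e5] the contraction factor [kap L t (t - r)] is at most 1/2. *)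
pose e5 := (2 * C)^-1.
have e50 : 0 < e5 by rewrite invr_gt0 mulr_gt0.
pose d := Num.min (s - r) (Num.min e5 (Num.min (Num.min e1 e2) (Num.min e3 e4))).
have d0 : 0 < d by rewrite !lt_min subr_gt0 rs e50 e10 e20 e30 e40.
have near t : r <= t < r + d -> [/\ t < T, t - r < e5, `|u t - u r| < dQ,
    `|U t - u r| < dQ & `|v t - v r| < dP /\ `|V t - v r| < dP].
  move=> /andP[rt]; rewrite -ltrBlDl !lt_min => /and3P[t1 t2 /andP[/andP[t3 t4] /andP[t5 t6]]].
  split=> //.
  - by apply: lt_trans sT; rewrite ltrD2r in t1.
  - by apply: He1; rewrite rt -ltrBlDl.
  - by rewrite uU; apply: He2; rewrite rt -ltrBlDl.
  - by split; [apply: He3|rewrite vV; apply: He4]; rewrite rt -ltrBlDl.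
pose K := 2 * (dP + dQ).
have K0 : 0 < K by rewrite mulr_gt0// addr_gt0.
have tri (x y z c : R) : `|x - z| < c -> `|y - z| < c -> c <= dP + dQ -> `|x - y| <= K.
  move=> h1 h2 h3; rewrite (_ : x - y = (x - z) - (y - z)); last by ring.
  rewrite /K mulr_natl mulr2n (le_trans (ler_normB _ _))//.
  by rewrite lerD// (le_trans _ h3)// ltW.
have bound m t : r <= t < r + d ->
    `|u t - U t| <= K * (1 / 2) ^+ m /\ `|v t - V t| <= K * (1 / 2) ^+ m.
  elim: m t => [|m IH] t td.
    rewrite expr0 mulr1; have [_ _ a b [c e]] := near t td; split.
      by apply: tri a b _; rewrite lerDr ltW.
    by apply: tri c e _; rewrite lerDl ltW.
  have [tT t5 _ _ _] := near t td; have /andP[rt td'] := td.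
  pose B := L * (K * (1 / 2) ^+ m).
  have B0 : 0 <= B.
    apply: mulr_ge0; first exact: ltW.
    by apply: mulr_ge0; [exact: ltW|rewrite exprn_ge0// divr_ge0].
  have small : kap * B * t * (t - r) <= K * (1 / 2) ^+ m.+1.
    have -> : K * (1 / 2) ^+ m.+1 = kap * B * T * e5.
      rewrite exprS /e5 /C /B; field.
      by rewrite !gt_eqF// kap_gt0.
    have tT' := ltW tT; have t5' := ltW t5; have t0 := le_trans r0 rt.
    have kB : 0 <= kap * B by rewrite mulr_ge0// ltW// kap_gt0.
    apply: ler_pM => //; [exact: mulr_ge0|by rewrite subr_ge0|exact: ler_wpM2l].
  have PB s' : 0 < s' <= t -> `|(P \o v) s' - (P \o V) s'| <= B.
    move=> /andP[s'0 s't]; have [rs'|s'r] := leP r s'; last first.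
      have s'c : 0 <= s' <= r by rewrite (ltW s'0) (ltW s'r).
      by have [_ vE] := H s' s'c; rewrite /= vE subrr normr0.
    have sd : r <= s' < r + d by rewrite rs' (le_lt_trans s't).
    have [_ _ _ _ [c e]] := near _ sd; have [_ IHv] := IH _ sd.
    apply: le_trans (HP _ _ c e) _; apply: ler_pM => //; first exact: ltW.
    by rewrite le_max lexx.
  have QB s' : 0 < s' <= t -> `|(Q \o u) s' - (Q \o U) s'| <= B.
    move=> /andP[s'0 s't]; have [rs'|s'r] := leP r s'; last first.
      have s'c : 0 <= s' <= r by rewrite (ltW s'0) (ltW s'r).
      by have [uE _] := H s' s'c; rewrite /= uE subrr normr0.
    have sd : r <= s' < r + d by rewrite rs' (le_lt_trans s't).
    have [_ _ c e _] := near _ sd; have [IHu _] := IH _ sd.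
    apply: le_trans (HQ _ _ c e) _; apply: ler_pM => //; first exact: ltW.
    by rewrite le_max lexx orbT.
  have rt' : 0 <= r <= t by rewrite r0.
  split; apply: le_trans small.
    exact: profile_diff pu pU rt' tT B0 uU PB.
  exact: profile_diff pv pV rt' tT B0 vV QB.
exists d => // t /andP[rt td].
have td' : r <= t < r + d by rewrite ltW.
have z (x : R) : (forall m, `|x| <= K * (1 / 2) ^+ m) -> x = 0.
  move=> /geom_le; rewrite divr_ge0// ltr_pdivrMr// mul1r ltr1n => /(_ isT).
  by rewrite normr_le0 => /eqP.
split; apply/eqP; rewrite -subr_eq0; apply/eqP/z => m; by have [] := bound m t td'.
Qed.

End profiles.

(** * Weighted primitives *)


Section integrals.
Context {R : realType}.
Implicit Types (h k : R -> R) (a b r s T C c : R).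
Local Notation mu := (@lebesgue_measure R).

Lemma seq_le_lim (u : nat -> R) (l c : R) : u @ \oo --> l -> (forall m, u m <= c) -> l <= c.
Proof.
move=> ul uc; rewrite -(cvg_lim _ ul)//; apply: limr_le; first by apply/cvg_ex; exists l.
by apply: nearW => m; exact: uc.
Qed.

Lemma pow_derive (K : nat) (t : R) : is_derive t 1 (fun s : R => s ^+ K.+1) (K.+1%:R * t ^+ K).
Proof.
apply: DeriveDef; first exact: exprn_derivable.
by rewrite exp_derive [_ *: 1]mulr1.
Qed.

(** A class of integrands stable under locally bounded pointwise limits, as the iteration and the
    limits in [eta] require; continuity would not be. *)
Definition bounded_measurable h :=
  measurable_fun [set r : R | 0 <= r] h /\
  forall T, exists C, forall s, 0 <= s <= T -> `|h s| <= C.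

Definition prim h r := (\int[mu]_(s in `[0, r]) h s)%R.

Lemma bounded_measurable_cont h : (forall r, 0 < r -> {for r, continuous h}) ->
  (forall T, exists C, forall s, 0 <= s <= T -> `|h s| <= C) -> bounded_measurable h.
Proof.
move=> ch bh; split=> //.
have -> : [set r : R | 0 <= r] = [set 0] `|` [set r : R | 0 < r].
  by apply/seteqP; split=> r /=; [rewrite le_eqVlt => /predU1P[<-|->]; [left|right]|case=> [->|/ltW]].
have o : open [set r : R | 0 < r] by exact: open_gt.
apply/measurable_funU => //; first exact: open_measurable.
split; first exact: measurable_fun_set1.
by apply: open_continuous_measurable_fun => // r; rewrite inE => /ch.
Qed.

Lemma bm_integrable h T : bounded_measurable h -> mu.-integrable `[0, T] (EFin \o h).
Proof.
move=> [mh /(_ T)[C hC]]; apply: measurable_bounded_integrable => //.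
- by rewrite /= lebesgue_measure_itv /=; case: ifP => _; rewrite ?ltry.
- by apply: measurable_funS mh => //; [exact: closed_measurable (@closed_ge _ 0)|move=> r /=; rewrite in_itv /= => /andP[]].
- exists C; split; first exact: num_real.
  move=> M CM s /=; rewrite in_itv /= => sT; apply: le_trans (ltW CM).
  exact: hC.
Qed.

Lemma prim0 h : prim h 0 = 0.
Proof. by rewrite /prim set_itv1 Rintegral_set1. Qed.

Lemma prim_oc h r : bounded_measurable h -> prim h r = (\int[mu]_(s in `]0, r]) h s)%R.
Proof.
move=> gh; rewrite /prim Rintegral_itv_obnd_cbnd//.
by apply: integrableS (bm_integrable r gh) => //; apply: subset_itvr; rewrite bnd_simp.
Qed.

Lemma prim_le h k r : bounded_measurable h -> bounded_measurable k ->
  (forall s, 0 < s <= r -> h s <= k s) -> prim h r <= prim k r.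
Proof.
have sub : [set` `]0, r]] `<=` [set` `[0, r]] by apply: subset_itvr; rewrite bnd_simp.
move=> gh gk hk; rewrite !prim_oc//; apply: le_Rintegral => //.
- exact: integrableS (bm_integrable r gh).
- exact: integrableS (bm_integrable r gk).
Qed.

Lemma prim_incr h a b : bounded_measurable h -> (forall s, 0 <= s -> 0 <= h s) ->
  0 <= a <= b -> prim h a <= prim h b.
Proof.
move=> gh h0 /andP[a0 ab]; rewrite -subr_ge0 /prim Rintegral_itvB ?bnd_simp//.
  apply: Rintegral_ge0 => s /=; rewrite in_itv /= => /andP[s0 _].
  by apply: h0; rewrite (le_trans a0)// ltW.
exact: bm_integrable.
Qed.

Lemma prim_lt0 h r : r < 0 -> prim h r = 0.
Proof. by move=> r0; rewrite /prim set_itv_ge ?Rintegral_set0// bnd_simp -ltNge. Qed.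

Lemma prim_ge0 h r : (forall s, 0 <= s <= r -> 0 <= h s) -> 0 <= prim h r.
Proof. by move=> h0; apply: Rintegral_ge0 => s /=; rewrite in_itv; exact: h0. Qed.

Lemma prim_derive h r : bounded_measurable h -> 0 < r -> {for r, continuous h} ->
  is_derive r 1 (prim h) (h r).
Proof.
move=> gh r0 ch.
have [] := @continuous_FTC1_closed R h 0 r (r + 1) _ (bm_integrable _ gh) r0 ch.
  by rewrite ltrDl.
move=> d dE; apply: DeriveDef; first exact: d.
by rewrite -derive1E; exact: dE.
Qed.

Lemma prim_lip h T C a b : bounded_measurable h -> (forall s, 0 <= s <= T -> `|h s| <= C) ->
  0 <= a <= b -> b <= T -> `|prim h b - prim h a| <= C * (b - a).
Proof.
move=> gh hC /andP[a0 ab] bT.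
rewrite /prim Rintegral_itvB ?bnd_simp//; last exact: bm_integrable.
have i1 : mu.-integrable `]a, b] (EFin \o h).
  apply: integrableS (bm_integrable b gh) => //.
  by apply: subset_itvr; rewrite bnd_simp.
apply: le_trans (le_normr_Rintegral _ i1) _ => //.
apply: (@le_trans _ _ (\int[mu]_(s in `]a, b]) C)%R).
  apply: le_Rintegral => //; first exact: integrable_norm i1.
    apply: measurable_bounded_integrable => //.
      by rewrite /= lebesgue_measure_itv /=; case: ifP => _; rewrite ?ltry.
    exists `|C|; split; first exact: num_real.
    by move=> M CM s _; rewrite ltW.
  move=> s /=; rewrite in_itv /= => /andP[s1 s2]; apply: hC.
  by rewrite (le_trans a0 (ltW s1)) (le_trans s2).
rewrite Rintegral_cst//= lebesgue_measure_itv /= lte_fin.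
move: ab; rewrite le_eqVlt => /predU1P[->|->]; last by [].
by rewrite ltxx subrr.
Qed.

Lemma prim_cont h r : bounded_measurable h -> 0 < r -> {for r, continuous (prim h)}.
Proof.
move=> gh r0; apply/continuous_eps => e e0; have [_ /(_ (r + 1))[C hC]] := gh.
have C1 : 0 < `|C| + 1 by rewrite ltr_wpDl.
exists (Num.min r (Num.min 1 (e / (`|C| + 1)))).
  by rewrite !lt_min r0 ltr01 divr_gt0.
move=> s; rewrite !lt_min => /and3P[sr s1 se].
have s0 : 0 < s by move: sr; rewrite ltr_norml => /andP[+ _]; rewrite ltrBrDr addNr.
have sT : s <= r + 1.
  by move: s1; rewrite ltr_norml => /andP[_]; rewrite ltrBlDl => /ltW.
have rT : r <= r + 1 by rewrite lerDl.
have hC' t : 0 <= t <= r + 1 -> `|h t| <= `|C| + 1.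
  move=> /hC/le_trans; apply; rewrite (le_trans (ler_norm _))//.
  by rewrite lerDl.
move: se; rewrite ltr_pdivlMr// mulrC; apply: le_lt_trans.
have [rs|sr'] := leP r s.
  have := prim_lip gh hC' (a := r) (b := s); rewrite (ltW r0) rs => /(_ isT sT).
  by rewrite (ger0_norm (_ : 0 <= s - r)) ?subr_ge0.
have := prim_lip gh hC' (a := s) (b := r); rewrite (ltW s0) (ltW sr') => /(_ isT rT).
by rewrite distrC (distrC s r) (ger0_norm (_ : 0 <= r - s)) ?subr_ge0// ltW.
Qed.

Lemma prim_rcont0 h : bounded_measurable h -> rcont (prim h) 0.
Proof.
move=> gh e e0; have [_ /(_ 1)[C hC]] := gh.
have C1 : 0 < `|C| + 1 by rewrite ltr_wpDl.
exists (Num.min 1 (e / (`|C| + 1))); first by rewrite lt_min ltr01 divr_gt0.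
move=> s; rewrite add0r lt_min ltr_pdivlMr// => /and3P[s0 s1 se].
have := prim_lip gh hC (a := 0) (b := s); rewrite lexx s0 => /(_ isT (ltW s1)).
rewrite subr0 => /le_lt_trans; apply; apply: le_lt_trans se; rewrite mulrC.
by rewrite ler_wpM2l// (le_trans (ler_norm _))// lerDl.
Qed.

Lemma prim_dct (h_ : nat -> R -> R) h :
  (forall m, bounded_measurable (h_ m)) ->
  (forall T, exists C, forall m s, 0 <= s <= T -> `|h_ m s| <= C) ->
  (forall s, 0 <= s -> h_ ^~ s @ \oo --> h s) ->
  bounded_measurable h /\ forall r, 0 <= r -> (fun m => prim (h_ m) r) @ \oo --> prim h r.
Proof.
move=> gh bh ch.
have mh : measurable_fun [set r : R | 0 <= r] h.
  apply: (@measurable_fun_cvg _ _ _ _ h_) => [m|x]; first by have [] := gh m.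
  exact: ch.
have bd : forall T, exists C, forall s, 0 <= s <= T -> `|h s| <= C.
  move=> T; have [C hC] := bh T; exists C => s sT.
  have s0 : 0 <= s by case/andP: sT.
  by apply: (seq_le_lim (cvg_norm (ch s s0))) => m; exact: hC.
have gd : bounded_measurable h by split.
split=> // r r0; have [C hC] := bh r.
have [] := @dominated_convergence _ _ _ mu `[0, r]%classic (measurable_itv _)
  (fun m => EFin \o h_ m) (EFin \o h) (cst C%:E).
- by move=> m; have /integrableP[] := bm_integrable r (gh m).
- by have /integrableP[] := bm_integrable r gd.
- by apply: aeW => x /=; rewrite in_itv /= => /andP[x0 _]; apply: cvg_EFin; [exact: nearW|exact: ch].
- have := @measurable_bounded_integrable _ _ R mu (cst C) `[0, r]%classic (measurable_itv _).
  apply => //.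
    by rewrite /= lebesgue_measure_itv /=; case: ifP => _; rewrite ?ltry.
  exists `|C|; split; first exact: num_real.
  by move=> M CM s _ /=; exact: ltW.
- by apply: aeW => x m /=; rewrite in_itv /= => xr; rewrite lee_fin; exact: hC.
move=> ih _ c; rewrite /prim /Rintegral.
apply: fine_cvg; rewrite fineK; last first.
  exact: (integrable_fin_num _ (bm_integrable r gd)).
exact: c.
Qed.

Lemma prim_pow (K : nat) r : 0 <= r -> prim (fun s => s ^+ K) r = r ^+ K.+1 / K.+1%:R.
Proof.
move=> r0.
have cpow s : {for s, continuous (fun s : R => s ^+ K)} by exact: exprn_continuous.
have g : bounded_measurable (fun s : R => s ^+ K).
  apply: bounded_measurable_cont => [s _|T]; first exact: cpow.
  exists (`|T| ^+ K) => s /andP[s0 sT]; rewrite normrX lerXn2r ?nnegrE//.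
  by rewrite ger0_norm// (le_trans sT)// ler_norm.
have dp (t : R) : is_derive t 1 (fun s : R => s ^+ K.+1 / K.+1%:R) (t ^+ K).
  have H := is_deriveM (pow_derive K t) (is_derive_cst (K.+1%:R^-1 : R) t 1).
  apply: (is_derive_eq H); rewrite scaler0 add0r /GRing.scale /=.
  by rewrite mulrA mulVf ?mul1r// pnatr_eq0.
have rc (f : R -> R) : (forall s, is_derive s 1 f (s ^+ K)) -> rcont f 0.
  by move=> H; exact: rcont_of_derive (H 0).
apply/eqP; rewrite eq_le -subr_le0 -[X in _ && X]subr_le0; apply/andP; split.
  have := @right_nincr R (fun s => prim (fun s : R => s ^+ K) s - s ^+ K.+1 / K.+1%:R)
    (fun s => s ^+ K - s ^+ K) 0 r r0.
  rewrite prim0 expr0n mul0r subrr; apply.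
  - by apply: rcontB; [exact: prim_rcont0|exact: rc].
  - by move=> s /andP[s0 _]; apply: is_deriveB; exact: prim_derive.
  - by move=> s _; rewrite subrr.
have := @right_nincr R (fun s => s ^+ K.+1 / K.+1%:R - prim (fun s : R => s ^+ K) s)
  (fun s => s ^+ K - s ^+ K) 0 r r0.
rewrite prim0 expr0n mul0r subrr; apply.
- by apply: rcontB; [exact: rc|exact: prim_rcont0].
- by move=> s /andP[s0 _]; apply: is_deriveB; exact: prim_derive.
- by move=> s _; rewrite subrr.
Qed.

Lemma prim_scale h c r : bounded_measurable h -> prim (fun s => c * h s) r = c * prim h r.
Proof. by move=> gh; apply: RintegralZl => //; exact: bm_integrable. Qed.

Lemma bm_powM (K : nat) h : bounded_measurable h -> bounded_measurable (fun s => s ^+ K * h s).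
Proof.
move=> [mh bh]; split.
  apply: measurable_funM mh; apply: measurable_funS (measurableT) _ _ => //.
move=> T; have [C hC] := bh T; exists (`|T| ^+ K * C) => s sT.
have /andP[s0 sT'] := sT.
rewrite normrM; apply: ler_pM => //; last exact: hC.
by rewrite normrX lerXn2r ?nnegrE// ger0_norm// (le_trans sT')// ler_norm.
Qed.

(** The solution of [r y' + (K + 1) y = h] that stays bounded at the origin. At 0 itself it takes
    the default value 0 and not its limit. *)
Definition avg (K : nat) h r := r ^- K.+1 * prim (fun s => s ^+ K * h s) r.

Lemma avg_le (K : nat) h k r : 0 <= r -> bounded_measurable h -> bounded_measurable k ->
  (forall s, 0 < s <= r -> h s <= k s) -> avg K h r <= avg K k r.
Proof.
move=> r0 gh gk hk; apply: ler_wpM2l; first by rewrite invr_ge0 exprn_ge0.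
apply: prim_le; [exact: bm_powM|exact: bm_powM|] => s sr.
by apply: ler_wpM2l; [rewrite exprn_ge0// ltW//; case/andP: sr|exact: hk].
Qed.

Lemma bm_cst c : bounded_measurable (fun=> c).
Proof.
by apply: bounded_measurable_cont => [r _|T]; [exact: cst_continuous|exists `|c|].
Qed.

Lemma avg_cst (K : nat) c r : 0 < r -> avg K (fun=> c) r = c / K.+1%:R.
Proof.
move=> r0; rewrite /avg.
have -> : (fun s : R => s ^+ K * c) = (fun s => c * s ^+ K).
  by apply/funext => s; rewrite mulrC.
rewrite prim_scale; last first.
  have := bm_powM K (bm_cst 1); congr bounded_measurable.
  by apply/funext => s; rewrite mulr1.
rewrite prim_pow ?ltW//; field.
by rewrite expf_neq0 ?gt_eqF// (gt_eqF (_ : 0 < 1 + K%:R)) ?ltr_pwDl.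
Qed.

Lemma avg_ge0 (K : nat) h r : 0 <= r -> (forall s, 0 <= s <= r -> 0 <= h s) -> 0 <= avg K h r.
Proof.
move=> r0 h0; apply: mulr_ge0; first by rewrite invr_ge0 exprn_ge0.
apply: prim_ge0 => s sr; apply: mulr_ge0; last exact: h0.
by rewrite exprn_ge0//; case/andP: sr.
Qed.

Lemma avg0 (K : nat) h : avg K h 0 = 0.
Proof. by rewrite /avg prim0 mulr0. Qed.

Lemma avg_cont (K : nat) h r : bounded_measurable h -> 0 < r -> {for r, continuous (avg K h)}.
Proof.
move=> gh r0; apply: continuousM; last exact: prim_cont (bm_powM K gh) r0.
apply: continuousV; first by rewrite expf_neq0// gt_eqF.
exact: exprn_continuous.
Qed.

Lemma avg_derive (K : nat) h r : bounded_measurable h -> 0 < r -> {for r, continuous h} ->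
  is_derive r 1 (avg K h) ((h r - K.+1%:R * avg K h r) / r).
Proof.
move=> gh r0 ch.
have rn0 : r != 0 by rewrite gt_eqF.
have d1 : is_derive r 1 (prim (fun s => s ^+ K * h s)) (r ^+ K * h r).
  apply: prim_derive => //; first exact: bm_powM.
  by apply: continuousM => //; exact: exprn_continuous.
have d2 : is_derive r 1 (fun s : R => s ^- K.+1) (- K.+1%:R * r ^- K.+2).
  have nz : r ^+ K.+1 != 0 by rewrite expf_neq0.
  apply: (is_derive_eq (@is_deriveV R (fun s => s ^+ K.+1) r _ 1 nz (pow_derive K r))).
  by rewrite /GRing.scale /= !exprS; field; rewrite rn0 expf_neq0.
apply: (is_derive_eq (is_deriveM d2 d1)).
rewrite /avg /GRing.scale /= !exprS; field.
by rewrite rn0 expf_neq0.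
Qed.

Lemma avg_dct (K : nat) (h_ : nat -> R -> R) h :
  (forall m, bounded_measurable (h_ m)) ->
  (forall T, exists C, forall m s, 0 <= s <= T -> `|h_ m s| <= C) ->
  (forall s, 0 <= s -> h_ ^~ s @ \oo --> h s) ->
  bounded_measurable h /\ forall r, (fun m => avg K (h_ m) r) @ \oo --> avg K h r.
Proof.
move=> gh bh ch; have [gd _] := prim_dct gh bh ch; split=> // r.
have [r0|r0] := leP 0 r; last first.
  by rewrite /avg prim_lt0//; under eq_fun do rewrite prim_lt0//; exact: cvg_cst.
apply: cvgMr; have [] := @prim_dct (fun m s => s ^+ K * h_ m s) (fun s => s ^+ K * h s).
- by move=> m; exact: bm_powM.
- move=> T; have [C hC] := bh T; exists (`|T| ^+ K * C) => m s sT.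
  have /andP[s0 sT'] := sT.
  rewrite normrM; apply: ler_pM => //; last exact: hC.
  by rewrite normrX lerXn2r ?nnegrE// ger0_norm// (le_trans sT')// ler_norm.
- by move=> s s0; apply: cvgMr; exact: ch.
by move=> _; apply.
Qed.

End integrals.

(** * Existence for the radial system *)


Section existence.
Context {R : realType} (cp cm lam : R) (n K : nat).
Hypotheses (lam0 : 0 < lam) (lamp : lam <= cp) (lamm : lam <= cm) (n0 : (0 < n)%N).
Hypothesis hK : n%:R * cm / lam <= K%:R.
Implicit Types (y z u v f g h : R -> R) (P Q : R -> R) (r s t xi eta x : R).

Local Notation pm := (pm cp cm).
Local Notation pm_le := (pm_le lam0 lamp lamm).
Local Notation pm_le_inv := (pm_le_inv lam0 lamp lamm).

Let cp0 : 0 < cp. Proof. exact: lt_le_trans lamp. Qed.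
Let cm0 : 0 < cm. Proof. exact: lt_le_trans lamm. Qed.

Definition pm_inv x : R := if 0 < x then x / cp else x / cm.

Lemma pm_invK x : pm (pm_inv x) = x.
Proof.
rewrite /pm_inv; have [x0|x0] := ltP 0 x.
  by rewrite /pm divr_gt0// mulrC divfK// gt_eqF.
by rewrite /pm pmulr_lgt0 ?invr_gt0// ltNge x0/= mulrC divfK// gt_eqF.
Qed.

Lemma pm_inv_le x x' : x <= x' -> pm_inv x <= pm_inv x'.
Proof. by move=> h; apply: pm_le_inv; rewrite !pm_invK. Qed.

Lemma pm_inv_lip x x' : x <= x' -> pm_inv x' <= pm_inv x + (x' - x) / lam.
Proof.
move=> h; rewrite -lerBlDl ler_pdivlMr// mulrC.
have := pm_lip lam0 lamp lamm (pm_inv_le h).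
by rewrite !pm_invK lerBrDl.
Qed.

Lemma pm_inv_cont x : {for x, continuous pm_inv}.
Proof.
apply/continuous_eps => e e0; exists (e * lam); first exact: mulr_gt0.
move=> x'; rewrite -ltr_pdivrMr// => h; apply: le_lt_trans h.
have key a b : a <= b -> `|pm_inv b - pm_inv a| <= `|b - a| / lam.
  move=> ab; rewrite !ger0_norm ?subr_ge0 ?pm_inv_le//.
  by rewrite lerBlDl; exact: pm_inv_lip.
have [xx|/ltW xx] := leP x x'; first exact: key.
by rewrite distrC (distrC x'); exact: key.
Qed.

(* With y = - u' / r, the radial equation reads r y' + (K + 1) y = ham y g; the
   choice of K makes ham nondecreasing in y as well. *)
Definition ham (y g : R) : R := K%:R * y - pm_inv (n%:R * cm * y - g).

Let ncm0 : 0 <= n%:R * cm.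
Proof. by rewrite mulr_ge0// ltW. Qed.

Lemma ham_le (y y' g g' : R) : y <= y' -> g <= g' -> ham y g <= ham y' g'.
Proof.
move=> yy gg; rewrite /ham.
have h1 : n%:R * cm * y - g <= n%:R * cm * y' - g by rewrite lerB// ler_wpM2l.
have := pm_inv_lip h1.
have h2 : pm_inv (n%:R * cm * y' - g') <= pm_inv (n%:R * cm * y' - g).
  by apply: pm_inv_le; rewrite lerB.
have h3 : (n%:R * cm * y' - g - (n%:R * cm * y - g)) / lam <= K%:R * (y' - y).
  rewrite (_ : _ / lam = n%:R * cm / lam * (y' - y)); last by field; rewrite gt_eqF.
  by rewrite ler_wpM2r// subr_ge0.
by move: h2 h3; rewrite mulrBr; lra.
Qed.

Lemma ham_lip (y y' g g' : R) : `|ham y g - ham y' g'| <= K%:R * `|y - y'| + `|g - g'| / lam.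
Proof.
have key a b : a <= b -> forall c, ham b c <= ham a c + K%:R * (b - a).
  move=> ab c; rewrite /ham.
  have : pm_inv (n%:R * cm * a - c) <= pm_inv (n%:R * cm * b - c).
    by apply: pm_inv_le; rewrite lerB// ler_wpM2l.
  by rewrite mulrBr; lra.
have key2 c d : c <= d -> forall a, ham a d <= ham a c + (d - c) / lam.
  move=> cd a; rewrite /ham.
  have h : n%:R * cm * a - d <= n%:R * cm * a - c by rewrite lerB.
  have := pm_inv_lip h; rewrite (_ : _ - _ - _ = d - c); last by ring.
  by lra.
have one a b c d : ham a c - ham b d <= K%:R * `|a - b| + `|c - d| / lam.
  have h1 : ham a c - ham b c <= K%:R * `|a - b|.
    have [ab|/ltW ba] := leP a b.
      apply: (@le_trans _ _ 0); first by rewrite subr_le0 ham_le.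
      by rewrite mulr_ge0.
    by rewrite ger0_norm ?subr_ge0// lerBlDl key.
  have h2 : ham b c - ham b d <= `|c - d| / lam.
    have [cd|/ltW dc] := leP c d.
      apply: (@le_trans _ _ 0); first by rewrite subr_le0 ham_le.
      by rewrite divr_ge0// ltW.
    by rewrite ger0_norm ?subr_ge0// lerBlDl key2.
  by lra.
rewrite ler_norml one andbT -[X in _ <= X]opprB lerN2 (distrC y) (distrC g).
exact: one.
Qed.

(** A constant [y] corresponds to a paraboloid with Hessian [- y I], on which the operator equals
    [- (n + 1) cm y]. These constants are the upper barriers of the iteration. *)
Lemma ham_fix (y : R) : 0 <= y -> ham y (n.+1%:R * cm * y) = K.+1%:R * y.
Proof.
move=> y0; rewrite /ham (_ : _ - n.+1%:R * cm * y = - (cm * y)); last first.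
  by rewrite -[n.+1]addn1 natrD; ring.
rewrite /pm_inv oppr_gt0 ltNge mulr_ge0 ?(ltW cm0)//= -[in RHS]addn1 natrD.
by field; rewrite gt_eqF.
Qed.

Lemma ham0 (g : R) : 0 <= g -> ham 0 g = g / cm.
Proof.
move=> g0; rewrite /ham !mulr0 !sub0r /pm_inv oppr_gt0 ltNge g0 /=.
by rewrite mulNr opprK.
Qed.

Lemma ham_cvg (y_ g_ : nat -> R) (y g : R) : y_ @ \oo --> y -> g_ @ \oo --> g ->
  (fun m => ham (y_ m) (g_ m)) @ \oo --> ham y g.
Proof.
move=> cy cg; apply: cvgB; first exact: cvgMr.
apply: (@continuous_cvg _ _ _ \oo _ _ pm_inv); first exact: pm_inv_cont.
by apply: cvgB => //; exact: cvgMr.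
Qed.

Lemma ham_cont f g r : {for r, continuous f} -> {for r, continuous g} ->
  {for r, continuous (fun s => ham (f s) (g s))}.
Proof.
move=> cf cg; apply: continuousB.
  by apply: continuousM => //; exact: cst_continuous.
have c : {for r, continuous (fun s => n%:R * cm * f s - g s)}.
  by apply: continuousB => //; apply: continuousM => //; exact: cst_continuous.
by apply: (continuous_comp c); exact: pm_inv_cont.
Qed.

(** Recovers a component from its value [xi] at the origin and from [y = - u' / r]. *)
Definition from (xi : R) y r : R := xi - prim (fun s => s * y s) r.

Definition rhs P y eta z s : R := ham (y s) (P (from eta z s)).

Definition adm c y := [/\ bounded_measurable y, forall r, 0 <= r -> 0 <= y r <= c &
  forall r, 0 < r -> {for r, continuous y}].

Let bmx y : bounded_measurable y -> bounded_measurable (fun s => s * y s).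
Proof. exact: (@bm_powM R 1). Qed.

Let lower_bound c y : (forall r, 0 <= r -> 0 <= y r <= c) -> forall r, 0 <= r -> 0 <= y r.
Proof. by move=> yb r /yb/andP[]. Qed.

Lemma from0 xi y : from xi y 0 = xi.
Proof. by rewrite /from prim0 subr0. Qed.

Lemma from_cont xi y r : bounded_measurable y -> 0 < r -> {for r, continuous (from xi y)}.
Proof.
move=> gy r0; apply: continuousB; first exact: cst_continuous.
exact: prim_cont (bmx gy) r0.
Qed.

Lemma from_rcont xi y : bounded_measurable y -> rcont (from xi y) 0.
Proof.
move=> gy e e0; have [d d0 Hd] := prim_rcont0 (bmx gy) e0.
exists d => // r /Hd; rewrite /from prim0 !subr0 => h.
by rewrite addrC addKr normrN.
Qed.

Lemma from_le xi y r : (forall s, 0 <= s -> 0 <= y s) -> from xi y r <= xi.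
Proof.
move=> y0; rewrite /from gerBl; apply: prim_ge0 => s /andP[s0 _].
by rewrite mulr_ge0// y0.
Qed.

Lemma from_mono xi xi' y y' r : bounded_measurable y -> bounded_measurable y' ->
  xi <= xi' -> (forall s, 0 <= s -> y' s <= y s) -> from xi y r <= from xi' y' r.
Proof.
move=> gy gy' xx yy; apply: lerB => //; apply: prim_le; try exact: bmx.
by move=> s /andP[s0 _]; rewrite ler_pM2l// yy// ltW.
Qed.

(** The other component is largest at the origin, so monotonicity of [ham] compares the right-hand
    side with the one of the constant solution [c]. *)
Lemma rhs_bounds P y eta z c s : (forall x, 0 <= P x) -> {homo P : x y / x <= y} ->
  P eta <= n.+1%:R * cm * c -> 0 <= c -> 0 <= y s <= c -> from eta z s <= eta ->
  0 <= rhs P y eta z s <= K.+1%:R * c.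
Proof.
move=> P0 mP Pc c0 /andP[y0 yc] ze; apply/andP; split.
  have <- : ham 0 0 = 0 by rewrite ham0// mul0r.
  exact: ham_le.
rewrite -ham_fix//; apply: ham_le => //; apply: le_trans Pc; exact: mP.
Qed.

Lemma rhs_bm P y eta z c c' : (forall x, 0 <= P x) -> {homo P : x y / x <= y} ->
  (forall x, {for x, continuous P}) ->
  P eta <= n.+1%:R * cm * c -> 0 <= c -> adm c y -> adm c' z ->
  (forall r, 0 < r -> {for r, continuous (rhs P y eta z)}) /\
  bounded_measurable (rhs P y eta z).
Proof.
move=> P0 mP cP Pc c0 [gy yb cy] [gz zb cz].
have cr r : 0 < r -> {for r, continuous (rhs P y eta z)}.
  move=> r0; apply: ham_cont; first exact: cy.
  apply: (@continuous_comp _ _ _ (from eta z) P); last exact: cP.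
  exact: from_cont.
split=> //; apply: bounded_measurable_cont => // T.
exists (K.+1%:R * c) => s /andP[s0 _].
have /andP[h1 h2] := rhs_bounds P0 mP Pc c0 (yb s s0)
  (from_le eta s (lower_bound zb)).
by rewrite ger0_norm.
Qed.

Lemma adm_step P y eta z c c' : (forall x, 0 <= P x) -> {homo P : x y / x <= y} ->
  (forall x, {for x, continuous P}) ->
  P eta <= n.+1%:R * cm * c -> 0 <= c -> adm c y -> adm c' z ->
  adm c (avg K (rhs P y eta z)).
Proof.
move=> P0 mP cP Pc c0 ay az; have [cr gr] := rhs_bm P0 mP cP Pc c0 ay az.
have [gy yb cy] := ay; have [gz zb cz] := az.
have bd s : 0 <= s -> 0 <= rhs P y eta z s <= K.+1%:R * c.
  move=> s0; apply: rhs_bounds => //; first exact: yb.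
  by apply: from_le => t t0; have /andP[] := zb t t0.
have b r : 0 <= r -> 0 <= avg K (rhs P y eta z) r <= c.
  move=> r0; apply/andP; split.
    by apply: avg_ge0 => // s /andP[s0 _]; have /andP[] := bd s s0.
  have [->|rn0] := eqVneq r 0; first by rewrite avg0.
  have rp : 0 < r by rewrite lt_neqAle eq_sym rn0.
  have -> : c = avg K (fun=> K.+1%:R * c) r by rewrite avg_cst// mulrC mulKf// pnatr_eq0.
  apply: avg_le => //; first exact: bm_cst.
  by move=> s /andP[s0 _]; have /andP[] := bd s (ltW s0).
have ca r : 0 < r -> {for r, continuous (avg K (rhs P y eta z))} by exact: avg_cont.
split=> //; apply: bounded_measurable_cont => // T; exists c => s /andP[s0 _].
by have /andP[h1 h2] := b s s0; rewrite ger0_norm.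
Qed.

Lemma step_mono P y y' eta eta' z z' c c' r : (forall x, 0 <= P x) ->
  {homo P : x y / x <= y} -> (forall x, {for x, continuous P}) ->
  P eta <= n.+1%:R * cm * c -> P eta' <= n.+1%:R * cm * c -> 0 <= c ->
  adm c y -> adm c' z -> adm c y' -> adm c' z' -> 0 <= r ->
  eta <= eta' -> (forall s, 0 <= s -> y s <= y' s) -> (forall s, 0 <= s -> z' s <= z s) ->
  avg K (rhs P y eta z) r <= avg K (rhs P y' eta' z') r.
Proof.
move=> P0 mP cP Pc Pc' c0 ay az ay' az' r0 ee yy zz.
apply: avg_le => //; first by have [] := rhs_bm P0 mP cP Pc c0 ay az.
  by have [] := rhs_bm P0 mP cP Pc' c0 ay' az'.
move=> s /andP[/ltW s0 _]; apply: ham_le; first exact: yy.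
by apply: mP; apply: from_mono => //; [case: az|case: az'].
Qed.

(** One equation in integral form, the other unknown being given. Continuity of [y] is left out
    because it does not pass to pointwise limits; it follows from [y] being an average. *)
Definition half_sol P eta c y z := [/\ bounded_measurable y,
  forall r, 0 <= r -> 0 <= y r <= c, bounded_measurable (rhs P y eta z) &
  y = avg K (rhs P y eta z)].

(** Two sequences [y_] and [y'_] with the same limit serve two uses: [y'_] is the shift of [y_] in
    the iteration, and equals [y_] for a sequence of solutions with varying [eta]. The bound [E] on
    the data makes dominated convergence uniform. *)
Lemma half_limit P (y_ y'_ z_ : nat -> R -> R) (e_ : nat -> R) E c c' y z eta :
  (forall x, 0 <= P x) -> {homo P : x y / x <= y} -> (forall x, {for x, continuous P}) ->
  P E <= n.+1%:R * cm * c -> 0 <= c -> (forall m, e_ m <= E) ->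
  (forall m, adm c (y_ m)) -> (forall m, adm c' (z_ m)) ->
  (forall m, y'_ m = avg K (rhs P (y_ m) (e_ m) (z_ m))) ->
  e_ @ \oo --> eta -> (forall r, y_ ^~ r @ \oo --> y r) -> (forall r, z_ ^~ r @ \oo --> z r) ->
  (forall r, y'_ ^~ r @ \oo --> y r) ->
  half_sol P eta c y z.
Proof.
move=> P0 mP cP Pc c0 eE ay az y'E ce cy cz cy'.
have Pe m : P (e_ m) <= n.+1%:R * cm * c by apply: le_trans Pc; exact: mP.
have bmlim (w_ : nat -> R -> R) w d : (forall m, adm d (w_ m)) ->
    (forall r, w_ ^~ r @ \oo --> w r) ->
    (forall T, exists C, forall m s, 0 <= s <= T -> `|w_ m s| <= C) /\
    (forall r, 0 <= r -> 0 <= w r <= d).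
  move=> aw cw; split.
    move=> T; exists d => m s /andP[s0 _]; have [_ /(_ s s0)/andP[h1 h2] _] := aw m.
    by rewrite ger0_norm.
  move=> r r0; apply/andP; split.
    rewrite -oppr_le0; apply: (seq_le_lim (cvgN (cw r))) => m.
    by have [_ /(_ r r0)/andP[h1 h2] _] := aw m; rewrite oppr_le0.
  by apply: (seq_le_lim (cw r)) => m; have [_ /(_ r r0)/andP[h1 h2] _] := aw m.
have [by_ yb] := bmlim _ _ _ ay cy; have [bz_ zb] := bmlim _ _ _ az cz.
have [gy _] := prim_dct (fun m => let: And3 a _ _ := ay m in a) by_ (fun r _ => cy r).
have [gzs cvz] : bounded_measurable (fun s => s * z s) /\
    forall r, 0 <= r -> (fun m => prim (fun s => s * z_ m s) r) @ \oo --> prim (fun s => s * z s) r.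
  apply: prim_dct => [m|T|s _].
  - by apply: bmx; case: (az m).
  - have [C hC] := bz_ T; exists (`|T| * C) => m s sT; rewrite normrM.
    apply: ler_pM => //; last exact: hC.
    by have /andP[s0 sT'] := sT; rewrite ger0_norm// (le_trans sT')// ler_norm.
  - by apply: cvgMr; exact: cz.
have cfrom s : 0 <= s -> (fun m => from (e_ m) (z_ m) s) @ \oo --> from eta z s.
  by move=> s0; apply: cvgB => //; exact: cvz.
have [gr cr] : bounded_measurable (rhs P y eta z) /\
    forall r, (fun m => avg K (rhs P (y_ m) (e_ m) (z_ m)) r) @ \oo --> avg K (rhs P y eta z) r.
  apply: avg_dct => [m|T|s s0].
  - exact: (rhs_bm P0 mP cP (Pe m) c0 (ay m) (az m)).2.
  - exists (K.+1%:R * c) => m s /andP[s0 _].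
    have [_ /(_ s s0) yms _] := ay m; have [_ zms _] := az m.
    have /andP[h1 h2] := rhs_bounds P0 mP (Pe m) c0 yms
      (from_le (e_ m) s (lower_bound zms)).
    by rewrite ger0_norm.
  - apply: ham_cvg; first exact: cy.
    by apply: (@continuous_cvg _ _ _ \oo _ _ P); [exact: cP|exact: cfrom].
split=> //; apply/funext => r.
apply: (cvg_unique _ (cy' r)) => //.
have -> : y'_ ^~ r = (fun m => avg K (rhs P (y_ m) (e_ m) (z_ m)) r).
  by apply/funext => m; rewrite y'E.
exact: cr.
Qed.

Lemma avg_lt0 (f : R -> R) r : r < 0 -> avg K f r = 0.
Proof. by move=> r0; rewrite /avg prim_lt0// mulr0. Qed.

(** A larger [z] means a smaller [v], so each update is nondecreasing in its own unknown and
    nonincreasing in the other. Starting from the lowest [y] and the highest [z], the first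
    component increases and the second decreases along the iteration. *)
Fixpoint iterates P Q xi eta (c' : R) m : (R -> R) * (R -> R) :=
  if m is j.+1 then
    let yz := iterates P Q xi eta c' j in
    (avg K (rhs P yz.1 eta yz.2), avg K (rhs Q yz.2 xi yz.1))
  else ((fun=> 0), (fun=> c')).

Lemma solution_exists P Q xi eta c c' :
  (forall x, 0 <= P x) -> {homo P : x y / x <= y} -> (forall x, {for x, continuous P}) ->
  (forall x, 0 <= Q x) -> {homo Q : x y / x <= y} -> (forall x, {for x, continuous Q}) ->
  P eta <= n.+1%:R * cm * c -> 0 <= c -> Q xi <= n.+1%:R * cm * c' -> 0 <= c' ->
  exists y z, half_sol P eta c y z /\ half_sol Q xi c' z y.
Proof.
move=> P0 mP cP Q0 mQ cQ Pc c0 Qc c'0.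
pose it := iterates P Q xi eta c'.
have admc (d e : R) : 0 <= d <= e -> adm e (fun=> d).
  by move=> de; split=> [|//|r _]; [exact: bm_cst|exact: cst_continuous].
have ad m : adm c (it m).1 /\ adm c' (it m).2.
  elim: m => [|m [IH1 IH2]] /=; first by split; apply: admc; rewrite lexx ?c0 ?c'0.
  by split; [exact: adm_step IH1 IH2|exact: adm_step IH2 IH1].
have mono m : (forall r, 0 <= r -> (it m).1 r <= (it m.+1).1 r) /\
              (forall r, 0 <= r -> (it m.+1).2 r <= (it m).2 r).
  elim: m => [|m [IH1 IH2]].
    have [[_ h1 _] [_ h2 _]] := ad 1%N.
    by split=> r r0; [have /andP[] := h1 r r0|have /andP[] := h2 r r0].
  have [a1 a2] := ad m; have [b1 b2] := ad m.+1.
  by split=> r r0; [exact: (step_mono P0 mP cP Pc Pc c0 a1 a2 b1 b2 r0 (lexx _) IH1 IH2)|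
    exact: (step_mono Q0 mQ cQ Qc Qc c'0 b2 b1 a2 a1 r0 (lexx _) IH2 IH1)].
have cv1 r : cvgn (fun m => (it m).1 r).
  apply: nondecreasing_is_cvgn.
    apply/nondecreasing_seqP => m; have [r0|r0] := leP 0 r; first exact: (mono m).1.
    by case: m => [|m]; rewrite /= !avg_lt0.
  exists c => _ [m _ <-]; have [r0|r0] := leP 0 r.
    by have [[_ /(_ r r0)/andP[]] _] := ad m.
  by case: m => [|m] //=; rewrite avg_lt0.
have cv2 r : cvgn (fun m => (it m).2 r).
  apply: nonincreasing_is_cvgn.
    apply/nonincreasing_seqP => m; have [r0|r0] := leP 0 r; first exact: (mono m).2.
    by case: m => [|m]; rewrite /= !avg_lt0.
  exists 0 => _ [m _ <-]; have [r0|r0] := leP 0 r.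
    by have [_ [_ /(_ r r0)/andP[]]] := ad m.
  by case: m => [|m] //=; rewrite avg_lt0.
pose y r := limn (fun m => (it m).1 r); pose z r := limn (fun m => (it m).2 r).
have shift (u_ : nat -> R) (l : R) : u_ @ \oo --> l -> (fun m => u_ m.+1) @ \oo --> l.
  by move=> ul; rewrite -(cvg_shiftS u_ (nbhs l)) in ul.
exists y, z; split.
- apply: (@half_limit P (fun m => (it m).1) (fun m => (it m.+1).1) (fun m => (it m).2)
    (fun=> eta) eta c c') => //.
  + by move=> m; have [] := ad m.
  + by move=> m; have [] := ad m.
  + exact: cvg_cst.
  + by move=> r; apply: (shift (fun m => (it m).1 r)); exact: cv1.
- apply: (@half_limit Q (fun m => (it m).2) (fun m => (it m.+1).2) (fun m => (it m).1)
    (fun=> xi) xi c' c) => //.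
  + by move=> m; have [] := ad m.
  + by move=> m; have [] := ad m.
  + exact: cvg_cst.
  + by move=> r; apply: (shift (fun m => (it m).2 r)); exact: cv2.
Qed.

(** * Regularity and positivity of a solution of the integral equation *)

Section solution.
Variables (P : R -> R) (eta c : R) (y z : R -> R).
Hypotheses (P0 : forall x, 0 <= P x) (mP : {homo P : x y / x <= y})
  (cP : forall x, {for x, continuous P}) (Pc : P eta <= n.+1%:R * cm * c)
  (Peta : 0 < P eta)
  (hs : half_sol P eta c y z) (gz : bounded_measurable z)
  (z0 : forall r, 0 <= r -> 0 <= z r).

Local Notation g := (fun r => P (from eta z r)).
Local Notation h := (rhs P y eta z).

Lemma sol_cont r : 0 < r -> {for r, continuous y}.
Proof. by move=> r0; have [_ _ gh ->] := hs; exact: avg_cont. Qed.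

Lemma sol_rhs_cont r : 0 < r -> {for r, continuous h}.
Proof.
move=> r0; apply: ham_cont; first exact: sol_cont.
by apply: (@continuous_comp _ _ _ (from eta z) P); [exact: from_cont|exact: cP].
Qed.

Lemma sol_derive r : 0 < r -> is_derive r 1 y ((h r - K.+1%:R * y r) / r).
Proof.
move=> r0; have [_ _ gh yE] := hs; rewrite [X in is_derive _ _ X _]yE.
apply: (is_derive_eq (avg_derive K gh r0 (sol_rhs_cont r0))).
by rewrite -yE.
Qed.

Lemma sol_c_ge0 : 0 <= c.
Proof. by have [_ /(_ 0 (lexx _))/andP[h1 h2] _ _] := hs; exact: le_trans h2. Qed.

(** The limit of [y] at the origin, where the Hessian is [- sol_y0] times the identity. *)
Definition sol_y0 : R := P eta / (n.+1%:R * cm).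

Let ncm : 0 < n.+1%:R * cm.
Proof. by rewrite mulr_gt0// ltr0n. Qed.

Lemma sol_ham0 : ham sol_y0 (P eta) = K.+1%:R * sol_y0.
Proof.
rewrite -ham_fix; last by rewrite /sol_y0 divr_ge0// ltW.
by congr ham; rewrite /sol_y0 mulrC divfK// gt_eqF.
Qed.

(** Averaging turns a bound [B] on the distance of [y] to [sol_y0] near 0 into
    [(K B + e1) / (K + 1)]: a contraction of factor [q = K / (K + 1)] with fixed point [e1],
    iterated on one fixed interval. *)
Lemma sol_near0 e : 0 < e -> exists2 d, 0 < d & forall r, 0 < r < d ->
  `|y r - sol_y0| < e /\ `|h r - K.+1%:R * y r| < e.
Proof.
move=> e0.
pose e1 := e / (4 * K.+1%:R).
have K1 : 1 <= K.+1%:R :> R by rewrite ler1n.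
have K10 : 0 < K.+1%:R :> R by rewrite ltr0n.
have e10 : 0 < e1 by rewrite divr_gt0// mulr_gt0.
have [d d0 Hd] : exists2 d, 0 < d & forall s, 0 <= s < d -> `|P (from eta z s) - P eta| <= e1 * lam.
  have /continuous_eps/(_ (e1 * lam) (mulr_gt0 e10 lam0))[d1 d10 H1] := cP (x := eta).
  have [d d0 H2] := from_rcont eta gz d10.
  exists d => // s sd; apply: ltW; apply: H1.
  by have := H2 s; rewrite add0r from0; apply.
have dist s B : 0 <= s < d -> `|y s - sol_y0| <= B -> `|h s - K.+1%:R * sol_y0| <= K%:R * B + e1.
  move=> sd yB; rewrite -sol_ham0; apply: le_trans (ham_lip _ _ _ _) _.
  apply: lerD; first exact: ler_wpM2l.
  by rewrite ler_pdivrMr// Hd.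
have [_ yb gh yE] := hs.
have y00 : 0 <= sol_y0 by rewrite /sol_y0 divr_ge0// ltW.
have y0c : sol_y0 <= c by rewrite /sol_y0 ler_pdivrMr// mulrC.
pose q : R := K%:R / K.+1%:R.
have bound m s : 0 < s < d -> `|y s - sol_y0| <= c * q ^+ m + e1.
  elim: m s => [|m IH] s sd.
    rewrite expr0 mulr1; have /andP[s0 _] := sd; have /andP[h1 h2] := yb s (ltW s0).
    rewrite -[leLHS]addr0; apply: lerD; last exact: ltW.
    by rewrite ler_norml; apply/andP; split; lra.
  have /andP[s0 sdd] := sd.
  pose B := c * q ^+ m + e1.
  have ht t : 0 < t <= s -> `|h t - K.+1%:R * sol_y0| <= K%:R * B + e1.
    move=> /andP[t0 ts]; have td : 0 < t < d by rewrite t0 (le_lt_trans ts).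
    by apply: dist (IH t td); case/andP: td => /ltW ->.
  have BE : (K%:R * B + e1) / K.+1%:R = c * q ^+ m.+1 + e1.
    rewrite /B exprS; move: (q ^+ m) => w; rewrite /q -natr1; field.
    by rewrite natr1 gt_eqF.
  rewrite -BE [y s](congr1 (fun f => f s) yE).
  have cst b : b / K.+1%:R = avg K (fun=> b) s by rewrite avg_cst.
  have -> : sol_y0 = (K.+1%:R * sol_y0) / K.+1%:R by rewrite mulrC mulKf// gt_eqF.
  rewrite ler_norml; apply/andP; split.
    rewrite lerBrDr -mulNr -mulrDl cst; apply: avg_le => //; [exact: ltW|exact: bm_cst|].
    by move=> t /ht; rewrite ler_norml => /andP[]; lra.
  rewrite lerBlDr -mulrDl cst; apply: avg_le => //; [exact: ltW|exact: bm_cst|].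
  by move=> t /ht; rewrite ler_norml => /andP[]; lra.
exists d => // r rd.
have yr : `|y r - sol_y0| <= e1.
  rewrite -subr_le0; apply: (@geom_le R _ c q).
    rewrite divr_ge0//= ltr_pdivrMr// mul1r ltr_nat.
    by [].
  by move=> m; rewrite lerBlDr bound.
have e1e : K.+1%:R * e1 = e / 4 by rewrite /e1; field; rewrite gt_eqF.
have e14 : e1 <= e / 4 by rewrite -e1e ler_peMl// ltW.
split; first by apply: le_lt_trans yr _; lra.
have /andP[r0 rd'] := rd.
have r0d : 0 <= r < d by rewrite ltW.
rewrite (_ : _ - _ = (h r - K.+1%:R * sol_y0) - K.+1%:R * (y r - sol_y0)); last by ring.
apply: le_lt_trans (ler_normB _ _) _.
have h1 := dist r e1 r0d yr.
have h2 : `|K.+1%:R * (y r - sol_y0)| <= e / 4.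
  by rewrite -e1e normrM ger0_norm// ler_pM2l.
have h3 : K%:R * e1 <= e / 4.
  by rewrite -e1e ler_pM2r// ler_nat.
by lra.
Qed.

(** Positivity near 0 comes from the positive limit [sol_y0], and it propagates because
    [r^(K + 1) y] is the primitive of a nonnegative function. *)
Lemma sol_gt0 r : 0 < r -> 0 < y r.
Proof.
move=> r0; have y00 : 0 < sol_y0 by rewrite /sol_y0 divr_gt0.
have [d d0 Hd] := sol_near0 y00.
pose s := Num.min r (d / 2).
have s0 : 0 < s by rewrite lt_min r0 divr_gt0.
have sr : s <= r by rewrite ge_min lexx.
have sd : s < d by rewrite gt_min ltr_pdivrMr// ltr_pMr// ltr1n orbT.
have [|+ _] := Hd s; first by rewrite s0.
rewrite ltr_norml => /andP[+ _]; rewrite ltrBrDl subrr => ys.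
have [_ yb gh yE] := hs.
have h0 t : 0 <= t -> 0 <= h t.
  move=> t0; have := @rhs_bounds P y eta z c t P0 mP Pc sol_c_ge0 (yb t t0).
  by move=> /(_ (from_le _ _ z0))/andP[].
have mon : s ^+ K.+1 * y s <= r ^+ K.+1 * y r.
  rewrite [y s](congr1 (fun f => f s) yE) [y r](congr1 (fun f => f r) yE) /avg.
  rewrite !mulrA !divff ?mul1r ?expf_neq0 ?gt_eqF//.
  apply: prim_incr; [exact: bm_powM| |by rewrite ltW].
  by move=> t t0; rewrite mulr_ge0 ?exprn_ge0// h0.
rewrite -(@pmulr_rgt0 _ (r ^+ K.+1)) ?exprn_gt0//.
by apply: lt_le_trans mon; rewrite mulr_gt0// exprn_gt0.
Qed.

Lemma sol_lower G r : 0 <= G -> 0 < r -> (forall s, 0 <= s <= r -> G <= P (from eta z s)) ->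
  G / cm / K.+1%:R <= y r.
Proof.
move=> G0 r0 hG; have [_ yb gh yE] := hs.
rewrite [y r](congr1 (fun f => f r) yE) -(avg_cst K _ r0); apply: avg_le => //; first exact: ltW.
  exact: bm_cst.
move=> s /andP[s0 sr]; rewrite -ham0//; apply: ham_le.
  by have /andP[] := yb s (ltW s0).
by apply: hG; rewrite ltW.
Qed.

Lemma sol_profile xi T : bounded_measurable y ->
  profile cp cm n T (from xi y) (fun r => - (r * y r)) (fun r => K%:R * y r - h r) (P \o from eta z).
Proof.
move=> gy; have [_ yb gh yE] := hs; split.
- by rewrite mul0r oppr0.
- exact: from_rcont.
- move=> e e0; have [d d0 Hd] := sol_near0 ltr01.
  pose M := sol_y0 + 1.
  have M0 : 0 < M by rewrite ltr_wpDl// /sol_y0 divr_ge0// ltW.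
  exists (Num.min d (e / M)); first by rewrite lt_min d0 divr_gt0.
  move=> r; rewrite add0r lt_min ltr_pdivlMr// => /and3P[r0 rd re].
  rewrite mul0r oppr0 subr0 normrN.
  have [->|rn0] := eqVneq r 0; first by rewrite mul0r normr0.
  have rp : 0 < r by rewrite lt_neqAle eq_sym rn0.
  apply: le_lt_trans re; rewrite normrM ger0_norm// ler_wpM2l//.
  have [|+ _] := Hd r; first by rewrite rp.
  rewrite ltr_norml => /andP[_]; rewrite ger0_norm ?ltrBlDr; last by have /andP[] := yb r r0.
  by rewrite addrC => /ltW.
- move=> r /andP[r0 _]; split.
  + apply: (is_derive_eq (is_deriveB (is_derive_cst xi r 1)
      (prim_derive (bmx gy) r0 (continuousM _ _)))).
    * by [].
    * exact: sol_cont.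
    * by rewrite sub0r.
  + apply: (is_derive_eq (is_deriveN (is_deriveM (is_derive_id r 1) (sol_derive r0)))).
    rewrite /GRing.scale /= -natr1; field.
    by rewrite gt_eqF.
  + have yr : 0 < y r by exact: sol_gt0.
    have -> : K%:R * y r - h r = pm_inv (n%:R * cm * y r - P (from eta z r)).
      by rewrite /rhs /ham subKr.
    have -> : - (r * y r) / r = - y r by field; rewrite gt_eqF.
    by rewrite pm_invK /pm oppr_gt0 ltNge (ltW yr)/=; ring.
Qed.

Lemma sol_radial xi (u := fun x : 'rV[R]_n.+1 => from xi y (enorm x)) : bounded_measurable y ->
  C2_on setT u /\
  forall x : 'rV[R]_n.+1, pucci cp cm (hessian u x) = - P (from eta z (enorm x)).
Proof.
(* The average has the default value 0 at the origin; [yh] puts its limit there, as the continuous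
   extension of the Hessian requires. *)
move=> gy; pose yh r := if r == 0 then sol_y0 else y r.
pose y1 r := (h r - K.+1%:R * y r) / r.
have yhE r : 0 < r -> yh r = y r by move=> r0; rewrite /yh gt_eqF.
have prof := fun T => sol_profile xi T gy.
have [_ yb gh yE] := hs.
have y00 : 0 < sol_y0 by rewrite /sol_y0 divr_gt0.
have [||||| HC2 Hh] := @radial_C2 R n.+1 (from xi y) yh y1 c.
- move=> r r0; have [_ _ _ /(_ r)] := prof (r + 1); rewrite r0 ltrDl ltr01.
  by move=> /(_ isT)[d _ _]; rewrite yhE.
- move=> r /andP[r0 _]; rewrite from0 /from addrC addKr normrN.
  have b s : 0 <= s <= r -> `|s * y s| <= r * c.
    move=> /andP[s0 sr]; have /andP[h1 h2] := yb s s0.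
    by rewrite normrM !ger0_norm// ler_pM.
  have := prim_lip (bmx gy) b (a := 0) (b := r); rewrite !lexx (ltW r0) => /(_ isT isT).
  by rewrite prim0 !subr0 expr2 (mulrC r c) mulrA.
- move=> r r0; apply: (@near_eq_is_derive _ _ _ y); last exact: sol_derive.
  by apply: filterS (lt_nbhsr r0) => s s0; rewrite yhE.
- move=> r r0; apply: continuousM; last first.
    by apply: continuousV; [rewrite gt_eqF|exact: cvg_id].
  apply: continuousB; first exact: sol_rhs_cont.
  by apply: continuousM; [exact: cst_continuous|exact: sol_cont].
- move=> e /sol_near0[d d0 Hd]; exists d => // r rd; have /andP[r0 _] := rd.
  have [h1 h2] := Hd r rd; rewrite yhE// /yh eqxx; split=> //.
  by rewrite /y1 mulrC divfK// gt_eqF.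
split=> // x; rewrite Hh.
have [->|x0] := eqVneq x 0.
  (* At the origin the rank-one term vanishes; any unit vector with coefficient 0 brings the matrix
     to the form of [pucci_scalar_outer]. *)
  have -> : (- yh (enorm (0 : 'rV[R]_n.+1)))%:M - (y1 (enorm (0 : 'rV[R]_n.+1)) / enorm (0 : 'rV[R]_n.+1)) *:
      ((0 : 'rV[R]_n.+1)^T *m (0 : 'rV[R]_n.+1)) =
      (- sol_y0)%:M + 0 *: ((delta_mx 0 0 : 'rV[R]_n.+1)^T *m (delta_mx 0 0 : 'rV[R]_n.+1)).
    by rewrite mulmx0 scaler0 scale0r subr0 addr0 enorm0 /yh eqxx.
  rewrite pucci_scalar_outer; last by rewrite dot_delta mxE !eqxx.
  rewrite addr0 /pm oppr_gt0 ltNge (ltW y00)/= enorm0 from0 /sol_y0 -natr1.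
  by field; rewrite natr1 !gt_eqF.
have r0 := enorm_gt0 x0; set r := enorm x in r0 *.
pose w : 'rV[R]_n.+1 := r^-1 *: x.
have ww : dot w w = 1.
  by rewrite dotZl dotZr -enorm_sqr -/r; field; rewrite gt_eqF.
have -> : (- yh r)%:M - (y1 r / r) *: (x^T *m x) = (- y r)%:M + (- (r * y1 r)) *: (w^T *m w).
  rewrite yhE// -scaleNr; congr (_ + _).
  apply/matrixP => i j; rewrite !mxE !big_ord1 !mxE.
  by field; rewrite gt_eqF.
rewrite pucci_scalar_outer//.
have [_ _ _ /(_ r)] := prof (r + 1); rewrite r0 ltrDl ltr01 => /(_ isT)[_ _ /= <-].
congr (pm _ + _ * pm _); last by field; rewrite gt_eqF.
by rewrite /y1 -natr1; field; rewrite gt_eqF.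
Qed.

End solution.

End existence.

(** * Shooting *)


Section shooting.
Context {R : realType} (cp cm lam : R) (n K : nat).
Hypotheses (lam0 : 0 < lam) (lamp : lam <= cp) (lamm : lam <= cm) (n0 : (0 < n)%N).
Hypothesis hK : n%:R * cm / lam <= K%:R.
Implicit Types (y z u v f g h P Q : R -> R) (r s t xi eta x c : R).

Let cm0 : 0 < cm. Proof. exact: lt_le_trans lamm. Qed.
Let k : R := n.+1%:R * cm.
Let k0 : 0 < k. Proof. by rewrite mulr_gt0// ltr0n. Qed.

Definition nonlinearity P := [/\ forall x, 0 <= P x, {homo P : x y / x <= y},
  forall x, {for x, continuous P}, loc_lip P & forall x, 0 < x -> 0 < P x].

(* [y = - u' / r] and [z = - v' / r]; the bounds [c], [c'] on [y], [z] come from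
   the values of the right-hand sides at the origin, where they are largest. *)
Definition sys P Q xi eta c c' y z := [/\ 0 < xi /\ 0 < eta, P eta <= k * c,
  Q xi <= k * c', half_sol cp cm n K P eta c y z & half_sol cp cm n K Q xi c' z y].

(** Through this symmetry each fact about the first component also serves for the second one. *)
Lemma sys_swap P Q xi eta c c' y z :
  sys P Q xi eta c c' y z -> sys Q P eta xi c' c z y.
Proof. by move=> [[? ?] ? ? ? ?]; split. Qed.

(* [u] vanishes strictly before [v]: an open condition, and monotone in [eta]. *)
Definition first xi eta y z := exists2 r, 0 < r & from xi y r < 0 < from eta z r.

Section facts.
Variables (P Q : R -> R).
Hypotheses (nP : nonlinearity P).

Section one.
Variables (xi eta c c' : R) (y z : R -> R).
Hypothesis hs : sys P Q xi eta c c' y z.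

Lemma sys_bm : bounded_measurable y.
Proof. by have [_ _ _ [] ? _ _ _ _] := hs. Qed.

Lemma sys_bounds r : 0 <= r -> 0 <= y r <= c.
Proof. by have [_ _ _ [] _ + _ _ _] := hs; apply. Qed.

Lemma sys_c_ge0 : 0 <= c.
Proof. by have /andP[h1 h2] := sys_bounds (lexx 0); exact: le_trans h2. Qed.

End one.

Section two.
Variables (xi eta c c' : R) (y z : R -> R).
Hypothesis hs : sys P Q xi eta c c' y z.
Let bz : bounded_measurable z. Proof. by have [_ _ _ _ []] := hs. Qed.
Let zb r : 0 <= r -> 0 <= z r. Proof. by have [_ _ _ _ [_ + _ _]] := hs => H /H/andP[]. Qed.

Lemma sys_gt0 r : 0 < r -> 0 < y r.
Proof.
have [[xi0 eta0] Pc Qc hy hz] := hs; have [P0 mP cP lP pP] := nP.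
exact: (sol_gt0 lam0 lamp lamm hK P0 mP cP Pc (pP _ eta0) hy bz zb).
Qed.

Lemma sys_profile T : profile cp cm n T (from xi y) (fun r => - (r * y r))
  (fun r => K%:R * y r - rhs cp cm n K P y eta z r) (P \o from eta z).
Proof.
have [[xi0 eta0] Pc Qc hy hz] := hs; have [P0 mP cP lP pP] := nP.
by apply: (sol_profile lam0 lamp lamm hK P0 mP cP Pc (pP _ eta0) hy bz zb); exact: sys_bm hs.
Qed.

Lemma sys_radial : C2_on setT (fun x : 'rV[R]_n.+1 => from xi y (enorm x)) /\
  forall x : 'rV[R]_n.+1, pucci cp cm (hessian (fun x : 'rV[R]_n.+1 => from xi y (enorm x)) x) =
    - P (from eta z (enorm x)).
Proof.
have [[xi0 eta0] Pc Qc hy hz] := hs; have [P0 mP cP lP pP] := nP.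
by apply: (sol_radial lam0 lamp lamm hK P0 mP cP Pc (pP _ eta0) hy bz zb); exact: sys_bm hs.
Qed.

Lemma sys_lower G r : 0 <= G -> 0 < r -> (forall s, 0 <= s <= r -> G <= P (from eta z s)) ->
  G / cm / K.+1%:R <= y r.
Proof.
have [[xi0 eta0] Pc Qc hy hz] := hs; have [P0 mP cP lP pP] := nP.
exact: (sol_lower lam0 lamp lamm hK hy).
Qed.

Lemma sys_cont r : 0 < r -> {for r, continuous (from xi y)}.
Proof. by move=> r0; apply: from_cont => //; exact: sys_bm hs. Qed.

Lemma sys_derive r : 0 < r -> is_derive r 1 (from xi y) (- (r * y r)).
Proof.
move=> r0; have [_ _ _ /(_ r)] := sys_profile (r + 1).
by rewrite r0 ltrDl ltr01 => /(_ isT)[].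
Qed.

Lemma sys_le r : 0 <= r -> from xi y r <= xi.
Proof. by move=> r0; apply: from_le => s /(sys_bounds hs)/andP[]. Qed.

Lemma sys_dec a b : 0 <= a < b -> from xi y b < from xi y a.
Proof.
have pos a' b' : 0 < a' < b' -> from xi y b' < from xi y a'.
  move=> /andP[a0 ab].
  have [t /andP[t1 t2]|t /andP[t1 t2] E] := @MVT_lt R (from xi y) (fun r => - (r * y r)) a' b' ab.
    by apply: sys_derive; rewrite (lt_le_trans a0).
  have t0 := lt_trans a0 t1.
  by rewrite -subr_lt0 E mulNr oppr_lt0 !mulr_gt0 ?subr_gt0// sys_gt0.
move=> /andP[a0 ab]; have [aE|an0] := eqVneq a 0; last first.
  by apply: pos; rewrite ab andbT lt_neqAle eq_sym an0 a0.
have b0 : 0 < b by rewrite -aE.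
rewrite aE from0; apply: (@lt_le_trans _ _ (from xi y (b / 2))).
  by apply: pos; rewrite divr_gt0//= ltr_pdivrMr// ltr_pMr// ltr1n.
by apply: sys_le; rewrite divr_ge0// ltW.
Qed.

Lemma sys_drop a b (g : R) : 0 < a < b -> 0 <= g -> (forall r, a <= r <= b -> g <= y r) ->
  from xi y b <= xi - a * g * (b - a).
Proof.
move=> /andP[a0 ab] g0 gy.
have [t /andP[t1 t2]|t /andP[t1 t2] E] := @MVT_le R (from xi y) (fun r => - (r * y r)) a b (ltW ab).
  by apply: sys_derive; rewrite (lt_le_trans a0).
have h1 : a * g <= t * y t by rewrite ler_pM// ?(ltW a0)// gy// t1.
have h2 := sys_le (ltW a0).
have h3 : a * g * (b - a) <= t * y t * (b - a) by rewrite ler_wpM2r// subr_ge0 ltW.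
by move: E h2 h3; rewrite mulNr; lra.
Qed.

Lemma sys_lower_u r : 0 <= r -> xi - r * c * r <= from xi y r.
Proof.
move=> r0; rewrite /from lerD2l lerN2.
have b s : 0 <= s <= r -> `|s * y s| <= r * c.
  move=> /andP[s0 sr]; have /andP[h1 h2] := sys_bounds hs s0.
  by rewrite normrM !ger0_norm// ler_pM.
have := prim_lip (bm_powM 1 (sys_bm hs)) b (a := 0) (b := r).
rewrite !lexx r0 => /(_ isT isT); rewrite prim0 !subr0.
exact: le_trans (ler_norm _).
Qed.

Lemma sys_zero r : 0 < r -> from xi y r <= 0 -> exists2 r1, 0 < r1 <= r & from xi y r1 = 0.
Proof.
move=> r0 ur; have [[xi0 _] _ _ _ _] := hs.
have [d d0 Hd] := from_rcont xi (sys_bm hs) xi0.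
pose a := Num.min r (d / 2).
have a0 : 0 < a by rewrite lt_min r0 divr_gt0.
have ad : a < d by rewrite gt_min ltr_pdivrMr// ltr_pMr// ltr1n orbT.
have ar : a <= r by rewrite ge_min lexx.
have ua : 0 < from xi y a.
  have := Hd a; rewrite add0r (ltW a0) ad from0 => /(_ isT).
  by rewrite ltr_norml => /andP[+ _]; rewrite ltrBrDl subrr.
have [||r1] := @IVT R (from xi y) a r 0 ar.
- apply: continuous_in_subspaceT => s; rewrite inE /= in_itv /= => /andP[s1 _].
  by apply: sys_cont; exact: lt_le_trans s1.
- by rewrite ge_min ur orbT le_max (ltW ua).
- rewrite in_itv /= => /andP[ar1 r1r] E; exists r1 => //.
  by rewrite r1r (lt_le_trans a0).
Qed.

End two.

End facts.

Lemma sys_not_both P Q xi eta c c' y z : nonlinearity P -> nonlinearity Q ->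
  sys P Q xi eta c c' y z ->
  first xi eta y z -> first eta xi z y -> False.
Proof.
move=> nP nQ hs [r r0 /andP[ur vr]] [s s0 /andP[vs us]].
have mono P' Q' xi' eta' d d' y' z' (nP' : nonlinearity P') a b :
    sys P' Q' xi' eta' d d' y' z' -> 0 < a <= b ->
    from xi' y' b <= from xi' y' a.
  move=> hs' /andP[a0]; rewrite le_eqVlt => /predU1P[->//|ab].
  by apply: ltW; apply: (sys_dec nP' hs'); rewrite (ltW a0).
have [rs|/ltW sr] := leP r s.
  have := mono _ _ _ _ _ _ _ _ nP r s hs; rewrite r0 rs => /(_ isT).
  by move=> /(lt_le_trans us) /lt_trans/(_ ur); rewrite ltxx.
have := mono _ _ _ _ _ _ _ _ nQ s r (sys_swap hs); rewrite s0 sr => /(_ isT).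
by move=> /(lt_le_trans vr) /lt_trans/(_ vs); rewrite ltxx.
Qed.

(** Both components decrease strictly, past their zeros too since the nonlinearities are
    nonnegative. Each thus has at most one zero, and between two distinct zeros the signs are
    opposite. *)
Lemma sys_cases P Q xi eta c c' y z : nonlinearity P -> nonlinearity Q ->
  sys P Q xi eta c c' y z ->
  [\/ first xi eta y z, first eta xi z y,
    exists2 r0, 0 < r0 & (forall r, 0 <= r < r0 -> 0 < from xi y r /\ 0 < from eta z r) /\
      from xi y r0 = 0 /\ from eta z r0 = 0 |
    forall r, 0 <= r -> 0 < from xi y r /\ 0 < from eta z r].
Proof.
move=> nP nQ hs; have hs' := sys_swap hs.
have [[xi0 eta0] _ _ _ _] := hs.
have dich P' Q' xi' eta' d d' y' z' (nP' : nonlinearity P') :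
    sys P' Q' xi' eta' d d' y' z' ->
    (forall r, 0 <= r -> 0 < from xi' y' r) \/ exists2 r1, 0 < r1 & from xi' y' r1 = 0.
  move=> H; case: (pselect (exists2 r, 0 < r & from xi' y' r <= 0)) => [[r r0 ur]|ne].
    by right; have [r1 /andP[r10 _] E] := sys_zero H r0 ur; exists r1.
  left=> r; rewrite le_eqVlt => /predU1P[<-|r0]; first by rewrite from0; case: H => [[]].
  by rewrite ltNge; apply/negP => ur; apply: ne; exists r.
have [pu|[r1 r10 u1]] := dich _ _ _ _ _ _ _ _ nP hs;
  have [pv|[r2 r20 v1]] := dich _ _ _ _ _ _ _ _ nQ hs'.
- by apply: Or44 => r r0; split; [exact: pu|exact: pv].
- apply: Or42; exists (r2 + 1); first exact: addr_gt0.
  rewrite pu ?addr_ge0 ?ltW//= andbT -v1.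
  by apply: (sys_dec nQ hs'); rewrite ltW//= ltrDl.
- apply: Or41; exists (r1 + 1); first exact: addr_gt0.
  rewrite pv ?addr_ge0 ?ltW//= andbT -u1.
  by apply: (sys_dec nP hs); rewrite ltW//= ltrDl.
have mid (a b : R) : 0 < a < b -> [/\ 0 < (a + b) / 2, a < (a + b) / 2 & (a + b) / 2 < b].
  by move=> /andP[a0 ab]; split; lra.
case: (ltgtP r1 r2) => r12.
- have [m0 m1 m2] := mid r1 r2 (introT andP (conj r10 r12)).
  apply: Or41; exists ((r1 + r2) / 2) => //; apply/andP; split.
    by rewrite -u1; apply: (sys_dec nP hs); rewrite ltW.
  by rewrite -v1; apply: (sys_dec nQ hs'); rewrite ltW.
- have [m0 m1 m2] := mid r2 r1 (introT andP (conj r20 r12)).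
  apply: Or42; exists ((r2 + r1) / 2) => //; apply/andP; split.
    by rewrite -v1; apply: (sys_dec nQ hs'); rewrite ltW.
  by rewrite -u1; apply: (sys_dec nP hs); rewrite ltW.
- apply: Or43; exists r1 => //; split; last by rewrite {2}r12.
  move=> r rr; split; first by rewrite -u1; exact: (sys_dec nP hs).
  by rewrite -v1; apply: (sys_dec nQ hs'); rewrite -r12.
Qed.

Lemma cont_eq_left f g a : 0 < a -> {for a, continuous f} -> {for a, continuous g} ->
  (forall r, 0 <= r < a -> f r = g r) -> f a = g a.
Proof.
move=> a0 cf cg fg; apply/eqP; rewrite eq_le -subr_le0 -[X in _ && X]subr_le0.
apply/andP; split.
  apply: (@left_lim_le R (fun r => f r - g r)) => //; first exact: continuousB.
  by move=> t /fg ->; rewrite subrr.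
apply: (@left_lim_le R (fun r => g r - f r)) => //; first exact: continuousB.
by move=> t /fg ->; rewrite subrr.
Qed.

(** Two solutions with the same data are known to agree only up to the first zero. That reaches the
    zero of [u] with [v] still positive; just beyond it the other solution also has [u] negative, by
    strict decrease, and [v] positive, by continuity. *)
Lemma sys_transfer P Q xi eta c c' y z d d' y' z' : nonlinearity P -> nonlinearity Q ->
  sys P Q xi eta c c' y z -> sys P Q xi eta d d' y' z' ->
  first xi eta y z -> first xi eta y' z'.
Proof.
move=> nP nQ hs hs' [r r0 /andP[ur vr]].
have [r1 /andP[r10 r1r] ur1] := sys_zero hs r0 (ltW ur).
have vpos s : 0 <= s <= r1 -> 0 < from eta z s.
  move=> /andP[s0 sr1]; have := le_trans sr1 r1r; rewrite le_eqVlt => /predU1P[->//|sr].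
  by apply: lt_trans vr _; apply: (sys_dec nQ (sys_swap hs)); rewrite s0.
have [_ _ _ lP _] := nP; have [_ _ _ lQ _] := nQ.
have eq s : 0 <= s < r1 -> from xi y s = from xi y' s /\ from eta z s = from eta z' s.
  apply: (system_unique lam0 lamp lamm n0 lP lQ (sys_profile nP hs r1)
    (sys_profile nQ (sys_swap hs) r1) (sys_profile nP hs' r1)
    (sys_profile nQ (sys_swap hs') r1)); rewrite ?from0//.
  move=> t /andP[t0 tr1]; split; last by apply: vpos; rewrite t0 ltW.
  by rewrite -ur1; apply: (sys_dec nP hs); rewrite t0.
have u'r1 : from xi y' r1 = 0.
  rewrite -ur1; apply: esym; apply: (cont_eq_left r10); [exact: (sys_cont hs r10)|exact: (sys_cont hs' r10)|].
  by move=> s /eq[].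
have v'r1 : 0 < from eta z' r1.
  rewrite -(@cont_eq_left (from eta z) (from eta z') r1 r10); first by apply: vpos; rewrite (ltW r10) lexx.
  - exact: (sys_cont (sys_swap hs) r10).
  - exact: (sys_cont (sys_swap hs') r10).
  - by move=> s /eq[].
have /continuous_eps/(_ _ v'r1)[e e0 He] := sys_cont (sys_swap hs') r10.
exists (r1 + e / 2); first by rewrite addr_gt0// divr_gt0.
apply/andP; split.
  by rewrite -u'r1; apply: (sys_dec nP hs'); rewrite ltW//= ltrDl divr_gt0.
have := He (r1 + e / 2); rewrite addrC addKr gtr0_norm ?divr_gt0//.
rewrite ltr_pdivrMr// ltr_pMr// ltr1n => /(_ isT).
by rewrite ltr_norml => /andP[+ _]; rewrite ltrBrDl subrr.
Qed.

(** The order of the derivatives becomes an order of [y] and [z] after division by [r]. It is stated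
    for every real [r] so that monotone pointwise limits exist everywhere; for [r <= 0] all averages
    are 0. *)
Lemma sys_order P Q xi eta eta' c c' y z d d' y' z' : nonlinearity P -> nonlinearity Q ->
  sys P Q xi eta c c' y z -> sys P Q xi eta' d d' y' z' -> eta < eta' ->
  forall r, [/\ y r <= y' r, z' r <= z r,
    0 <= r -> from xi y' r <= from xi y r & 0 <= r -> from eta z r <= from eta' z' r].
Proof.
move=> nP nQ hs hs' ee r.
have [_ mP _ _ _] := nP; have [_ mQ _ _ _] := nQ.
have [r0|r0] := ltP r 0.
  have neg P' Q' xi' e' b b' (w x : R -> R) : sys P' Q' xi' e' b b' w x -> w r = 0.
    by move=> [_ _ _ [_ _ _ ->] _]; rewrite avg_lt0.
  by rewrite (neg _ _ _ _ _ _ _ _ hs) (neg _ _ _ _ _ _ _ _ hs')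
    (neg _ _ _ _ _ _ _ _ (sys_swap hs)) (neg _ _ _ _ _ _ _ _ (sys_swap hs'));
    split=> //; rewrite leNgt r0.
have e1 : from xi y' 0 <= from xi y 0 by rewrite !from0.
have e2 : from eta z 0 < from eta' z' 0 by rewrite !from0.
have rr : 0 <= r < r + 1 by rewrite r0 ltrDl ltr01.
have [uu vv u1 v1] := system_order lam0 lamp lamm n0 mP mQ (sys_profile nP hs' (r + 1))
    (sys_profile nQ (sys_swap hs') (r + 1)) (sys_profile nP hs (r + 1))
    (sys_profile nQ (sys_swap hs) (r + 1)) e1 e2 rr.
have [->|rn0] := eqVneq r 0.
  have z0 P' Q' xi' e' b b' (w x : R -> R) : sys P' Q' xi' e' b b' w x -> w 0 = 0.
    by move=> [_ _ _ [_ _ _ ->] _]; rewrite avg0.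
  by rewrite (z0 _ _ _ _ _ _ _ _ hs) (z0 _ _ _ _ _ _ _ _ hs')
    (z0 _ _ _ _ _ _ _ _ (sys_swap hs)) (z0 _ _ _ _ _ _ _ _ (sys_swap hs'))
    !from0 (ltW ee).
have rp : 0 < r by rewrite lt_neqAle eq_sym rn0.
move: u1 v1; rewrite !lerN2 !ler_pM2l// => u1 v1.
split=> // _; move: vv; rewrite !from0; lra.
Qed.

Lemma from_cvg (e_ : nat -> R) (z_ : nat -> R -> R) e z c r :
  (forall m, bounded_measurable (z_ m)) -> (forall m r, 0 <= r -> 0 <= z_ m r <= c) ->
  e_ @ \oo --> e -> (forall r, z_ ^~ r @ \oo --> z r) -> 0 <= r ->
  (fun m => from (e_ m) (z_ m) r) @ \oo --> from e z r.
Proof.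
move=> gz zb ce cz r0; apply: cvgB => //.
have [|T|s _|_] := @prim_dct R (fun m s => s * z_ m s) (fun s => s * z s).
- by move=> m; exact: (bm_powM 1 (gz m)).
- exists (`|T| * c) => m s /andP[s0 sT]; have /andP[h1 h2] := zb m s s0.
  rewrite normrM; apply: ler_pM => //; rewrite ger0_norm//.
  by rewrite (le_trans sT)// ler_norm.
- by apply: cvgMr; exact: cz.
by apply.
Qed.

Lemma sys_limit P Q xi eta c c' E (e_ : nat -> R) (y_ z_ : nat -> R -> R) :
  nonlinearity P -> nonlinearity Q -> 0 < eta -> P E <= k * c -> (forall m, e_ m <= E) ->
  (forall m, sys P Q xi (e_ m) c c' (y_ m) (z_ m)) -> e_ @ \oo --> eta ->
  (forall r, cvgn (y_ ^~ r)) -> (forall r, cvgn (z_ ^~ r)) ->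
  exists y z, [/\ sys P Q xi eta c c' y z, forall r, y_ ^~ r @ \oo --> y r &
    forall r, z_ ^~ r @ \oo --> z r].
Proof.
move=> nP nQ eta0 Pc eE hs ce cy cz.
have [P0 mP cP lP pP] := nP; have [Q0 mQ cQ lQ pQ] := nQ.
have [[xi0 _] _ Qc _ _] := hs 0%N.
exists (fun r => limn (y_ ^~ r)), (fun r => limn (z_ ^~ r)); split; [|exact: cy|exact: cz].
have etaE : eta <= E by exact: (seq_le_lim ce).
have ady m : adm c (y_ m).
  by split; [exact: sys_bm (hs m)|exact: sys_bounds (hs m)|move=> r r0;
    have [_ _ _ [_ _ gh ->] _] := hs m; exact: avg_cont].
have adz m : adm c' (z_ m).
  by split; [exact: sys_bm (sys_swap (hs m))|exact: sys_bounds (sys_swap (hs m))|move=> r r0;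
    have [_ _ _ _ [_ _ gh ->]] := hs m; exact: avg_cont].
split=> //.
- by apply: le_trans Pc; exact: mP.
- apply: (half_limit lam0 lamp lamm hK P0 mP cP Pc (sys_c_ge0 (hs 0%N)) eE ady adz _ ce cy cz cy).
  by move=> m; have [_ _ _ []] := hs m.
- apply: (half_limit lam0 lamp lamm hK Q0 mQ cQ Qc (sys_c_ge0 (sys_swap (hs 0%N)))
    (fun=> lexx xi) adz ady _ (cvg_cst _) cz cy cz).
  by move=> m; have [_ _ _ _ []] := hs m.
Qed.


Lemma sys_range P Q xi eta c c' y z : sys P Q xi eta c c' y z -> forall r, 0 <= y r <= c.
Proof.
move=> hs r; have [r0|r0] := ltP r 0; last exact: sys_bounds hs _ r0.
have [_ _ _ [_ _ _ ->] _] := hs.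
by rewrite avg_lt0// lexx (sys_c_ge0 hs).
Qed.

(** On [[r / 2, r]] the slope [- u'] is at least [r / 2] times the lower bound of [y], so [u] loses
    [r^2 / 4] times that bound there. *)
Lemma sys_first P Q xi eta c c' y z r (G : R) : nonlinearity P -> sys P Q xi eta c c' y z ->
  0 <= G -> 0 < r -> (forall s, 0 <= s <= r -> G <= P (from eta z s)) ->
  xi < r * r / 4 * (G / cm / K.+1%:R) -> 0 < from eta z r -> first xi eta y z.
Proof.
move=> nP hs G0 r0 hG gt v0; exists r => //; rewrite v0 andbT.
set g := G / cm / K.+1%:R in gt *.
have g0 : 0 <= g by rewrite !divr_ge0 ?(ltW cm0)// ler0n.
have r2 : 0 < r / 2 by rewrite divr_gt0.
have r2r : r / 2 < r by rewrite ltr_pdivrMr// ltr_pMr// ltr1n.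
have gy s : r / 2 <= s <= r -> g <= y s.
  move=> /andP[rs sr]; apply: (sys_lower nP hs G0); first exact: lt_le_trans rs.
  by move=> t /andP[t0 ts]; apply: hG; rewrite t0 (le_trans ts).
have := sys_drop nP hs (introT andP (conj r2 r2r)) g0 gy.
move: gt; nra.
Qed.

Lemma sys_exists P Q xi eta c c' : nonlinearity P -> nonlinearity Q ->
  0 < xi -> 0 < eta -> P eta <= k * c -> Q xi <= k * c' -> exists y z, sys P Q xi eta c c' y z.
Proof.
move=> [P0 mP cP _ _] [Q0 mQ cQ _ _] xi0 eta0 Pc Qc.
have c0 : 0 <= c by rewrite -(pmulr_rge0 _ k0) (le_trans (P0 eta)).
have c'0 : 0 <= c' by rewrite -(pmulr_rge0 _ k0) (le_trans (Q0 xi)).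
have [y [z [hy hz]]] := solution_exists lam0 lamp lamm hK P0 mP cP Q0 mQ cQ Pc c0 Qc c'0.
by exists y, z.
Qed.

(** Allows one bound for all [eta] up to [E], as limits in [eta] need. *)
Lemma sys_weaken P Q xi eta c c' d y z : sys P Q xi eta c c' y z -> c <= d ->
  sys P Q xi eta d c' y z.
Proof.
move=> [xe Pc Qc [h1 h2 h3 h4] hz] cd; split=> //.
  by apply: le_trans Pc _; rewrite ler_pM2l.
by split=> // r r0; have /andP[-> h] := h2 r r0; exact: le_trans cd.
Qed.

(** Strictly monotone data give monotone, hence convergent, sequences of solutions. The limit solves
    the system with data [eta] but may be another solution than the given one, hence [sys_transfer];
    its strict signs at one radius then pass to a member of the sequence. *)
Lemma sys_seq_first P Q xi eta c c' E (e_ : nat -> R) (y_ z_ : nat -> R -> R) d d' y z :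
  nonlinearity P -> nonlinearity Q -> P E <= k * c -> (forall m, e_ m <= E) ->
  (forall m, sys P Q xi (e_ m) c c' (y_ m) (z_ m)) -> e_ @ \oo --> eta ->
  (forall m, e_ m < e_ m.+1) \/ (forall m, e_ m.+1 < e_ m) ->
  sys P Q xi eta d d' y z ->
  (first xi eta y z -> exists m, first xi (e_ m) (y_ m) (z_ m)) /\
  (first eta xi z y -> exists m, first (e_ m) xi (z_ m) (y_ m)).
Proof.
move=> nP nQ Pc eE hs ce me h0; have [[xi0 eta0] _ _ _ _] := h0.
have cvg_mono (w_ : nat -> R) b : (forall m, 0 <= w_ m <= b) ->
    (forall m, w_ m <= w_ m.+1) \/ (forall m, w_ m.+1 <= w_ m) -> cvgn w_.
  move=> wb [mw|mw].
    apply: nondecreasing_is_cvgn; first exact/nondecreasing_seqP.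
    by exists b => _ [m _ <-]; have /andP[] := wb m.
  apply: nonincreasing_is_cvgn; first exact/nonincreasing_seqP.
  by exists 0 => _ [m _ <-]; have /andP[] := wb m.
have ord r : (forall m, y_ m r <= y_ m.+1 r) /\ (forall m, z_ m.+1 r <= z_ m r) \/
             (forall m, y_ m.+1 r <= y_ m r) /\ (forall m, z_ m r <= z_ m.+1 r).
  case: me => me; [left|right]; split=> m.
  - by have [] := sys_order nP nQ (hs m) (hs m.+1) (me m) r.
  - by have [] := sys_order nP nQ (hs m) (hs m.+1) (me m) r.
  - by have [] := sys_order nP nQ (hs m.+1) (hs m) (me m) r.
  - by have [] := sys_order nP nQ (hs m.+1) (hs m) (me m) r.
have cy r : cvgn (y_ ^~ r).
  apply: (cvg_mono (y_ ^~ r) c) => [m|]; first exact: sys_range (hs m) r.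
  by have [[]|[]] := ord r; [left|right].
have cz r : cvgn (z_ ^~ r).
  apply: (cvg_mono (z_ ^~ r) c') => [m|]; first exact: sys_range (sys_swap (hs m)) r.
  by have [[]|[]] := ord r; [right|left].
have [y' [z' [h' cy' cz']]] := sys_limit nP nQ eta0 Pc eE hs ce cy cz.
have cu r : 0 <= r -> (fun m => from xi (y_ m) r) @ \oo --> from xi y' r.
  apply: (from_cvg _ _ (cvg_cst _) cy') => m; first exact: sys_bm (hs m).
  exact: sys_bounds (hs m).
have cv r : 0 <= r -> (fun m => from (e_ m) (z_ m) r) @ \oo --> from eta z' r.
  apply: (from_cvg _ _ ce cz') => m; first exact: sys_bm (sys_swap (hs m)).
  exact: sys_bounds (sys_swap (hs m)).
have ev (f_ g_ : nat -> R) (f g : R) : f_ @ \oo --> f -> g_ @ \oo --> g -> f < 0 < g ->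
    exists m, f_ m < 0 < g_ m.
  move=> cf cg /andP[f0 g0].
  have H : \forall m \near \oo, f_ m < 0 /\ 0 < g_ m.
    near=> m; split; near: m.
      by move/cvgrPdist_lt: cf => /(_ (- f)); rewrite oppr_gt0 => /(_ f0);
         apply: filterS => m; rewrite ltr_norml => /andP[]; lra.
    by move/cvgrPdist_lt: cg => /(_ g g0);
       apply: filterS => m; rewrite ltr_norml => /andP[]; lra.
  have [m _ /(_ m (leqnn m)) [h1 h2]] := H.
  by exists m; rewrite h1 h2.
split=> F.
  have [r r0 sgn] := sys_transfer nP nQ h0 h' F.
  have [m hm] := ev _ _ _ _ (cu r (ltW r0)) (cv r (ltW r0)) sgn.
  by exists m, r.
have [r r0 sgn] := sys_transfer nQ nP (sys_swap h0) (sys_swap h') F.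
have [m hm] := ev _ _ _ _ (cv r (ltW r0)) (cu r (ltW r0)) sgn.
by exists m, r.
Unshelve. all: by end_near. Qed.

Lemma shooting P Q : nonlinearity P -> nonlinearity Q ->
  (forall A : R, exists2 x : R, 0 < x & A <= P x) ->
  exists xi eta c c' y z, sys P Q xi eta c c' y z /\
   ((exists2 r0, 0 < r0 & (forall r, 0 <= r < r0 -> 0 < from xi y r /\ 0 < from eta z r) /\
      from xi y r0 = 0 /\ from eta z r0 = 0) \/
    forall r, 0 <= r -> 0 < from xi y r /\ 0 < from eta z r).
Proof.
move=> nP nQ Pinf; apply: contrapT => none.
have [P0 mP _ _ _] := nP; have [Q0 mQ _ _ posQ] := nQ.
pose c' := Q 1 / k.
have Qc : Q 1 <= k * c' by rewrite mulrC divfK ?gt_eqF.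
have c'0 : 0 <= c' by rewrite divr_ge0 ?Q0 ?ltW.
have Kp : 0 < K.+1%:R :> R by rewrite ltr0n.
(* The datum [E = c' + x] keeps [v >= x] on [[0, 1]], where [v] loses at most [c']. The size of
   [P x] then makes [u] lose more than its initial value 1 by radius 1, with the factor 1/4 of
   [sys_first] at [r = 1]. *)
have [x x0 Px] := Pinf (4 * cm * K.+1%:R + 1).
pose E := c' + x.
have E0 : 0 < E by rewrite ltr_wpDl.
pose c := P E / k.
have Pc eta : eta <= E -> P eta <= k * c.
  by move=> /mP; rewrite mulrC divfK ?gt_eqF.
have EU y z : sys P Q 1 E c c' y z -> first 1 E y z.
  move=> hs.
  have vx s : 0 <= s <= 1 -> x <= from E z s.
    move=> /andP[s0 s1]; apply: le_trans (sys_lower_u (sys_swap hs) s0).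
    suff : s * c' * s <= c' by rewrite /E; lra.
    by rewrite mulrAC ler_piMl// mulr_ile1.
  apply: (sys_first nP hs (P0 x) ltr01).
  - by move=> s /vx; exact: mP.
  - suff : 4 < P x / cm / K.+1%:R by move: (_ / K.+1%:R) => g; lra.
    by rewrite !ltr_pdivlMr// mulrAC; apply: lt_le_trans Px; lra.
  - by apply: lt_le_trans (vx 1 _) => //; rewrite ler01 lexx.
pose VF := [set eta : R | 0 < eta <= E /\ exists y z, sys P Q 1 eta c c' y z /\ first eta 1 z y].
have [eta1 VF1] : VF !=set0.
  (* For [eta <= 1] this radius keeps [u >= 1 / 2] on [[0, r]], so [v] loses at least [b] by radius
     [r]; any [eta] below [b] makes [v] vanish first. *)
  pose r := (1 + 2 * (P 1 / k))^-1.
  have pk : 0 <= P 1 / k by rewrite divr_ge0 ?P0 ?ltW.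
  have rd : 0 < 1 + 2 * (P 1 / k) by lra.
  have r0 : 0 < r by rewrite invr_gt0.
  have r1 : r <= 1 by rewrite invf_le1//; lra.
  have rk : r * (P 1 / k) <= 1 / 2.
    by rewrite mulrC ler_pdivrMr//; lra.
  pose g := Q (1 / 2) / cm / K.+1%:R.
  have g0 : 0 < g by rewrite !divr_gt0// posQ// divr_gt0.
  pose b := r * r / 4 * g.
  have b0 : 0 < b by apply: mulr_gt0 => //; apply: divr_gt0 => //; exact: mulr_gt0.
  pose eta := Num.min (Num.min 1 E) (b / 2).
  have eta0 : 0 < eta by rewrite !lt_min ltr01 E0 divr_gt0.
  have eta1 : eta <= 1 by rewrite !ge_min lexx.
  have etaE : eta <= E by rewrite !ge_min lexx orbT.
  have etab : eta < b by rewrite gt_min ltr_pdivrMr// ltr_pMr// ltr1n orbT.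
  have Pe : P eta <= k * (P eta / k) by rewrite mulrC divfK ?gt_eqF.
  have [y [z hs]] := sys_exists nP nQ ltr01 eta0 Pe Qc.
  exists eta; split; first by rewrite eta0.
  exists y, z; split.
    by apply: (sys_weaken hs); rewrite ler_pM2r ?invr_gt0//; exact: mP.
  have ux s : 0 <= s <= r -> 1 / 2 <= from 1 y s.
    move=> /andP[s0 sr]; apply: le_trans (sys_lower_u hs s0).
    suff : s * (P eta / k) * s <= r * (P 1 / k) * 1 by lra.
    have pe : 0 <= P eta / k by rewrite divr_ge0 ?P0 ?ltW.
    apply: ler_pM => //; [exact: mulr_ge0| |exact: le_trans r1].
    by apply: ler_pM => //; rewrite ler_pM2r ?invr_gt0//; exact: mP.
  apply: (sys_first nQ (sys_swap hs) (Q0 (1 / 2)) r0).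
  - by move=> s /ux; exact: mQ.
  - exact: etab.
  - by apply: lt_le_trans (ux r _) => //; rewrite ?divr_gt0// lexx ltW.
have VFs : has_sup VF by split; [exists eta1|exists E => e [/andP[]]].
pose eta0 := sup VF.
have eta0E : eta0 <= E by apply: ge_sup; [exists eta1|move=> e [/andP[]]].
have eta00 : 0 < eta0.
  by have [/andP[h _] _] := VF1; apply: lt_le_trans h _; exact: ub_le_sup VFs.2 _ VF1.
have ex eta : 0 < eta <= E -> {yz | sys P Q 1 eta c c' yz.1 yz.2}.
  move=> /andP[e0 eE]; apply: cid.
  by have [y [z hs]] := sys_exists nP nQ ltr01 e0 (Pc _ eE) Qc; exists (y, z).
have [[y z] /= hs] := ex eta0 (introT andP (conj eta00 eta0E)).
(* Data [eta0 + d / (m + 1)] approach the supremum from above or from below; [d = - eta0 / 2] keeps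
   them positive, and [d <= E - eta0] keeps them below [E]. *)
have seq (d : R) : (0 < d <= E - eta0) \/ d = - (eta0 / 2) ->
    exists (e_ : nat -> R) (y_ z_ : nat -> R -> R), [/\ forall m, e_ m <= E,
      forall m, sys P Q 1 (e_ m) c c' (y_ m) (z_ m), e_ @ \oo --> eta0,
      (forall m, e_ m < e_ m.+1) \/ (forall m, e_ m.+1 < e_ m) &
      forall m, exists2 h, 0 < h & e_ m = eta0 + d * h].
  move=> hd; pose e_ m := eta0 + d * @harmonic R m.
  have h01 m : 0 < @harmonic R m <= 1 by rewrite invr_gt0 ltr0n invf_le1 ?ltr0n// ler1n.
  have eE m : 0 < e_ m <= E.
    rewrite /e_; have /andP[h0 h1] := h01 m; case: hd => [/andP[d0 dE]|->].
      have : d * harmonic m <= d * 1 by rewrite ler_pM2l.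
      have : 0 < d * harmonic m by rewrite mulr_gt0.
      by move=> ? ?; apply/andP; split; lra.
    have : eta0 / 2 * harmonic m <= eta0 / 2 * 1 by rewrite ler_pM2l// divr_gt0.
    have : 0 < eta0 / 2 * harmonic m by rewrite mulr_gt0// divr_gt0.
    by move=> ? ?; apply/andP; split; lra.
  exists e_, (fun m => (projT1 (ex _ (eE m))).1), (fun m => (projT1 (ex _ (eE m))).2); split.
  - by move=> m; have /andP[] := eE m.
  - by move=> m; exact: projT2 (ex _ (eE m)).
  - have : d * @harmonic R m @[m --> \oo] --> d * 0 by apply: cvgMr; exact: cvg_harmonic.
    rewrite mulr0 => H; rewrite -[X in _ --> X]addr0.
    by apply: cvgD; [exact: cvg_cst|].
  - have hdec m : @harmonic R m.+1 < @harmonic R m by rewrite ltf_pV2 ?posrE ?ltr0n// ltr_nat.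
    case: hd => [/andP[d0 dE]|dE]; [right|left] => m; rewrite /e_ ltrD2l.
      by rewrite ltr_pM2l.
    by rewrite ltr_nM2l// dE oppr_lt0 divr_gt0.
  - by move=> m; have /andP[h0 _] := h01 m; exists (@harmonic R m).
have [Fu|Fv|S|G] := sys_cases nP nQ hs.
(* If [u] vanished first at the supremum, it would also do so for some smaller [e_ m]. A member of
   [VF] above [e_ m] and the order in [eta] make [v] vanish first at [e_ m] too, which is
   impossible. *)
- have [e_ [y_ [z_ [eE hm ce me eh]]]] := seq (- (eta0 / 2)) (or_intror erefl).
  have [/(_ Fu)[m Fm] _] := sys_seq_first nP nQ (Pc E (lexx E)) eE hm ce me hs.
  have em : e_ m < eta0.
    have [h h0 ->] := eh m; have : 0 < eta0 / 2 * h by rewrite mulr_gt0// divr_gt0.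
    by lra.
  have [e' [_ [y' [z' [hs' [r r0 /andP[vr ur]]]]]] ee'] := sup_gt VFs.1 em.
  have [_ _ u v] := sys_order nP nQ (hm m) hs' ee' r.
  apply: (sys_not_both nP nQ (hm m) Fm); exists r => //.
  by rewrite (le_lt_trans (v (ltW r0)) vr) (lt_le_trans ur (u (ltW r0))).
(* If [v] vanished first at the supremum, then [eta0 < E] because [u] vanishes first at [E], and
   some datum above the supremum would belong to [VF]. *)
- have d0 : 0 < E - eta0.
    rewrite subr_gt0 lt_neqAle eta0E andbT; apply/eqP => EE.
    move: hs Fv; rewrite EE => hs Fv.
    exact: sys_not_both nP nQ hs (EU _ _ hs) Fv.
  have dd : 0 < E - eta0 <= E - eta0 by rewrite d0 lexx.
  have [e_ [y_ [z_ [eE hm ce me eh]]]] := seq (E - eta0) (or_introl dd).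
  have [_ /(_ Fv)[m Fm]] := sys_seq_first nP nQ (Pc E (lexx E)) eE hm ce me hs.
  have em : eta0 < e_ m by have [h h0 ->] := eh m; rewrite ltrDl mulr_gt0.
  have : e_ m <= eta0.
    apply: (ub_le_sup VFs.2); split; first by rewrite eE (lt_trans eta00).
    exact: (ex_intro _ (y_ m) (ex_intro _ (z_ m) (conj (hm m) Fm))).
  by rewrite leNgt em.
- by apply: none; exists 1, eta0, c, c', y, z; split=> //; left.
- by apply: none; exists 1, eta0, c, c', y, z; split=> //; right.
Qed.

End shooting.

(** * Truncated powers *)

Section power.
Context {R : realType} (p : R).
Hypothesis p0 : 0 < p.

(* The power is only used at positive values; truncating at 0 makes it monotone
   and continuous on all of R. *)
Definition pospow (x : R) : R := Num.max x 0 `^ p.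

Lemma pospowE (x : R) : 0 <= x -> pospow x = x `^ p.
Proof. by move=> x0; rewrite /pospow max_l. Qed.

Lemma pospow_homo : {homo pospow : x y / x <= y}.
Proof.
move=> x y xy; apply: ge0_ler_powR; rewrite ?nnegrE; [exact: ltW|by rewrite le_max lexx orbT|by rewrite le_max lexx orbT|].
exact: le_max2.
Qed.

Lemma pospow_gt0 (x : R) : 0 < x -> 0 < pospow x.
Proof. by move=> x0; rewrite pospowE ?ltW// powR_gt0. Qed.

Lemma pospow_loc_lip : loc_lip pospow.
Proof.
(* The function [t^(p - 1)] is monotone, in a direction depending on [p], so the sum of its values
   at [x / 2] and [2 x] bounds it between them in both cases. *)
move=> x x0; pose L := p * ((x / 2) `^ (p - 1) + (2 * x) `^ (p - 1)).
have L0 : 0 < L by rewrite mulr_gt0// addr_gt0// powR_gt0 ?divr_gt0// mulr_gt0.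
exists L, (x / 2); split=> //; first by rewrite divr_gt0.
have lip a b : `|a - x| < x / 2 -> `|b - x| < x / 2 -> a <= b -> `|pospow b - pospow a| <= L * `|b - a|.
  rewrite !ltr_norml => /andP[a1 a2] /andP[b1 b2] ab.
  have a0 : 0 < a by lra.
  have b0 : 0 < b by lra.
  rewrite !pospowE ?(ltW a0) ?(ltW b0)//.
  have [t /andP[t1 t2]|t /andP[t1 t2] ->] := @MVT_le R (fun s => s `^ p) (fun s => p * s `^ (p - 1)) a b ab.
    exact: (@is_derive1_powR R p t (lt_le_trans a0 t1)).
  have t0 := lt_le_trans a0 t1.
  rewrite normrM ler_wpM2r// ger0_norm ?mulr_ge0 ?powR_ge0 ?(ltW p0)//.
  rewrite ler_pM2l//.
  have [p1|p1] := leP 1 p.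
    rewrite ler_wpDl ?powR_ge0//; apply: ge0_ler_powR; rewrite ?nnegrE ?subr_ge0 ?(ltW t0)//; lra.
  rewrite ler_wpDr ?powR_ge0//.
  rewrite -(opprB 1 p) !powRN lef_pV2 ?posrE ?powR_gt0 ?divr_gt0//.
  apply: ge0_ler_powR; rewrite ?nnegrE ?subr_ge0 ?(ltW t0) ?(ltW p1)//; lra.
move=> a b ha hb; have [ab|/ltW ba] := leP a b; last exact: lip.
by rewrite distrC (distrC a); exact: lip.
Qed.

Lemma pospow_continuous (x : R) : {for x, continuous pospow}.
Proof.
have cm0 : {for x, continuous (fun t : R => Num.max t 0)}.
  by apply: continuous_max; [exact: cvg_id|exact: cvg_cst].
have [x0|x0] := ltP 0 x.
  apply/continuous_eps => e e0; have [L [d [L0 d0 H]]] := pospow_loc_lip x0.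
  exists (Num.min d (e / L)); first by rewrite lt_min d0 divr_gt0.
  move=> y; rewrite lt_min => /andP[yd ye].
  apply: le_lt_trans (H _ _ yd _) _; first by rewrite subrr normr0.
  by rewrite mulrC -ltr_pdivlMr.
apply/continuous_eps => e e0.
have x00 : pospow x = 0 by rewrite /pospow max_r// powR0// gt_eqF.
exists (e `^ p^-1); first exact: powR_gt0.
move=> y yx; rewrite x00 subr0 ger0_norm ?powR_ge0//.
have [y0|y0] := leP y 0; first by rewrite /pospow max_r// powR0// gt_eqF.
rewrite pospowE ?ltW//; apply: (@lt_le_trans _ _ (e `^ p^-1 `^ p)).
  apply: gt0_ltr_powR; rewrite ?nnegrE ?powR_ge0 ?(ltW y0)//.
  by apply: le_lt_trans yx; apply: le_trans (ler_norm _); lra.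
by rewrite -powRrM mulVf ?gt_eqF// powRr1// ltW.
Qed.

Lemma pospow_nonlinearity : nonlinearity pospow.
Proof.
split; [by move=> x; exact: powR_ge0|exact: pospow_homo|exact: pospow_continuous|
  exact: pospow_loc_lip|exact: pospow_gt0].
Qed.

Lemma pospow_unbounded (A : R) : exists2 x : R, 0 < x & A <= pospow x.
Proof.
exists ((1 + `|A|) `^ p^-1); first by rewrite powR_gt0 ?ltr_wpDr.
rewrite pospowE ?powR_ge0// -powRrM mulVf ?gt_eqF// powRr1 ?addr_ge0//.
by rewrite ler_wpDl// ler_norm.
Qed.

End power.

(** * The Hopf lemma *)


Section line_hessian.
Context {R : realType} {n : nat}.
Implicit Types (x y xi c e : 'rV[R]_n) (f g : 'rV[R]_n -> R) (A B S : 'M[R]_n).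

(* A pointwise substitute for being C^2 near [x] with Hessian [A], stable under
   composition with affine maps. *)
Definition hess_at f A x := forall xi, exists g1 : R -> R,
  (\forall t \near (0 : R), is_derive (t : R) 1 (fun s : R => f (x + s *: xi)) (g1 t)) /\
  is_derive (0 : R) 1 g1 (qf A xi).

Lemma line_continuous x xi (t : R) : {for t, continuous (fun s : R => x + s *: xi)}.
Proof.
apply: rV_continuous => i.
rewrite (_ : (fun _ => _) = (fun s : R => x 0 i + s * xi 0 i)); last first.
  by apply/funext => s; rewrite !mxE.
by apply: continuousD; [exact: cst_continuous|apply: continuousM; [exact: cvg_id|exact: cst_continuous]].
Qed.

Lemma qdist_continuous c : continuous (fun x => dot (x - c) (x - c)).
Proof.
move=> x; have h : {for x, continuous (fun x => x - c)}.
  by apply: continuousB; [exact: cvg_id|exact: cst_continuous].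
exact: (@dot_continuous R n _ (fun x => x - c) (fun x => x - c) x h h).
Qed.

Lemma near_line (U : set 'rV[R]_n) x xi : nbhs x U -> \forall t \near (0 : R), U (x + t *: xi).
Proof.
have H : (fun s : R => x + s *: xi) @ (0 : R) --> x + (0 : R) *: xi by exact: line_continuous.
by rewrite scale0r addr0 in H => Ux; exact: H U Ux.
Qed.

Lemma hess_at_C2 (U : set 'rV[R]_n) f x : open U -> C2_on U f -> U x -> hess_at f (hessian f x) x.
Proof.
move=> oU Uf Ux xi; exists (fun t : R => \sum_i xi 0 i * partial i f (x + t *: xi)); split.
  have := near_line xi (open_nbhs_nbhs (conj oU Ux)).
  by apply: filterS => t; apply: C1_chain_line => //; case: Uf.
have := @C2_chain_line R n U f x xi 0 oU Uf; rewrite scale0r addr0; exact.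
Qed.

Lemma hess_atB f g A B x : hess_at f A x -> hess_at g B x ->
  hess_at (fun y => f y - g y) (A - B) x.
Proof.
move=> hf hg xi; have [f1 [f1n f2]] := hf xi; have [g1 [g1n g2]] := hg xi.
exists (fun t => f1 t - g1 t); split.
  by apply: filterS2 f1n g1n => t ft gt; exact: is_deriveB.
by rewrite qfD qfN; exact: is_deriveB.
Qed.

Lemma hess_at_affine (sg : 'rV[R]_n -> 'rV[R]_n) S f A x :
  (forall y xi (s : R), sg (y + s *: xi) = sg y + s *: (xi *m S)) ->
  hess_at f A (sg x) -> hess_at (f \o sg) (S *m A *m S^T) x.
Proof.
move=> sgE hf xi; have [f1 [f1n f2]] := hf (xi *m S).
exists f1; split.
  rewrite (_ : (fun _ => _) = (fun s : R => f (sg x + s *: (xi *m S))))//.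
  by apply/funext => s /=; rewrite sgE.
by rewrite /qf !mulmxA dot_mul trmxK.
Qed.

Lemma hess_at_ge0 f A x : hess_at f A x -> (\forall y \near x, f x <= f y) ->
  forall xi, 0 <= qf A xi.
Proof.
move=> hf mf xi; have [f1 [f1n f2]] := hf xi.
apply: (second_order_min f1n f2).
by have := near_line xi mf; apply: filterS => t; rewrite scale0r addr0.
Qed.

Lemma hess_at_exp c x (m al : R) :
  hess_at (fun y => m * expR (- (al * dot (y - c) (y - c))))
    ((m * expR (- (al * dot (x - c) (x - c)))) *:
      ((4 * al ^+ 2) *: ((x - c)^T *m (x - c)) - (2 * al) *: 1%:M)) x.
Proof.
move=> xi; pose w := x - c.
pose q (s : R) := dot w w + (2 * dot w xi) * s + dot xi xi * s ^+ 2.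
pose q1 (s : R) := 2 * dot w xi + 2 * dot xi xi * s.
have qd (t : R) : is_derive t 1 q (q1 t) by exact: quad_derive.
have fE : (fun s : R => m * expR (- (al * dot (x + s *: xi - c) (x + s *: xi - c)))) =
    (fun s : R => m * expR (- al * q s)).
  by apply/funext => s; rewrite -addrA (addrC _ (- c)) addrA dot_line mulNr.
have ed (t : R) : is_derive t 1 (fun s : R => expR (- al * q s)) (expR (- al * q t) * (- al * q1 t)).
  apply: (is_derive_eq (@is_derive1_comp R expR (fun s : R => - al * q s) t _ _ _ _)).
  by [].
exists (fun t : R => m * (expR (- al * q t) * (- al * q1 t))); split.
  by rewrite fE; near=> t; exact: is_deriveZ.
have q1d : is_derive (0 : R) 1 q1 (2 * dot xi xi).
  have := quad_derive (2 * dot w xi) (2 * dot xi xi) 0 (0 : R).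
  rewrite mulr0 addr0 (_ : (fun _ => _) = q1)//.
  by apply/funext => s; rewrite mul0r addr0.
have H := is_deriveZ m (is_deriveM (ed 0) (is_deriveZ (- al) q1d)).
apply: (is_derive_eq H).
rewrite qfZ qfD qfN !qfZ qf_outer qf1 (dotC xi) -/w.
rewrite /q1 /q !mulr0 expr0n /= !mulr0 !addr0 mulNr.
rewrite /GRing.scale /=; ring.
Unshelve. all: by end_near. Qed.

Lemma hess_at_pow e x (l m mu : R) : 0 < dot x e - l ->
  hess_at (fun y => m * (dot y e - l) `^ (1 + mu))
    ((m * ((1 + mu) * mu * (dot x e - l) `^ (mu - 1))) *: (e^T *m e)) x.
Proof.
move=> t0 xi; pose t := dot x e - l; pose d := dot xi e.
have fE : (fun s : R => m * (dot (x + s *: xi) e - l) `^ (1 + mu)) =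
    (fun s : R => m * (t + d * s) `^ (1 + mu)).
  by apply/funext => s; rewrite dotDl dotZl (mulrC s) addrAC.
have ld (s : R) : is_derive s 1 (fun s : R => t + d * s) d.
  have := quad_derive t d 0 s; rewrite mulr0 mul0r addr0 (_ : (fun _ => _) = (fun s : R => t + d * s))//.
  by apply/funext => r; rewrite mul0r addr0.
have pd (a s : R) : 0 < t + d * s ->
    is_derive s 1 (fun s : R => (t + d * s) `^ a) (a * (t + d * s) `^ (a - 1) * d).
  move=> ts; have h := @is_derive1_powR R a _ ts.
  exact: (@is_derive1_comp R (fun r => r `^ a) (fun s : R => t + d * s) s _ _ h (ld s)).
exists (fun s : R => m * ((1 + mu) * (t + d * s) `^ mu * d)); split.
  rewrite fE.
  have : \forall s \near (0 : R), 0 < t + d * s.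
    have /is_derive_cont/continuous_eps/(_ _ t0)[del del0 H] := ld 0.
    apply/nbhs_eps; exists del => // s /H; rewrite mulr0 addr0.
    by rewrite ltr_norml -/t => /andP[+ _]; lra.
  apply: filterS => s ts.
  have := is_deriveZ m (pd (1 + mu) s ts).
  by rewrite (addrC 1 mu) addrK.
have t00 : 0 < t + d * 0 by rewrite mulr0 addr0.
have H := is_deriveZ m (is_deriveZ ((1 + mu) * d) (pd mu 0 t00)).
rewrite (_ : (fun s : R => _) = (fun s : R => m * (((1 + mu) * d) * (t + d * s) `^ mu))); last first.
  by apply/funext => s; ring.
apply: (is_derive_eq H).
rewrite qfZ qf_outer mulr0 addr0 /GRing.scale /= -/t -/d; ring.
Qed.

End line_hessian.

Lemma near_lt {R : realType} (T : topologicalType) (f : T -> R) (x : T) (a : R) :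
  {for x, continuous f} -> f x < a -> \forall y \near x, f y < a.
Proof. by move=> cf fa; apply: (cvgr_lt (f x)) => //; exact: cf. Qed.

Lemma near_gt {R : realType} (T : topologicalType) (f : T -> R) (x : T) (a : R) :
  {for x, continuous f} -> a < f x -> \forall y \near x, a < f y.
Proof. by move=> cf fa; apply: (cvgr_gt (f x)) => //; exact: cf. Qed.

Section comparison.
Context {R : realType} {n : nat} (cp cm lam Lam : R).
Hypotheses (lam0 : 0 < lam) (lL : lam <= Lam).
Hypothesis cpm : (cp = Lam /\ cm = lam) \/ (cp = lam /\ cm = Lam).
Implicit Types (x y xi c e : 'rV[R]_n) (a b f g : 'rV[R]_n -> R) (A B C S : 'M[R]_n).

(** At a local minimum of [a - b - f] the quadratic form of [A - B - C] is nonnegative. Inserted in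
    [pucci_sub], this compares the difference of the operators with one linear elliptic operator
    applied to the barrier [f]. *)
Lemma pucci_min a b f A B C x : hess_at a A x -> hess_at b B x -> hess_at f C x ->
  A^T = A -> B^T = B -> (\forall y \near x, a x - b x - f x <= a y - b y - f y) ->
  exists (S : 'M[R]_n) (c : 'I_n -> R), [/\ S *m S^T = 1%:M,
    forall k, lam <= c k <= Lam &
    \sum_k c k * qf C (row k S) <= pucci cp cm A - pucci cp cm B].
Proof.
move=> ha hb hf sA sB mn.
have pos := hess_at_ge0 (hess_atB (hess_atB ha hb) hf) mn.
have [S [c [SS cb H]]] := pucci_sub lam0 lL cpm sB sA.
exists S, c; split=> //; rewrite -opprB lerNr; apply: le_trans H _.
rewrite -sumrN; apply: ler_sum => k _; rewrite -mulrN.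
apply: ler_wpM2l; first by have /andP[h _] := cb k; rewrite (le_trans _ h)// ltW.
have := pos (row k S); rewrite !qfD !qfN; lra.
Qed.

Lemma sum_qf_outer_ge S (c : 'I_n -> R) y (k be : R) : 0 <= k -> 0 <= be ->
  S *m S^T = 1%:M -> (forall i, lam <= c i <= Lam) ->
  k * (lam * dot y y - be * (n%:R * Lam)) <=
    \sum_i c i * qf (k *: (y^T *m y - be *: 1%:M)) (row i S).
Proof.
move=> k0 be0 SS cb.
have -> : \sum_i c i * qf (k *: (y^T *m y - be *: 1%:M)) (row i S) =
    k * (\sum_i c i * dot (row i S) y ^+ 2 - be * \sum_i c i).
  rewrite mulrBr !mulr_sumr -sumrB; apply: eq_bigr => i _.
  by rewrite qfZ qfD qfN qfZ qf_outer qf1 (row_orth i i SS) eqxx mulr1; ring.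
apply: ler_wpM2l => //; apply: lerB.
  rewrite -(parseval y SS) mulr_sumr; apply: ler_sum => i _.
  by apply: ler_wpM2r; [exact: sqr_ge0|have /andP[] := cb i].
apply: ler_wpM2l => //.
have -> : n%:R * Lam = \sum_(i < n) Lam by rewrite sumr_const card_ord mulr_natl.
by apply: ler_sum => i _; have /andP[] := cb i.
Qed.

(** Stated with pointwise second-order data, so that it also applies when [a] is a reflected
    function. *)
Definition supersol a b x := exists A B,
  [/\ hess_at a A x, hess_at b B x, A^T = A, B^T = B & pucci cp cm A <= pucci cp cm B].

Lemma qball_compact c (r : R) : compact [set x : 'rV[R]_n | dot (x - c) (x - c) <= r].
Proof.
have cq : continuous (fun x : 'rV[R]_n => dot (x - c) (x - c)).
  exact: qdist_continuous.
apply: bounded_closed_compact; last exact: closed_enorm_le cq.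
exists (`|c| + Num.sqrt r); split; first exact: num_real.
move=> M hM x /= xr; apply: le_trans (ltW hM).
rewrite -[x](subrK c) addrC; apply: le_trans (ler_normD _ _) _; rewrite lerD2l.
by apply: le_trans (norm_le_enorm _) _; rewrite enormE ler_sqrt// (le_trans (dot_ge0 _) xr).
Qed.

(* Barrier [exp (- al |x - c|^2)], a strict subsolution away from the center for
   [al] large. *)
Lemma hopf a b c (r : R) : 0 < r -> continuous a -> continuous b ->
  (forall x, dot (x - c) (x - c) <= r -> b x <= a x) -> b c < a c ->
  (forall x, dot (x - c) (x - c) < r -> supersol a b x) ->
  exists2 ep : R, 0 < ep & forall x, dot (x - c) (x - c) <= r ->
    ep * (r - dot (x - c) (x - c)) <= a x - b x.
Proof.
move=> r0 ca cb ab abc sup.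
have L0 := lt_le_trans lam0 lL.
pose q x := dot (x - c) (x - c).
have cq : continuous q.
  exact: qdist_continuous.
have q0 x : 0 <= q x by exact: dot_ge0.
pose m := (a c - b c) / 2.
have m0 : 0 < m by rewrite divr_gt0// subr_gt0.
(* A small ball around the center on which [a - b] is at least [m]; the barrier need not be a
   subsolution there. *)
have [D D0 Dm] : exists2 D, 0 < D & forall x, q x <= D -> m <= a x - b x.
  have /continuous_eps/(_ m m0)[d d0 H] : {for c, continuous (fun x => a x - b x)}.
    by apply: continuousB; [exact: ca|exact: cb].
  exists ((d / 2) ^+ 2); first by rewrite exprn_gt0// divr_gt0.
  move=> x xD; have : `|x - c| < d.
    apply: le_lt_trans (norm_le_enorm _) _; apply: (@le_lt_trans _ _ (d / 2)); last by lra.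
    by rewrite -ler_sqr ?nnegrE ?enorm_ge0 ?divr_ge0 ?(ltW d0)// enorm_sqr.
  by move=> /H; rewrite ltr_norml /m => /andP[+ _]; lra.
(* Chosen so that the rank-one part of the Hessian of the barrier, weighted by [lam], beats its
   scalar part, weighted by [n Lam], wherever [|x - c|^2] is at least [D]. *)
pose al := n%:R * Lam / (2 * lam * D) + 1.
have al0 : 0 < al by rewrite ltr_wpDl// !divr_ge0 ?mulr_ge0 ?(ltW D0) ?(ltW lam0) ?(ltW L0).
have alD : n%:R * Lam < 2 * al * (lam * D).
  rewrite /al (_ : 2 * _ * _ = n%:R * Lam + 2 * lam * D); last by field; rewrite !gt_eqF.
  by rewrite ltrDl !mulr_gt0.
pose E x := expR (- (al * q x)); pose E0 := expR (- (al * r)).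
have cF : continuous (fun x => a x - b x - m * E x).
  move=> x; rewrite -/{for x, continuous (fun x => a x - b x - m * E x)}.
  apply: continuousB; first by apply: continuousB; [exact: ca|exact: cb].
  apply: continuousM; first exact: cst_continuous.
  have h : {for x, continuous (fun x => - (al * q x))}.
    by apply: continuousN; apply: continuousM; [exact: cst_continuous|exact: cq].
  exact: (continuous_comp h (@continuous_expR R _)).
have ne : [set x | q x <= r] !=set0.
  by exists c; rewrite /= /q subrr /dot big1 ?ltW// => i _; rewrite mxE mul0r.
have [|x0 x0K mn] := EVT_min_rV ne (@qball_compact c r) (f := fun x => a x - b x - m * E x).
  exact: continuous_subspaceT.
have x0r : q x0 <= r by move: x0K; rewrite inE.
(* A smaller minimum is impossible in the small ball, where [a - b >= m], on the sphere, where
   [a - b >= 0], and in between, where the barrier is a strict subsolution. *)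
have key : - (m * E0) <= a x0 - b x0 - m * E x0.
  rewrite leNgt; apply/negP => neg.
  have E00 : 0 < E0 by exact: expR_gt0.
  have qD : D < q x0.
    rewrite ltNge; apply/negP => /Dm h.
    have : E x0 <= 1 by rewrite -expR0 ler_expR oppr_le0 mulr_ge0// ltW.
    by move: neg h; nra.
  have qr : q x0 < r.
    rewrite lt_neqAle x0r andbT; apply/eqP => h.
    by have := ab _ x0r; move: neg; rewrite /E h /E0; lra.
  have [A [B [hA hB sA sB AB]]] := sup _ qr.
  have nr : \forall y \near x0, a x0 - b x0 - m * E x0 <= a y - b y - m * E y.
    have := near_lt (cq x0) qr.
    by apply: filterS => y yr; apply: mn; rewrite inE; exact: ltW.
  have [S [k [SS kb H]]] := pucci_min hA hB (hess_at_exp c x0 m al) sA sB nr.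
  have : \sum_i k i * qf ((m * E x0) *: ((4 * al ^+ 2) *: ((x0 - c)^T *m (x0 - c)) - (2 * al) *: 1%:M))
     (row i S) <= 0 by apply: le_trans H _; rewrite subr_le0.
  have -> : (m * E x0) *: ((4 * al ^+ 2) *: ((x0 - c)^T *m (x0 - c)) - (2 * al) *: 1%:M) =
      (m * E x0 * (4 * al ^+ 2)) *: ((x0 - c)^T *m (x0 - c) - (2 * al)^-1 *: 1%:M).
    rewrite [in RHS]scalerBr !scalerBr !scalerA; congr (_ - _ *: _).
    by field; rewrite gt_eqF.
  have P0 : 0 < m * E x0 * (4 * al ^+ 2).
    by apply: mulr_gt0; apply: mulr_gt0 => //; [exact: expR_gt0|exact: exprn_gt0].
  have be0 : 0 <= (2 * al)^-1 by rewrite invr_ge0 mulr_ge0// ltW.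
  have := sum_qf_outer_ge (x0 - c) (ltW P0) be0 SS kb.
  move=> h1 h2; have := le_trans h1 h2.
  rewrite pmulr_rle0// subr_le0 (mulrC _^-1) ler_pdivlMr ?mulr_gt0// leNgt => /negP; apply.
  by apply: lt_le_trans alD _; rewrite mulrC ler_pM2r ?mulr_gt0// ler_pM2l// ltW.
(* By [exp t >= 1 + t], the barrier exceeds its boundary value [E0] by at least
   [E0 al (r - |x - c|^2)]. *)
exists (m * E0 * al).
  by apply: mulr_gt0 => //; apply: mulr_gt0 => //; exact: expR_gt0.
move=> x xr; have h : - (m * E0) <= a x - b x - m * E x.
  by apply: le_trans key _; apply: mn; rewrite inE.
have : E0 * (1 + al * (r - q x)) <= E x.
  rewrite (_ : E x = E0 * expR (al * (r - q x))).
    by rewrite ler_pM2l ?expR_gt0// expR_ge1Dx.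
  by rewrite -expRD /E; congr expR; ring.
rewrite -(ler_pM2l m0) -/(q x); lra.
Qed.

End comparison.

(** * Moving planes *)


Lemma one_powR {R : realType} (a : R) : 1 `^ a = 1 :> R.
Proof. by rewrite powR1. Qed.

Section reflection.
Context {R : realType} {n : nat} (e : 'rV[R]_n).
Hypothesis e1 : dot e e = 1.
Implicit Types (x y xi c : 'rV[R]_n) (l : R).

Definition refl l x := x - (2 * (dot x e - l)) *: e.

Lemma refl_line l y xi (s : R) : refl l (y + s *: xi) = refl l y + s *: (xi *m reflmx e).
Proof.
rewrite /refl mul_reflmx dotDl dotZl scalerBr scalerA.
apply/rowP => i; rewrite !mxE; ring.
Qed.

Lemma refl_dot l x : dot (refl l x) (refl l x) = dot x x - 4 * l * (dot x e - l).
Proof. by rewrite /refl !dot_lin e1 (dotC e x); ring. Qed.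

Lemma refl_fix l x : dot x e = l -> refl l x = x.
Proof. by move=> h; rewrite /refl h subrr mulr0 scale0r subr0. Qed.

Lemma enorm_lt_sqr x (r : R) : 0 < r -> (enorm x < r) = (dot x x < r ^+ 2).
Proof. by move=> r0; rewrite -ltr_sqr ?nnegrE ?enorm_ge0 ?ltW// enorm_sqr. Qed.

Lemma enorm_le_sqr x (r : R) : 0 <= r -> (enorm x <= r) = (dot x x <= r ^+ 2).
Proof. by move=> r0; rewrite -ler_sqr ?nnegrE ?enorm_ge0// enorm_sqr. Qed.

Lemma refl_enorm_lt l x (r : R) : 0 < r -> 0 < l -> l < dot x e -> enorm x <= r ->
  enorm (refl l x) < r.
Proof.
move=> r0 l0 lx; rewrite (enorm_le_sqr _ (ltW r0)) (enorm_lt_sqr _ r0) refl_dot.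
by apply: lt_le_trans; rewrite gtrDl oppr_lt0 !mulr_gt0// subr_gt0.
Qed.

Lemma dot_le_enorm x : dot x e <= enorm x.
Proof.
apply: le_trans (ler_norm _) _; rewrite enormE -sqrtr_sqr ler_sqrt ?dot_ge0//.
have := dot_ge0 (x - dot x e *: e).
by rewrite !dot_lin e1 (dotC e x); nra.
Qed.

Lemma refl_continuous (T : topologicalType) (f : T -> R) (g : T -> 'rV[R]_n) (t : T) :
  {for t, continuous f} -> {for t, continuous g} ->
  {for t, continuous (fun s => refl (f s) (g s))}.
Proof.
move=> cf cg; apply: rV_continuous => i.
rewrite (_ : (fun _ => _) = (fun s => g s 0 i - (2 * (dot (g s) e - f s)) * e 0 i)); last first.
  by apply/funext => s; rewrite !mxE.
have ce : {for t, continuous (fun=> e)} by exact: cst_continuous.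
apply: continuousB; last first.
  apply: continuousM; last exact: cst_continuous.
  apply: continuousM; first exact: cst_continuous.
  by apply: continuousB => //; exact: (@dot_continuous R n T g (fun=> e)).
exact: (continuous_comp cg (@coord_continuous R 1 n 0 i _)).
Qed.

End reflection.

(** * Symmetry of positive solutions in a ball *)

Section ball_solutions.
Context {R : realType} {n : nat} (cp cm lam Lam rho : R).
Hypotheses (lam0 : 0 < lam) (lL : lam <= Lam) (rho0 : 0 < rho).
Hypothesis cpm : (cp = Lam /\ cm = lam) \/ (cp = lam /\ cm = Lam).
Implicit Types (x y xi c e : 'rV[R]_n) (u v : 'rV[R]_n -> R) (l p q : R).

(** Extension by 0 outside the ball makes [u] continuous and nonnegative on the whole space, so
    extrema on compact sets and compositions with reflections need no domain conditions. *)
Definition zball u := [/\ continuous u, C2_on (@eball R n rho) u,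
  forall x, enorm x < rho -> 0 < u x & forall x, rho <= enorm x -> u x = 0].

Definition pucci_eq u v p := forall x, enorm x < rho -> pucci cp cm (hessian u x) = - (v x `^ p).

Lemma pucci0 : pucci cp cm (0 : 'M[R]_n) = 0.
Proof.
have -> : (0 : 'M[R]_n) = (1%:M)^T *m diag_mx 0 *m 1%:M.
  by rewrite mulmx1 trmx1 mul1mx; apply/matrixP => i j; rewrite !mxE mul0rn.
rewrite pucci_diag ?trmx1 ?mulmx1// big1// => i _.
by rewrite mxE /pm ltxx mulr0.
Qed.

Lemma zball_ge0 u x : zball u -> 0 <= u x.
Proof. by move=> [_ _ up uz]; have [/up/ltW|/uz->] := ltP (enorm x) rho. Qed.

Lemma zball_bounded u : zball u -> exists2 V, 0 < V & forall x, u x <= V.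
Proof.
move=> hu; have [cu _ up uz] := hu.
have e0 : enorm (0 : 'rV[R]_n) < rho by rewrite enorm0.
have ne : @ecball R n rho !=set0 by exists 0; rewrite /ecball /= ltW.
have [|x0 x0K mx] := EVT_max_rV ne (@ecball_compact R n rho) (f := u).
  exact: continuous_subspaceT.
exists (u x0).
  by apply: lt_le_trans (up _ e0) _; apply: mx; rewrite inE /ecball /= ltW.
move=> x; have [xr|/ltW xr] := leP (enorm x) rho; first by apply: mx; rewrite inE.
by rewrite (uz _ xr) zball_ge0.
Qed.

Lemma hess_eball u x : zball u -> enorm x < rho ->
  hess_at u (hessian u x) x /\ (hessian u x)^T = hessian u x.
Proof.
move=> [_ uC _ _] xr; split.
  by apply: hess_at_C2 uC xr; exact: eball_open.
by apply: hessian_sym uC xr; exact: eball_open.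
Qed.

(** The Hopf lemma against the zero function, which gives at least linear growth away from the
    sphere. *)
Lemma zball_lower u v p : zball u -> pucci_eq u v p ->
  exists2 ep, 0 < ep & forall x, ep * (rho ^+ 2 - dot x x) <= u x.
Proof.
move=> hu uv; have [cu _ up uz] := hu.
have r2 : 0 < rho ^+ 2 by exact: exprn_gt0.
have e0 : enorm (0 : 'rV[R]_n) < rho by rewrite enorm0.
have c0 : continuous (fun _ : 'rV[R]_n => 0 : R) by move=> x; exact: cst_continuous.
have [x _|||ep ep0 H] := hopf lam0 lL cpm (a := u) (b := fun=> 0) (c := 0) r2 cu c0.
- exact: zball_ge0.
- exact: up.
- move=> x; rewrite subr0 -enorm_lt_sqr// => xr.
  have [hA sA] := hess_eball hu xr.
  have O0 : @hess_at R n (fun=> 0) 0 x.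
    move=> xi; exists (fun=> 0); split; first by near=> t; exact: is_derive_cst.
    rewrite (_ : qf 0 xi = 0); last by rewrite -(scale0r (0 : 'M[R]_n)) qfZ mul0r.
    exact: is_derive_cst.
  exists (hessian u x), 0; split=> //; first by rewrite trmx0.
  by rewrite (uv _ xr) pucci0 oppr_le0 powR_ge0.
exists ep => // x; have [xr|xr] := ltP (rho ^+ 2) (dot x x).
  by apply: le_trans (zball_ge0 x hu); rewrite pmulr_rle0// subr_le0 ltW.
by have := H x; rewrite !subr0; exact.
Unshelve. all: by end_near. Qed.

Section direction.
Variable e : 'rV[R]_n.
Hypothesis e1 : dot e e = 1.

Definition mono u l := forall x, enorm x < rho -> l < dot x e -> u x <= u (refl e l x).

Lemma hess_refl u v p l x : zball u -> pucci_eq u v p -> enorm (refl e l x) < rho ->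
  exists A, [/\ hess_at (u \o refl e l) A x, A^T = A & pucci cp cm A = - (v (refl e l x) `^ p)].
Proof.
move=> hu uv xr; have [hA sA] := hess_eball hu xr.
exists (reflmx e *m hessian u (refl e l x) *m (reflmx e)^T); split.
- by apply: hess_at_affine hA => y xi s; exact: refl_line.
- by rewrite !trmx_mul trmxK sA mulmxA.
- by rewrite (pucci_orth _ _ sA (reflmx_orth e1)) uv.
Qed.

Lemma refl_comp_continuous u l : continuous u -> continuous (u \o refl e l).
Proof.
move=> cu x; apply: (@continuous_comp _ _ _ (refl e l) u); last exact: cu.
by apply: (@refl_continuous R n e _ (fun=> l) id); [exact: cst_continuous|exact: cvg_id].
Qed.

(* Strong maximum principle: from an interior zero move in the direction [e] to the
   last zero, which lies in a ball centered at a point of positivity. *)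
Lemma mono_strict u v p l : zball u -> zball v -> pucci_eq u v p -> 0 <= p -> 0 < l ->
  mono u l -> mono v l ->
  forall x, enorm x <= rho -> l < dot x e -> u x < u (refl e l x).
Proof.
move=> hu hv uv p0 l0 mu mv x xr lx; have [cu _ up uz] := hu.
have [rx|{}xr] := leP rho (enorm x).
  by rewrite (uz _ rx); apply: up; exact: refl_enorm_lt lx xr.
rewrite ltNge; apply/negP => wx.
pose w y := u (refl e l y) - u y.
have cw : continuous w.
  move=> y; have cr := @refl_comp_continuous u l cu y.
  exact: (@continuousB R _ _ (u \o refl e l) u y cr (cu y)).
have xe0 := lt_trans l0 lx.
pose T := [set t : R | 0 <= t /\ (enorm (x + t *: e) < rho /\ w (x + t *: e) <= 0)].
have T0 : T 0 by rewrite /T /= scale0r addr0 lexx subr_le0.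
have Tb : ubound T rho.
  move=> t [t0 [/(le_lt_trans (dot_le_enorm e1 _)) h _]].
  by move: h; rewrite dotDl dotZl e1; lra.
have Ts : has_sup T by split; [exists 0|exists rho].
pose t1 := sup T; have t10 : 0 <= t1 by exact: ub_le_sup Ts.2 _ T0.
pose x1 := x + t1 *: e.
have lc := @line_continuous R n x e t1.
have cwl : {for t1, continuous (fun t : R => w (x + t *: e))}.
  exact: (continuous_comp lc (cw _)).
have cel : {for t1, continuous (fun t : R => enorm (x + t *: e))}.
  exact: (continuous_comp lc (@enorm_continuous R n _)).
have near_sup (f : R -> R) a : {for t1, continuous f} -> (forall t, T t -> f t <= a) -> f t1 <= a.
  move=> cf fa; rewrite leNgt; apply/negP => h.
  have /nbhs_eps[d d0 H] := near_gt cf h.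
  have [t Tt td] := sup_adherent d0 Ts.
  have tt1 : t <= t1 by exact: ub_le_sup Ts.2 _ Tt.
  have td' : `|t - t1| < d by rewrite ler0_norm ?subr_le0//; rewrite -/t1 in td; lra.
  by have := H t td'; rewrite ltNge fa.
have x1r : enorm x1 <= rho by apply: near_sup cel _ => t [_ [/ltW]].
have w1 : w x1 <= 0 by apply: near_sup cwl _ => t [_ []].
have lx1 : l < dot x1 e by rewrite dotDl dotZl e1; lra.
(* The last zero is not on the sphere: [u] vanishes there, while the reflected point is interior and
   [u] is positive at it. *)
have {}x1r : enorm x1 < rho.
  rewrite lt_neqAle x1r andbT; apply/eqP => h.
  move: w1; rewrite /w (uz x1) ?h// subr0; apply/negP; rewrite -ltNge; apply: up.
  by apply: refl_enorm_lt lx1 _; rewrite ?h.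
have /nbhs_eps[d d0 Hd] : \forall y \near x1, enorm y < rho /\ l < dot y e.
  have h1 := near_lt (@enorm_continuous R n x1) x1r.
  have cd : {for x1, continuous (fun y => dot y e)}.
    by apply: (@dot_continuous R n _ id (fun=> e)); [exact: cvg_id|exact: cst_continuous].
  have h2 := near_gt cd lx1.
  by apply: filterS2 h1 h2.
(* The center lies beyond the last zero by [r], so the difference is positive there, and [x1] is
   interior to the ball of radius [2 r]; the value [d / 4] keeps that ball within distance [d] of
   [x1]. *)
pose r := d / 4; have r0 : 0 < r by rewrite divr_gt0.
pose c := x1 + r *: e.
have ne1 : `|e| <= 1 by apply: le_trans (norm_le_enorm e) _; rewrite enormE e1 sqrtr1.
have ball y : dot (y - c) (y - c) <= (2 * r) ^+ 2 -> enorm y < rho /\ l < dot y e.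
  have r20 : 0 <= 2 * r by rewrite mulr_ge0// ltW.
  rewrite -(enorm_le_sqr _ r20) => yc; apply: Hd.
  rewrite (_ : y - x1 = (y - c) + r *: e); last by apply/rowP => i; rewrite !mxE; ring.
  apply: le_lt_trans (ler_normD _ _) _; rewrite normrZ (gtr0_norm r0).
  have := norm_le_enorm (y - c); have : r * `|e| <= r * 1 by rewrite ler_pM2l.
  by rewrite /r in yc *; lra.
have c_in : enorm c < rho /\ l < dot c e.
  by apply: ball; rewrite subrr /dot big1 ?sqr_ge0// => i _; rewrite mxE mul0r.
have wc : u c < u (refl e l c).
  rewrite -subr_gt0 ltNge; apply/negP => h.
  have : T (t1 + r) by split; [rewrite addr_ge0// ltW|rewrite scalerDl addrA; split; [case: c_in|exact: h]].
  by move=> /(ub_le_sup Ts.2); rewrite -/t1 gerDl leNgt r0.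
have R0 : 0 < (2 * r) ^+ 2 by rewrite exprn_gt0// mulr_gt0.
have [y yc||y /ltW yc|ep ep0 H] := hopf lam0 lL cpm R0 (@refl_comp_continuous u l cu) cu (c := c).
- by have [y1 y2] := ball y yc; exact: mu.
- exact: wc.
- have [y1 y2] := ball y yc.
  have y3 := refl_enorm_lt e1 rho0 l0 y2 (ltW y1).
  have [A [hA sA EA]] := hess_refl hu uv y3.
  have [hB sB] := hess_eball hu y1.
  exists A, (hessian u y); split=> //; rewrite EA uv// lerN2.
  by apply: (ge0_ler_powR p0); rewrite ?nnegrE; [exact: zball_ge0|exact: zball_ge0|exact: mv].
have := H x1; rewrite (_ : x1 - c = - (r *: e)); last by apply/rowP => i; rewrite !mxE; ring.
have -> : dot (- (r *: e)) (- (r *: e)) = r ^+ 2 by rewrite !dot_lin e1; ring.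
have rr : r ^+ 2 < (2 * r) ^+ 2 by have h := mulr_gt0 r0 r0; rewrite !expr2; lra.
move=> /(_ (ltW rr)) h.
have : 0 < w x1 by apply: lt_le_trans h; rewrite mulr_gt0// subr_gt0.
by rewrite ltNge w1.
Qed.


(** At such a minimum, with [t] the distance to the plane, ellipticity gives at least
    [lam m (1 + mu) mu t^(mu - 1)] for the difference of the operators. The equation expresses that
    difference through [v^p], and the mean value theorem bounds it by [2 m C t^(2 mu - 1)]. Dividing
    by [m t^(mu - 1)] leaves a positive power of [t]. *)
Lemma slab_point u v p l x (mu ka V C m : R) :
  zball u -> zball v -> pucci_eq u v p -> 0 < p ->
  0 < mu -> 2 * mu <= p -> 2 * mu <= 1 -> 0 < ka -> 0 < V -> 0 < m ->
  enorm x < rho -> 0 < l -> l < dot x e -> dot x e - l <= 1 ->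
  ka * (dot x e - l) <= v (refl e l x) -> v x <= V ->
  p * (V `^ (p - 1) + ka `^ (p - 1)) <= C ->
  v x - v (refl e l x) <= 2 * m ->
  (\forall y \near x, u (refl e l x) - u x - m * (dot x e - l) `^ (1 + mu) <=
     u (refl e l y) - u y - m * (dot y e - l) `^ (1 + mu)) ->
  lam * ((1 + mu) * mu) <= 2 * C * (dot x e - l) `^ mu.
Proof.
move=> hu hv uv p0 mu0 mup mu1 ka0 V0 m0 xr l0 lx t1 kv vV hC vm mn.
set t := dot x e - l in mn t1 kv *; set s := v (refl e l x) in kv vm *.
have t0 : 0 < t by rewrite subr_gt0.
have y3 := refl_enorm_lt e1 rho0 l0 lx (ltW xr).
have [A [hA sA EA]] := hess_refl hu uv y3.
have [hB sB] := hess_eball hu xr.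
have [S [c [SS cb H]]] := pucci_min lam0 lL cpm hA hB (hess_at_pow m mu t0) sA sB mn.
have k0 : 0 < m * ((1 + mu) * mu * t `^ (mu - 1)).
  by rewrite !mulr_gt0 ?powR_gt0// addr_gt0.
have H2 := sum_qf_outer_ge e (ltW k0) (lexx 0) SS cb.
rewrite scale0r subr0 mul0r subr0 e1 mulr1 in H2.
have {H H2} := le_trans H2 H; rewrite EA uv// -/s opprK (addrC (- _)) => H.
have s0 : 0 < s by apply: lt_le_trans kv; exact: mulr_gt0.
have sv : s < v x.
  rewrite ltNge; apply/negP => vs.
  have h : v x `^ p <= s `^ p.
    by apply: (ge0_ler_powR (ltW p0)); rewrite ?nnegrE ?(ltW s0) ?zball_ge0.
  have : 0 < v x `^ p - s `^ p by apply: lt_le_trans H; rewrite mulr_gt0.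
  by rewrite subr_gt0 ltNge h.
have [z /andP[z1 z2] E] := @MVT_le R (fun r => r `^ p) (fun r => p * r `^ (p - 1)) s (v x) (ltW sv)
  (fun r hr => is_derive1_powR p (lt_le_trans s0 (elimT andP hr).1)).
rewrite E in H.
have z0 := lt_le_trans s0 z1.
have T0 a : 0 < t `^ a by exact: powR_gt0.
(* For [p >= 1] the intermediate point [z] is at most [V]; for [p < 1] it is at least [ka t]. Since
   [t <= 1] and [2 mu <= min p 1], the factor [t^(2 mu - 1)] covers both cases. *)
have zb : z `^ (p - 1) <= (V `^ (p - 1) + ka `^ (p - 1)) * t `^ (2 * mu - 1).
  have tinv (a : R) : 0 <= a -> 1 <= t `^ (- a).
    move=> a0; rewrite powRN invf_ge1 ?T0//.
    by rewrite -[leRHS](one_powR a); apply: (ge0_ler_powR a0); rewrite ?nnegrE ?ler01 ?(ltW t0).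
  have [p1|p1] := leP 1 p.
    have h1 : z `^ (p - 1) <= V `^ (p - 1).
      apply: ge0_ler_powR; rewrite ?nnegrE ?subr_ge0 ?(ltW z0) ?(ltW V0)//.
      exact: le_trans vV.
    have h2 : 1 <= t `^ (2 * mu - 1) by rewrite -(opprB 1); apply: tinv; lra.
    have h3 : 0 < ka `^ (p - 1) by exact: powR_gt0.
    have h4 : 0 < V `^ (p - 1) by exact: powR_gt0.
    by nra.
  have h1 : z `^ (p - 1) <= (ka * t) `^ (p - 1).
    rewrite -(opprB 1) !powRN lef_pV2 ?posrE ?powR_gt0 ?mulr_gt0//.
    apply: ge0_ler_powR; rewrite ?nnegrE ?subr_ge0 ?(ltW z0) ?(ltW p1) ?mulr_ge0 ?(ltW ka0) ?(ltW t0)//.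
    exact: le_trans z1.
  rewrite (powRM _ (ltW ka0) (ltW t0)) in h1.
  have h2 : t `^ (p - 1) <= t `^ (2 * mu - 1).
    rewrite (_ : 2 * mu - 1 = (p - 1) + - (p - 2 * mu)); last by ring.
    by rewrite [leRHS]powRD ?(gt_eqF t0) ?implybT// ler_peMr ?(ltW (T0 _))//; apply: tinv; lra.
  have h3 : 0 < ka `^ (p - 1) by exact: powR_gt0.
  have h4 : 0 < V `^ (p - 1) by exact: powR_gt0.
  have h5 := T0 (2 * mu - 1).
  have h6 : ka `^ (p - 1) * t `^ (p - 1) <= ka `^ (p - 1) * t `^ (2 * mu - 1) by rewrite ler_pM2l.
  have h7 : 0 < V `^ (p - 1) * t `^ (2 * mu - 1) by exact: mulr_gt0.
  by rewrite mulrDl; lra.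
have tE : t `^ (2 * mu - 1) = t `^ (mu - 1) * t `^ mu.
  by rewrite -powRD ?(gt_eqF t0) ?implybT//; congr (_ `^ _); ring.
have F : p * z `^ (p - 1) * (v x - s) <= C * t `^ (2 * mu - 1) * (2 * m).
  have q1 : p * z `^ (p - 1) <= C * t `^ (2 * mu - 1).
    have h : p * z `^ (p - 1) <= p * ((V `^ (p - 1) + ka `^ (p - 1)) * t `^ (2 * mu - 1)).
      by rewrite ler_pM2l.
    by apply: le_trans h _; rewrite mulrA ler_pM2r.
  apply: ler_pM => //; last by rewrite subr_ge0 ltW.
  by rewrite mulr_ge0 ?powR_ge0// ltW.
have {}H := le_trans H F; rewrite tE in H.
have G0 : 0 < m * t `^ (mu - 1) by exact: mulr_gt0.
rewrite -(ler_pM2l G0).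
by apply: le_trans (le_trans _ H) _; rewrite le_eqVlt; apply/orP; left; apply/eqP; ring.
Qed.


Lemma barrier_shift (a b c d m s t : R) :
  a - b = m * (2 - s) -> c - d <= m * (2 - t) -> b - a - m * s <= d - c - m * t.
Proof. by lra. Qed.

(* Narrow domains: [2 - t^(1 + mu)] is a supersolution with second derivative of
   order [t^(mu - 1)], which beats the [t^(2 mu - 1)] bounding the difference
   quotient of the power; the latter is singular at [t = 0] when the exponent is
   less than 1, but [v] stays above a multiple of [t] by the Hopf lemma. *)
Lemma slab u v p q l0 : zball u -> zball v -> pucci_eq u v p -> pucci_eq v u q ->
  0 < p -> 0 < q -> 0 < l0 ->
  exists2 d : R, 0 < d & forall l, l0 <= l ->
    (forall x, enorm x < rho -> l + d <= dot x e ->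
      u x <= u (refl e l x) /\ v x <= v (refl e l x)) -> mono u l /\ mono v l.
Proof.
move=> hu hv uv vu p0 q0 l00.
(* Half of the minimum, so that [t^(2 mu - 1)] dominates [t^(p - 1)], [t^(q - 1)] and 1 for
   [t <= 1], and still a factor [t^mu] is gained over the barrier. *)
pose mu := Num.min (Num.min p q) 1 / 2.
have mu0 : 0 < mu by rewrite divr_gt0// !lt_min p0 q0 ltr01.
have mu2 : 2 * mu = Num.min (Num.min p q) 1 by rewrite /mu mulrC divfK.
have mup : 2 * mu <= p by rewrite mu2 !ge_min lexx.
have muq : 2 * mu <= q by rewrite mu2 !ge_min lexx !orbT.
have mu1 : 2 * mu <= 1 by rewrite mu2 !ge_min lexx !orbT.
clearbody mu.
have [eu eu0 Hu] := zball_lower hu uv.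
have [ev ev0 Hv] := zball_lower hv vu.
(* Reflection increases [rho^2 - |x|^2] by [4 l t], so the Hopf bounds dominate [ka t] at the
   reflected point for every [l >= l0]. *)
pose ka := 4 * l0 * Num.min eu ev.
have ka0 : 0 < ka by rewrite !mulr_gt0// lt_min eu0 ev0.
have [Vu Vu0 bu] := zball_bounded hu; have [Vv Vv0 bv] := zball_bounded hv.
pose V := Num.max Vu Vv; have V0 : 0 < V by rewrite lt_max Vu0.
pose Cp a : R := a * (V `^ (a - 1) + ka `^ (a - 1)).
have Cp0 a : 0 < a -> 0 < Cp a.
  by move=> a0; rewrite mulr_gt0// addr_gt0// powR_gt0.
pose C := Cp p + Cp q.
have C0 : 0 < C by rewrite addr_gt0 ?Cp0.
have CpC : Cp p <= C by rewrite lerDl ltW ?Cp0.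
have CqC : Cp q <= C by rewrite lerDr ltW ?Cp0.
have M0 : 0 < lam * ((1 + mu) * mu) by rewrite !mulr_gt0// addr_gt0.
(* For [t^mu <= K0] the right-hand side of [slab_point] is at most half of its left-hand side. *)
pose K0 := lam * ((1 + mu) * mu) / (4 * C).
have K00 : 0 < K0 by rewrite divr_gt0// mulr_gt0.
pose d := Num.min 1 (K0 `^ mu^-1).
have d0 : 0 < d by rewrite lt_min ltr01 powR_gt0.
have d1 : d <= 1 by rewrite ge_min lexx.
have td t : 0 < t <= d -> 2 * C * t `^ mu < lam * ((1 + mu) * mu).
  move=> /andP[t0 tld]; have h : t `^ mu <= K0.
    apply: (@le_trans _ _ (K0 `^ mu^-1 `^ mu)).
      apply: ge0_ler_powR; rewrite ?nnegrE ?powR_ge0 ?(ltW mu0) ?(ltW t0)//.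
      by apply: le_trans tld _; rewrite ge_min lexx orbT.
    by rewrite -powRrM mulVf ?gt_eqF// powRr1// ltW.
  have h2 : 2 * C * t `^ mu <= 2 * C * K0 by rewrite ler_pM2l// mulr_gt0.
  apply: le_lt_trans h2 _; rewrite /K0 (_ : 2 * C * _ = lam * ((1 + mu) * mu) / 2); last first.
    by field; rewrite gt_eqF.
  by rewrite ltr_pdivrMr// ltr_pMr// ltr1n.
exists d => // l l0l H.
have lp := lt_le_trans l00 l0l.
have lower w ew x : 0 < ew -> Num.min eu ev <= ew ->
    (forall x, ew * (rho ^+ 2 - dot x x) <= w x) -> enorm x < rho -> l < dot x e ->
    ka * (dot x e - l) <= w (refl e l x).
  move=> ew0 ewm hw xr lx; apply: le_trans (hw _).
  have t0 : 0 < dot x e - l by rewrite subr_gt0.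
  move: xr; rewrite refl_dot// enorm_lt_sqr// => xr.
  apply: (@le_trans _ _ (ew * (4 * l * (dot x e - l)))); last by rewrite ler_pM2l//; lra.
  rewrite /ka -!mulrA [leRHS]mulrCA ler_pM2l// mulrA [leRHS]mulrCA [leRHS]mulrA ler_pM2r//.
  by apply: ler_pM => //; [exact: ltW|rewrite le_min !ltW].
pose K := @ecball R n rho `&` ([set x | - dot x e <= - l] `&` [set x | dot x e <= l + d]).
have cdot : continuous (fun x : 'rV[R]_n => dot x e).
  by move=> x; apply: (@dot_continuous R n _ id (fun=> e)); [exact: cvg_id|exact: cst_continuous].
have cK : compact K.
  apply: compact_closedI; first exact: ecball_compact.
  apply: closedI; apply: closed_enorm_le => //.
  by move=> x; apply: (@continuousN R R^o _ (fun x => dot x e)); exact: cdot.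
have KE x : K x <-> enorm x <= rho /\ l <= dot x e <= l + d.
  rewrite /K /ecball /= lerN2; split; first by move=> [-> [-> ->]].
  by move=> [-> /andP[-> ->]].
(* On the slab [t] lies in [[0, 1]], so [g] lies in [[1, 2]] and can be divided by; the truncated
   power makes continuity immediate. *)
pose g x := 2 - pospow (1 + mu) (dot x e - l).
have mu10 : 0 < 1 + mu by rewrite addr_gt0.
have gb x : K x -> 1 <= g x <= 2.
  move=> /KE[_ /andP[h1 h2]]; rewrite /g pospowE ?subr_ge0//.
  have := powR_ge0 (dot x e - l) (1 + mu).
  have : (dot x e - l) `^ (1 + mu) <= 1.
    rewrite -[leRHS](one_powR (1 + mu)); apply: ge0_ler_powR; rewrite ?nnegrE ?(ltW mu10) ?subr_ge0//.
    by lra.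
  by move=> ? ?; apply/andP; split; lra.
pose D (w : 'rV[R]_n -> R) x := w x - w (refl e l x).
have cD w : continuous w -> continuous (D w).
  by move=> cw x; exact: (@continuousB R R^o _ w (w \o refl e l) x (cw x) (@refl_comp_continuous w l cw x)).
(* One maximum for both components handles the coupling: at a maximizer the larger difference
   touches [m g] from below, and the other one, which drives its equation, is at most
   [m g <= 2 m]. *)
pose F x := Num.max (D u x) (D v x) / g x.
have cu : continuous u by case: hu.
have cv : continuous v by case: hv.
suff main x : enorm x < rho -> l < dot x e -> D u x <= 0 /\ D v x <= 0.
  by split=> x xr lx; have [] := main x xr lx; rewrite /D !subr_le0.
move=> xr lx; have [ld|dl] := leP (l + d) (dot x e).
  by rewrite /D !subr_le0; exact: H.
have Kx : K x by apply/KE; rewrite !ltW.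
have cF : {within K, continuous F}.
  apply: continuous_in_subspaceT => y; rewrite inE => Ky.
  have /andP[g1 _] := gb y Ky.
  apply: (@continuousM R _ (fun y => Num.max (D u y) (D v y)) (fun y => (g y)^-1) y).
    exact: (@continuous_max R _ (D u) (D v) y (cD u cu y) (cD v cv y)).
  apply: continuousV; first by rewrite gt_eqF// (lt_le_trans ltr01).
  apply: continuousB; first exact: cst_continuous.
  have h : {for y, continuous (fun y => dot y e - l)}.
    by apply: continuousB; [exact: cdot|exact: cst_continuous].
  have hp := @pospow_continuous R _ mu10 (dot y e - l).
  have hc := continuous_comp h hp.
  exact: hc.
have ne : K !=set0 by exists x.
have [x0 x0K mx] := EVT_max_rV ne cK cF.
rewrite inE in x0K.
have [F0|F0] := leP (F x0) 0.
  have : F x <= 0 by apply: le_trans F0; apply: mx; rewrite inE.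
  have /andP[g1 _] := gb x Kx; have gx0 := lt_le_trans ltr01 g1.
  by rewrite /F ler_pdivrMr// mul0r ge_max => /andP[].
exfalso; pose m := F x0.
have dom y : K y -> D u y <= m * g y /\ D v y <= m * g y.
  move=> Ky; have /andP[g1 _] := gb y Ky; have gy0 := lt_le_trans ltr01 g1.
  have : F y <= m by apply: mx; rewrite inE.
  by rewrite /F ler_pdivrMr// ge_max => /andP[].
have /KE[x0r /andP[lx0 x0d]] := x0K.
have /andP[g1 g2] := gb x0 x0K; have gx0 := lt_le_trans ltr01 g1.
have eqm : Num.max (D u x0) (D v x0) = m * g x0 by rewrite /m /F divfK// gt_eqF.
have mg0 : 0 < m * g x0 by exact: mulr_gt0.
(* A positive maximum is not on the plane, where the difference is 0, nor on the sphere, where [w]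
   is 0 and its reflection nonnegative, nor on the outer face, by the assumption beyond [l + d];
   inside, [slab_point] contradicts [td]. *)
have side w z a ez : zball w -> zball z -> pucci_eq w z a -> 0 < a -> 2 * mu <= a -> Cp a <= C ->
    0 < ez -> Num.min eu ev <= ez -> (forall x, ez * (rho ^+ 2 - dot x x) <= z x) ->
    (forall x, z x <= V) ->
    (forall y, K y -> D w y <= m * g y) -> D z x0 <= m * g x0 -> D w x0 = m * g x0 ->
    (forall x, enorm x < rho -> l + d <= dot x e -> w x <= w (refl e l x)) -> False.
  move=> hw hz wz a0 mua Ca ez0 ezm zl zV Dw Dz Dw0 Hw.
  have [cw _ wp wz0] := hw.
  have lx0' : l < dot x0 e.
    rewrite lt_neqAle lx0 andbT; apply/eqP => h.
    by move: mg0; rewrite -Dw0 /D refl_fix// subrr ltxx.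
  have x0r' : enorm x0 < rho.
    rewrite ltNge; apply/negP => h.
    by move: mg0; rewrite -Dw0 /D (wz0 _ h) sub0r oppr_gt0 ltNge zball_ge0.
  have x0d' : dot x0 e < l + d.
    rewrite ltNge; apply/negP => h.
    by move: mg0; rewrite -Dw0 /D subr_gt0 ltNge Hw.
  have tx0 : 0 < dot x0 e - l <= d.
    by rewrite subr_gt0 lx0' lerBlDl ltW.
  have := td _ tx0; rewrite ltNge => /negP; apply.
  apply: (slab_point hw hz wz a0 mu0 mua mu1 ka0 V0 F0 x0r' lp lx0' _ _ (zV x0) Ca).
  - by move: tx0 => /andP[_ h]; exact: le_trans h d1.
  - exact: (lower z ez).
  - by apply: le_trans Dz _; rewrite mulrC ler_pM2r.
  have n1 := near_lt (@enorm_continuous R n x0) x0r'.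
  have n2 := near_gt (cdot x0) lx0'.
  have n3 := near_lt (cdot x0) x0d'.
  apply: filterS3 n1 n2 n3 => y y1 y2 y3.
  have Ky : K y by apply/KE; rewrite !ltW.
  have := Dw y Ky; move: Dw0; rewrite /D /g !pospowE ?subr_ge0 ?(ltW lx0') ?(ltW y2)// -/m.
  exact: barrier_shift.
have [d1' d2'] := dom x0 x0K.
have uV y : u y <= V by rewrite le_max bu.
have vV y : v y <= V by rewrite le_max bv orbT.
have euv : Num.min eu ev <= eu by rewrite ge_min lexx.
have evu : Num.min eu ev <= ev by rewrite ge_min lexx orbT.
move: eqm; have [uv0|vu0] := leP (D u x0) (D v x0) => E.
- apply: (side v u q eu hv hu vu q0 muq CqC eu0 euv Hu uV _ d1' E) => y.
    by move=> /dom[].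
  by move=> yr yd; have [] := H y yr yd.
- apply: (side u v p ev hu hv uv p0 mup CpC ev0 evu Hv vV _ d2' E) => y.
    by move=> /dom[].
  by move=> yr yd; have [] := H y yr yd.
Qed.


Lemma mono_limit u l : zball u -> 0 <= l ->
  (forall h : R, 0 < h -> exists2 l', l < l' < l + h & mono u l') -> mono u l.
Proof.
move=> hu l0 H x xr lx; have [cu _ _ _] := hu.
rewrite leNgt; apply/negP => h.
have cr : {for l, continuous (fun l' => u (refl e l' x))}.
  have c1 : {for l, continuous (fun l' => refl e l' x)}.
    by apply: (@refl_continuous R n e _ id (fun=> x)); [exact: cvg_id|exact: cst_continuous].
  exact: (@continuous_comp _ _ _ (fun l' => refl e l' x) u l c1 (cu _)).
have /nbhs_eps[d d0 Hd] := near_lt cr h.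
pose k := Num.min d (dot x e - l).
have k0 : 0 < k by rewrite lt_min d0 subr_gt0.
have [l' /andP[l1 l2] ml] := H k k0.
have : `|l' - l| < d.
  rewrite gtr0_norm ?subr_gt0// ltrBlDl; apply: lt_le_trans l2 _.
  by rewrite lerD2l ge_min lexx.
move=> /Hd; rewrite ltNge ml//.
apply: lt_le_trans l2 _; rewrite -lerBrDl ge_min lexx orbT//.
Qed.

(** Continuous induction on [rho - l], starting from planes that miss the open ball. Strict
    inequalities on a compact part of the cap survive a small displacement of the plane, and [slab]
    fills the narrow strip that remains; closedness is a limit. *)
Lemma moving_plane u v p q l : zball u -> zball v -> pucci_eq u v p -> pucci_eq v u q ->
  0 < p -> 0 < q -> 0 < l -> mono u l /\ mono v l.
Proof.
move=> hu hv uv vu p0 q0; have [cu _ _ _] := hu; have [cv _ _ _] := hv.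
have triv l' : rho <= l' -> mono u l' /\ mono v l'.
  move=> rl; split=> x xr lx; have := lt_trans (lt_le_trans xr rl) lx;
  by rewrite ltNge dot_le_enorm.
suff P r : 0 <= r <= rho - l -> 0 < l -> mono u (rho - r) /\ mono v (rho - r).
  move=> l0; have [rl|/ltW lr] := leP rho l; first exact: triv.
  by have := P (rho - l); rewrite lexx subr_ge0 lr (_ : rho - (rho - l) = l); [apply|ring].
move=> hr l0; have [d d0 Hd] := slab hu hv uv vu p0 q0 l0.
pose Q r := mono u (rho - r) /\ mono v (rho - r).
apply: (@real_ind R Q (rho - l)) hr; rewrite /Q; first by apply: triv; rewrite subr0.
  move=> {}r /andP[r0 rl] H; have [mu mv] := H r (introT andP (conj r0 (lexx r))).
  set k := rho - r in mu mv *.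
  have lk : l < k by rewrite /k; lra.
  have k0 := lt_trans l0 lk.
  (* The part of the cap at distance at least [d / 2] from the plane, sphere included, where
     [mono_strict] gives strict inequalities. Moving the plane by less than [d / 2] leaves only a
     strip of width [d] outside it. *)
  pose K := @ecball R n rho `&` [set x | - dot x e <= - (k + d / 2)].
  have cK : compact K.
    apply: compact_closedI; first exact: ecball_compact.
    apply: closed_enorm_le => x; apply: (@continuousN R R^o _ (fun x => dot x e)).
    by apply: (@dot_continuous R n _ id (fun=> e)); [exact: cvg_id|exact: cst_continuous].
  have kd : k < k + d / 2 by rewrite ltrDl divr_gt0.
  have near_strict w z a : zball w -> zball z -> pucci_eq w z a -> 0 < a -> mono w k -> mono z k ->
      \forall l' \near k, K `<=` (fun x => w x < w (refl e l' x)).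
    move=> hw hz wz a0 mw mz; have [cw _ _ _] := hw.
    apply: (proj1 (compact_near_coveringP K) cK _ (nbhs k) (fun l' x => w x < w (refl e l' x))).
    move=> x [xr /=]; rewrite lerN2 => xk.
    have wx := mono_strict hw hz wz (ltW a0) k0 mw mz xr (lt_le_trans kd xk).
    have c2 : {for (x, k), continuous (fun yl : 'rV[R]_n * R => yl.2)} by exact: cvg_snd.
    have c1 : {for (x, k), continuous (fun yl : 'rV[R]_n * R => yl.1)} by exact: cvg_fst.
    have c3 := @refl_continuous R n e _ (fun yl : 'rV[R]_n * R => yl.2) (fun yl => yl.1) (x, k) c2 c1.
    have c4 : {for (x, k), continuous (fun yl : 'rV[R]_n * R => w (refl e yl.2 yl.1))}.
      exact: (@continuous_comp _ _ _ (fun yl : 'rV[R]_n * R => refl e yl.2 yl.1) w _ c3 (cw _)).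
    have c5 : {for (x, k), continuous (fun yl : 'rV[R]_n * R => w yl.1)}.
      exact: (@continuous_comp _ _ _ (fun yl : 'rV[R]_n * R => yl.1) w _ c1 (cw _)).
    have c6 : {for (x, k), continuous (fun yl : 'rV[R]_n * R => w (refl e yl.2 yl.1) - w yl.1)}.
      exact: continuousB.
    have w0 : 0 < w (refl e k x) - w x by rewrite subr_gt0.
    have := near_gt c6 w0; apply: filterS => -[y l'] /=.
    by rewrite subr_gt0.
  have /nbhs_eps[d1 d10 H1] := near_strict _ _ _ hu hv uv p0 mu mv.
  have /nbhs_eps[d2 d20 H2] := near_strict _ _ _ hv hu vu q0 mv mu.
  pose s := Num.min (Num.min d1 d2) (Num.min (d / 2) (k - l)).
  exists s; first by rewrite !lt_min d10 d20 divr_gt0// subr_gt0.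
  move=> t /andP[rt ts].
  have [td1 td2 tdd tkl] : [/\ t - r < d1, t - r < d2, t - r < d / 2 & t - r < k - l].
    have : t - r < s by rewrite ltrBlDl.
    by rewrite !lt_min => /andP[/andP[-> ->] /andP[-> ->]].
  have kE : rho - t = k - (t - r) by rewrite /k; ring.
  have tk : `|rho - t - k| = t - r.
    by rewrite kE addrAC subrr add0r normrN gtr0_norm// subr_gt0.
  apply: Hd; first by rewrite kE; lra.
  move=> x xr xd; have Kx : K x.
    by split; [exact: ltW|rewrite /= lerN2; apply: le_trans xd; rewrite kE; lra].
  split; apply: ltW.
    by apply: H1 Kx; rewrite tk.
  by apply: H2 Kx; rewrite tk.
move=> {}r /andP[r0 rl] H.
have k0 : 0 <= rho - r by lra.
have near_r (h : R) : 0 < h -> exists2 l', rho - r < l' < rho - r + h & mono u l' /\ mono v l'.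
  move=> h0; pose k := Num.min h r / 2.
  have k0' : 0 < k by rewrite divr_gt0// lt_min h0 r0.
  have m0 : 0 < Num.min h r by rewrite lt_min h0 r0.
  have kh : k < h.
    by apply: (@lt_le_trans _ _ (Num.min h r)); [rewrite /k; lra|rewrite ge_min lexx].
  have kr : k < r.
    by apply: (@lt_le_trans _ _ (Num.min h r)); [rewrite /k; lra|rewrite ge_min lexx orbT].
  exists (rho - (r - k)); first by apply/andP; split; lra.
  by apply: H; apply/andP; split; lra.
by split; apply: mono_limit => // h /near_r[l' hl' []]; exists l'.
Qed.

Lemma mono0 u v p q : zball u -> zball v -> pucci_eq u v p -> pucci_eq v u q ->
  0 < p -> 0 < q -> mono u 0.
Proof.
move=> hu hv uv vu p0 q0; apply: mono_limit => // h h0; exists (h / 2).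
  by rewrite add0r divr_gt0//= ltr_pdivrMr// ltr_pMr// ltr1n.
by have [] := moving_plane hu hv uv vu p0 q0 (divr_gt0 h0 (ltr0n _ 2)).
Qed.

End direction.

(** Two points of equal norm are mirror images in a hyperplane through the origin, so the limit
    position [l = 0] for the unit vector along [x - y] compares them; exchanging them gives
    equality. *)
Lemma ball_radial u v p q : zball u -> zball v -> pucci_eq u v p -> pucci_eq v u q ->
  0 < p -> 0 < q -> radial u.
Proof.
move=> hu hv uv vu p0 q0.
have [_ _ _ uz] := hu.
suff H x y : enorm x = enorm y -> enorm x < rho -> u x <= u y.
  move=> x y xy; have [xr|xr] := ltP (enorm x) rho; last by rewrite !uz// -xy.
  by apply: le_anti; rewrite !H// -xy.
move=> xy xr; have [->//|ne] := eqVneq x y.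
have d0 : 0 < enorm (x - y) by apply: enorm_gt0; rewrite subr_eq0.
pose e := (enorm (x - y))^-1 *: (x - y).
have dd : dot x x = dot y y by rewrite -!enorm_sqr xy.
have e1 : dot e e = 1.
  by rewrite /e dotZl dotZr -enorm_sqr; field; rewrite gt_eqF.
have xe : dot x e = enorm (x - y) / 2.
  rewrite /e dotZr (_ : dot x (x - y) = enorm (x - y) ^+ 2 / 2).
    by field; rewrite gt_eqF.
  by rewrite enorm_sqr !dot_lin (dotC y x) -dd; field.
have := mono0 e1 hu hv uv vu p0 q0 xr.
rewrite xe divr_gt0// => /(_ isT).
rewrite (_ : refl e 0 x = y)// /refl subr0 xe mulrC divfK// /e scalerA mulfV ?gt_eqF//.
by rewrite scale1r opprB addrC subrK.
Qed.

End ball_solutions.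

(** * Scaling and conclusion *)


Lemma near_continuous {R : realType} (T : topologicalType) (f g : T -> R) (x : T) :
  (\forall y \near x, f y = g y) -> {for x, continuous f} -> {for x, continuous g}.
Proof.
move=> H cf; have fx := nbhs_singleton H; rewrite /= in fx.
apply/cvgrPdist_lt => e e0; move/cvgrPdist_lt: cf => /(_ e e0).
by apply: filterS2 H => y fy; rewrite -fy -fx.
Qed.

Lemma continuous_at_near {R : realType} (T : topologicalType) (f : T -> R) (x : T) :
  (forall e : R, 0 < e -> \forall y \near x, `|f x - f y| < e) -> {for x, continuous f}.
Proof. by move=> H; apply/cvgrPdist_lt. Qed.

Section local_and_scaling.
Context {R : realType} {n : nat}.
Implicit Types (x y xi : 'rV[R]_n) (u v w : 'rV[R]_n -> R) (U : set 'rV[R]_n).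

Lemma C1_on_eq U u w : open U -> (forall x, U x -> u x = w x) -> C1_on U u -> C1_on U w.
Proof.
move=> oU uw Cu x Ux; have [cu du] := Cu x Ux.
have H : \forall y \near x, u y = w y.
  by have := open_nbhs_nbhs (conj oU Ux); apply: filterS => y /uw.
split; first exact: near_continuous H cu.
move=> i; have [d1 d2] := du i; split; first exact: (near_eq_derivable H d1).
exact: near_continuous (partial_near i H) d2.
Qed.

Lemma partial_eq_on U u w i : open U -> (forall x, U x -> u x = w x) ->
  forall x, U x -> partial i u x = partial i w x.
Proof.
move=> oU uw x Ux; have H : \near x, u x = w x.
  by have := open_nbhs_nbhs (conj oU Ux); apply: filterS => y /uw.
exact: (nbhs_singleton (partial_near i H)).
Qed.

Lemma C2_on_eq U u w : open U -> (forall x, U x -> u x = w x) -> C2_on U u -> C2_on U w.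
Proof.
move=> oU uw [Cu Cuu]; split; first exact: C1_on_eq Cu.
by move=> i; apply: C1_on_eq (Cuu i) => // x Ux; exact: partial_eq_on Ux.
Qed.

Lemma hessian_eq_on U u w x : open U -> (forall x, U x -> u x = w x) -> U x ->
  hessian u x = hessian w x.
Proof.
move=> oU uw Ux; apply/matrixP => i j; rewrite [LHS]mxE [RHS]mxE.
exact: (@partial_eq_on U (partial i u) (partial i w) j oU
  (fun y Uy => @partial_eq_on U u w i oU uw y Uy) x Ux).
Qed.

Lemma scale_continuous (c : R) x : {for x, continuous (fun x => c *: x)}.
Proof.
apply: rV_continuous => i.
rewrite (_ : (fun _ => _) = (fun y : 'rV[R]_n => c * y 0 i)); last by apply/funext => y; rewrite mxE.
by apply: continuousM; [exact: cst_continuous|exact: coord_continuous].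
Qed.

Lemma dilate_continuous (c : R) u x :
  {for c *: x, continuous u} -> {for x, continuous (fun y => u (c *: y))}.
Proof.
by move=> cu; exact: (@continuous_comp _ _ _ (fun y => c *: y) u x (@scale_continuous c x) cu).
Qed.

Lemma dilate_derive (a c : R) u x xi d : is_derive (c *: x) xi u d ->
  is_derive x xi (fun y => a * u (c *: y)) (a * c * d).
Proof.
move=> H; rewrite -[x]addr0 -(scale0r xi); apply/is_derive_line.
have h : is_derive (0 : R) 1 (fun s : R => u (c *: x + s *: xi)) d.
  by apply: line_derive; rewrite scale0r addr0.
have lc : is_derive (0 : R) 1 (fun s : R => c * s) c by exact: lin_derive.
rewrite -[X in is_derive X](mulr0 c) in h.
have := is_deriveZ a (@is_derive1_comp R (fun s : R => u (c *: x + s *: xi)) (fun s => c * s) 0 _ _ h lc).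
rewrite (_ : a \*: _ = fun s : R => a * u (c *: (x + s *: xi))); last first.
  by apply/funext => s; rewrite scalerDr scalerA.
by move=> H'; apply: (is_derive_eq H'); rewrite /GRing.scale /=; ring.
Qed.

Lemma partial_dilate (a c : R) U u i x : C1_on U u -> U (c *: x) ->
  partial i (fun y => a * u (c *: y)) x = a * c * partial i u (c *: x).
Proof. by move=> Cu Ux; apply: partial_eq; apply: dilate_derive; exact: C1_on_derive Cu Ux. Qed.

Lemma C1_dilate (a c : R) U u : open U -> C1_on U u ->
  C1_on ((fun x => c *: x) @^-1` U) (fun y => a * u (c *: y)).
Proof.
move=> oU Cu x Ux; have [cu du] := Cu _ Ux.
split; first by apply: continuousM; [exact: cst_continuous|exact: dilate_continuous].
move=> i; have [d1 d2] := du i; split.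
  by have [] := dilate_derive a (C1_on_derive i Cu Ux).
have H : \forall y \near x, a * c * partial i u (c *: y) = partial i (fun y => a * u (c *: y)) y.
  have Hn : nbhs x ((fun y => c *: y) @^-1` U).
    exact: (@scale_continuous c x _ (open_nbhs_nbhs (conj oU Ux))).
  by apply: filterS Hn => y Uy; rewrite (partial_dilate a i Cu Uy).
apply: (near_continuous H).
by apply: (@continuousM R _ (fun=> a * c) (fun y => partial i u (c *: y)) x); [exact: cst_continuous|exact: dilate_continuous].
Qed.

Lemma preimage_scale_open (c : R) U : open U -> open ((fun x => c *: x) @^-1` U).
Proof. by move=> oU; apply: open_comp => // x _; exact: scale_continuous. Qed.

Lemma C2_dilate (a c : R) U u : open U -> C2_on U u ->
  C2_on ((fun x => c *: x) @^-1` U) (fun y => a * u (c *: y)).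
Proof.
move=> oU [Cu Cuu]; split; first exact: C1_dilate.
move=> i; apply: C1_on_eq (C1_dilate (a * c) oU (Cuu i)); first exact: preimage_scale_open.
by move=> x Ux; rewrite (partial_dilate a i Cu Ux).
Qed.

Lemma hessian_dilate (a c : R) U u x : open U -> C2_on U u -> U (c *: x) ->
  hessian (fun y => a * u (c *: y)) x = (a * c ^+ 2) *: hessian u (c *: x).
Proof.
move=> oU [Cu Cuu] Ux; apply/matrixP => i j; rewrite [LHS]mxE [RHS]mxE [in RHS]mxE.
rewrite (@partial_eq_on _ _ (fun y => a * c * partial i u (c *: y)) j
  (@preimage_scale_open c U oU) (fun y Uy => partial_dilate a i Cu Uy) x Ux).
by rewrite (partial_dilate _ j (Cuu i) Ux); ring.
Qed.

Lemma pucci_scale (cp cm k : R) (A : 'M[R]_n) : A^T = A -> 0 <= k ->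
  pucci cp cm (k *: A) = k * pucci cp cm A.
Proof.
move=> /real_spectral[S [d [SS ->]]] k0.
have -> : k *: (S^T *m diag_mx d *m S) = S^T *m diag_mx (k *: d) *m S.
  by rewrite linearZ /= -scalemxAr -scalemxAl.
rewrite !pucci_diag// mulr_sumr; apply: eq_bigr => i _.
by rewrite mxE pmZ.
Qed.

(** The exponents [a = 2 (p + 1) / (p q - 1)] and [b = 2 (q + 1) / (p q - 1)] solve [a + 2 = b p]
    and [b + 2 = a q], which balances two derivatives against the powers. *)
Lemma regular_solution_dilate (cp cm p q c : R) U u v : open U ->
  0 < c -> 1 < p * q -> regular_solution (@pucci R cp cm n) p q U u v ->
  regular_solution (@pucci R cp cm n) p q ((fun x => c *: x) @^-1` U)
    (fun x => c `^ (2 * (p + 1) / (p * q - 1)) * u (c *: x))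
    (fun x => c `^ (2 * (q + 1) / (p * q - 1)) * v (c *: x)).
Proof.
move=> oU c0 pq [Cu Cv pos eq].
have pq0 : p * q - 1 != 0 by rewrite subr_eq0 gt_eqF.
have expo (a b r w : R) : 0 <= w -> a + 2 = b * r ->
    (c `^ b * w) `^ r = c `^ a * c ^+ 2 * w `^ r.
  move=> w0 E; rewrite powRM ?powR_ge0// -powRrM -E powRD; last by rewrite (gt_eqF c0) implybT.
  by rewrite powR_mulrn// ltW.
split; [exact: C2_dilate|exact: C2_dilate| |].
  by move=> x /pos[ux vx]; rewrite !mulr_gt0// powR_gt0.
move=> x Ux; have [ux vx] := pos _ Ux; have [e1 e2] := eq _ Ux.
rewrite (hessian_dilate _ oU Cu Ux) (hessian_dilate _ oU Cv Ux).
have k0 a : 0 <= c `^ a * c ^+ 2 by rewrite mulr_ge0 ?powR_ge0 ?exprn_ge0 ?ltW.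
have Ux' : U (c *: x) by exact: Ux.
have su := hessian_sym oU Cu Ux'; have sv := hessian_sym oU Cv Ux'.
move: e1 e2 su sv; move: (hessian u (c *: x)) (hessian v (c *: x)) => A B e1 e2 sA sB.
rewrite (pucci_scale cp cm sA (k0 _)) (pucci_scale cp cm sB (k0 _)).
rewrite (expo (2 * (p + 1) / (p * q - 1))) ?(ltW vx)//; last by field.
rewrite (expo (2 * (q + 1) / (p * q - 1))) ?(ltW ux)//; last by field.
by rewrite -!mulrDr e1 e2 !mulr0.
Qed.

End local_and_scaling.

(** * Extension of ball solutions by zero *)

Section extension.
Context {R : realType} {n : nat} (rho : R).
Implicit Types (x : 'rV[R]_n) (u v : 'rV[R]_n -> R).

Definition ext0 u x := if enorm x < rho then u x else 0.

Lemma ext0_zball u : C2_on (@eball R n rho) u -> (forall x, eball rho x -> 0 < u x) ->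
  {within @ecball R n rho, continuous u} -> (forall x, @esphere R n rho x -> u x = 0) ->
  zball rho (ext0 u).
Proof.
move=> Cu up cu uz.
have ue x : eball rho x -> u x = ext0 u x by rewrite /eball /ext0 /= => ->.
have oB := @eball_open R n rho.
split; last by move=> x; rewrite /ext0 ltNge => ->.
- move=> x; rewrite -/{for x, continuous (ext0 u)}; have [xr|xr|xr] := ltgtP (enorm x) rho.
  + by have [+ _] := C1_on_eq oB ue Cu.1 xr.
  + have H : \forall y \near x, 0 = ext0 u y.
      have := near_gt (@enorm_continuous R n x) xr.
      by apply: filterS => y yr; rewrite /ext0 ltNge (ltW yr).
    by apply: (near_continuous H); exact: cst_continuous.
  + have xK : ecball rho x by rewrite /ecball /= xr.
    have H0 := proj1 (subspace_continuousP _ _) cu x xK.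
    have {H0}/cvgrPdist_lt H : u y @[y --> within (ecball rho) (nbhs x)] --> (0 : R).
      by rewrite -(uz x xr); exact: H0.
    have x0 : ext0 u x = 0 by rewrite /ext0 xr ltxx.
    apply: continuous_at_near => e e0; rewrite x0.
    have := H e e0; rewrite near_withinE; apply: filterS => y Hy.
    rewrite /ext0; case: ifP => yr; last by rewrite subrr normr0.
    by apply: Hy; rewrite /ecball /= ltW.
- exact: C2_on_eq ue Cu.
- by move=> x xr; rewrite -ue//; exact: up.
Qed.

Lemma ext0_eqn (cp cm p : R) u v :
  (forall x, eball rho x -> pucci cp cm (hessian u x) + v x `^ p = 0) ->
  pucci_eq cp cm rho (ext0 u) (ext0 v) p.
Proof.
move=> H x xr.
rewrite -(@hessian_eq_on R n _ u _ x (@eball_open R n rho)) => [|y|//]; last first.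
  by rewrite /eball /ext0 /= => ->.
by rewrite {1}/ext0 xr; apply/eqP; rewrite -addr_eq0; apply/eqP; exact: H.
Qed.

End extension.

(** * Radial solutions restricted to a ray *)

Section radial_profile.
Context {R : realType} {n : nat} (cp cm : R).
Implicit Types (u v : 'rV[R]_n.+1 -> R).

Let d0 : 'rV[R]_n.+1 := delta_mx 0 0.

Definition ray u (r : R) := u (r *: d0).

Lemma enorm_ray (r : R) : enorm (r *: d0) = `|r|.
Proof.
by rewrite enormE dotZl dotZr dot_delta mxE !eqxx mulr1 -expr2 sqrtr_sqr.
Qed.

Lemma radial_ray u x : radial u -> u x = ray u (enorm x).
Proof. by move=> ru; apply: ru; rewrite enorm_ray ger0_norm// enorm_ge0. Qed.

Lemma ray_derive T u (r : R) : C1_on (@eball R n.+1 T) u -> `|r| < T ->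
  is_derive r 1 (ray u) (ray (partial 0 u) r).
Proof.
move=> Cu rT; have xT : eball T (r *: d0) by rewrite /eball /= enorm_ray.
have E : (fun s : R => u (0 + s *: d0)) = ray u by apply/funext => s; rewrite /ray add0r.
by rewrite -E; apply: line_derive; rewrite add0r; exact: C1_on_derive Cu xT.
Qed.

Lemma ray_continuous u (r : R) : continuous u -> {for r, continuous (ray u)}.
Proof.
move=> cu; have := @line_continuous R n.+1 0 d0 r.
rewrite (_ : (fun s : R => 0 + s *: d0) = (fun s : R => s *: d0)); last by apply/funext => s; rewrite add0r.
by move=> h; exact: (@continuous_comp _ _ _ (fun s : R => s *: d0) u r h (cu _)).
Qed.

Lemma radial_profile T u (g : R -> R) : 0 < T -> radial u -> C2_on (@eball R n.+1 T) u ->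
  (forall x, enorm x < T -> pucci cp cm (hessian u x) = - g (enorm x)) ->
  profile cp cm n T (ray u) (ray (partial 0 u)) (ray (partial 0 (partial 0 u))) g.
Proof.
move=> T0 ru [Cu Cuu] eq.
have D1 (r : R) : `|r| < T -> is_derive r 1 (ray u) (ray (partial 0 u) r) by exact: ray_derive Cu.
have D2 (r : R) : `|r| < T -> is_derive r 1 (ray (partial 0 u)) (ray (partial 0 (partial 0 u)) r).
  exact: ray_derive (Cuu 0).
have T00 : `|0 : R| < T by rewrite normr0.
split.
(* A radial function is even along the ray, so its derivative at 0 is its own opposite. *)
- have h := D1 0 T00.
  have nd : is_derive (0 : R) 1 (fun s : R => -1 * s) (-1) by exact: lin_derive.
  have h' := h; rewrite -[X in is_derive X](mulr0 (-1)) in h'.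
  have := @is_derive1_comp R (ray u) (fun s => -1 * s) 0 _ _ h' nd.
  rewrite (_ : ray u \o _ = ray u); last first.
    by apply/funext => s; apply: ru; rewrite !enorm_ray mulN1r normrN.
  move=> h2; have := @derive_val _ _ _ _ _ _ _ h; rewrite (@derive_val _ _ _ _ _ _ _ h2).
  by lra.
- exact: rcont_of_derive (D1 0 T00).
- exact: rcont_of_derive (D2 0 T00).
move=> r /andP[r0 rT]; have rT' : `|r| < T by rewrite gtr0_norm.
split; [exact: D1|exact: D2|].
pose x := r *: d0; have er : enorm x = r by rewrite enorm_ray gtr0_norm.
have x0 : 0 < enorm x by rewrite er.
have n1 : \forall s \near enorm x, is_derive (s : R) 1 (ray u) (ray (partial 0 u) s).
  rewrite er; have : \forall s \near r, `|s| < T by apply: (near_lt (@norm_continuous R R^o r)).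
  by apply: filterS => s; exact: D1.
have n2 : is_derive (enorm x) 1 (ray (partial 0 u)) (ray (partial 0 (partial 0 u)) r).
  by rewrite er; exact: D2.
have n3 : \near x, u x = ray u (enorm x) by near=> y; exact: radial_ray.
have := eq x; rewrite er (radial_hessian x0 n1 n2 n3) pucci_scalar_outer.
  by rewrite er => /(_ rT) <-; congr (pm _ _ _ + _); ring.
by rewrite dotZl dotZr -enorm_sqr er; field; rewrite gt_eqF.
Unshelve. all: by end_near. Qed.

End radial_profile.

(** * Exclusion and existence for fixed exponents *)

Section decomposition.
Context {R : realType} (n : nat) (cp cm lam Lam p q : R).
Hypotheses (lam0 : 0 < lam) (lL : lam <= Lam) (n0 : (0 < n)%N).
Hypothesis cpm : (cp = Lam /\ cm = lam) \/ (cp = lam /\ cm = Lam).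
Hypotheses (p0 : 0 < p) (q0 : 0 < q) (pq1 : 1 < p * q).
Local Notation M := (@pucci R cp cm n.+1).

Let lamp : lam <= cp. Proof. by case: cpm => -[-> _]. Qed.
Let lamm : lam <= cm. Proof. by case: cpm => -[_ ->]. Qed.

Lemma radial_regular_profiles T u v : 0 < T -> radial u -> radial v ->
  regular_solution M p q (@eball R n.+1 T) u v ->
  (exists u1 u2, profile cp cm n T (ray u) u1 u2 (pospow p \o ray v)) /\
  (exists v1 v2, profile cp cm n T (ray v) v1 v2 (pospow q \o ray u)).
Proof.
move=> T0 ru rv [Cu Cv pos eq].
split; eexists; eexists; apply: radial_profile => // x xT;
  have [ux vx] := pos x xT; have [e1 e2] := eq x xT.
- by rewrite /= -radial_ray// pospowE ?ltW//; apply/eqP; rewrite -addr_eq0 e1.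
- by rewrite /= -radial_ray// pospowE ?ltW//; apply/eqP; rewrite -addr_eq0 e2.
Qed.

Lemma regular_solution_sub (U V : set 'rV[R]_n.+1) u v : U `<=` V ->
  regular_solution M p q V u v -> regular_solution M p q U u v.
Proof.
move=> UV [[Cu Cuu] [Cv Cvv] pos eq]; split.
- by split=> [x /UV/Cu|i x /UV]; last exact: Cuu.
- by split=> [x /UV/Cv|i x /UV]; last exact: Cvv.
- by move=> x /UV/pos.
- by move=> x /UV/eq.
Qed.

Lemma regular_solution_pospow (A : set 'rV[R]_n.+1) u v : C2_on setT u -> C2_on setT v ->
  (forall x, M (hessian u x) = - pospow p (v x)) ->
  (forall x, M (hessian v x) = - pospow q (u x)) ->
  (forall x, A x -> 0 < u x /\ 0 < v x) -> regular_solution M p q A u v.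
Proof.
move=> [Cu Cuu] [Cv Cvv] eu ev pos; split.
- by split=> [x _|i x _]; [exact: Cu|exact: Cuu].
- by split=> [x _|i x _]; [exact: Cv|exact: Cvv].
- exact: pos.
move=> x /pos[ux vx]; split; apply/eqP; rewrite addr_eq0; apply/eqP.
  by rewrite -(pospowE p (ltW vx)); exact: eu.
by rewrite -(pospowE q (ltW ux)); exact: ev.
Qed.

Lemma ball_global_disjoint rho u v U V : 0 < rho ->
  regular_solution M p q (@eball R n.+1 rho) u v ->
  {within @ecball R n.+1 rho, continuous u} -> {within @ecball R n.+1 rho, continuous v} ->
  (forall x, @esphere R n.+1 rho x -> u x = 0 /\ v x = 0) ->
  regular_solution M p q [set: 'rV[R]_n.+1] U V -> radial U -> radial V -> False.
Proof.
move=> r0 [Cu Cv pos eq] cu cv z hUV rU rV.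
pose fu := ext0 rho u; pose fv := ext0 rho v.
have zu : zball rho fu by apply: ext0_zball => // x /[dup]; [move=> /pos[]|move=> /z[]].
have zv : zball rho fv by apply: ext0_zball => // x /[dup]; [move=> /pos[]|move=> /z[]].
have euv : pucci_eq cp cm rho fu fv p by apply: ext0_eqn => x /eq[].
have evu : pucci_eq cp cm rho fv fu q by apply: ext0_eqn => x /eq[].
have ru := ball_radial lam0 lL r0 cpm zu zv euv evu p0 q0.
have rv := ball_radial lam0 lL r0 cpm zv zu evu euv q0 p0.
have [cfu Cfu up uz] := zu; have [cfv Cfv vp vz] := zv.
have hf : regular_solution M p q (@eball R n.+1 rho) fu fv.
  split=> // [x xr|x xr]; first by split; [exact: up|exact: vp].
  by split; apply/eqP; rewrite addr_eq0; apply/eqP; [exact: euv|exact: evu].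
have [[u1 [u2 pu]] [v1 [v2 pv]]] := radial_regular_profiles r0 ru rv hf.
have fz (r : R) : rho <= r -> ray fu r = 0 /\ ray fv r = 0.
  by move=> rr; split; [apply: uz|apply: vz]; rewrite enorm_ray ger0_norm// (le_trans (ltW r0)).
have [_ _ UVpos _] := hUV.
have al0 : 0 < 2 * (p + 1) / (p * q - 1).
  by rewrite divr_gt0 ?subr_gt0// mulr_gt0// addr_gt0.
have fu0 : 0 < ray fu 0 by apply: up; rewrite enorm_ray normr0.
have U0 : 0 < U 0 by have [] := UVpos 0 I.
(* The dilation factor [c] solves [c^al U(0) = fu(0)], so that only the second initial values remain
   to be compared. *)
pose al := 2 * (p + 1) / (p * q - 1).
pose c := (ray fu 0 / U 0) `^ al^-1.
have c0 : 0 < c by rewrite powR_gt0// divr_gt0.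
pose W (x : 'rV[R]_n.+1) := c `^ al * U (c *: x).
pose Z (x : 'rV[R]_n.+1) := c `^ (2 * (q + 1) / (p * q - 1)) * V (c *: x).
have hs : regular_solution M p q [set: 'rV[R]_n.+1] W Z.
  exact: (regular_solution_dilate openT c0 pq1 hUV).
have rsc (x y : 'rV[R]_n.+1) : enorm x = enorm y -> enorm (c *: x) = enorm (c *: y).
  by move=> xy; rewrite !enormE !dotZl !dotZr -!enorm_sqr xy.
have rW : radial W by move=> x y xy; rewrite /W (rU _ _ (rsc x y xy)).
have rZ : radial Z by move=> x y xy; rewrite /Z (rV _ _ (rsc x y xy)).
have [[W1 [W2 pW]] [Z1 [Z2 pZ]]] := radial_regular_profiles r0 rW rZ
  (regular_solution_sub (@subsetT _ (@eball R n.+1 rho)) hs).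
have W0 : ray W 0 = ray fu 0.
  rewrite {1}/ray /W !(scale0r, scaler0) /c -powRrM mulVf ?gt_eqF// powRr1 ?divr_ge0 ?ltW//.
  by rewrite divfK// gt_eqF.
have [[CW _] [CZ _] WZpos _] := hs.
have posW (r : R) : 0 < ray W r /\ 0 < ray Z r by exact: WZpos.
have cW (r : R) : {for r, continuous (ray W)} by apply: ray_continuous => x; have [] := CW x I.
have cZ (r : R) : {for r, continuous (ray Z)} by apply: ray_continuous => x; have [] := CZ x I.
have cru (r : R) : {for r, continuous (ray fu)} by exact: ray_continuous.
have crv (r : R) : {for r, continuous (ray fv)} by exact: ray_continuous.
have [zu0 zv0] := fz rho (lexx rho).
have mP := pospow_homo p0; have mQ := pospow_homo q0.
(* If [Z] starts below [fv], the persisting gap makes [Z] negative at [rho], where [fv] is 0. If it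
   starts above, [W] stays below [fu], which vanishes at [rho]. With equal data uniqueness applies
   all the way, as [W] and [Z] are positive everywhere. *)
have [lt|gt|e0] := ltgtP (ray Z 0) (ray fv 0).
- have H : ray Z rho - ray fv rho <= - (ray fv 0 - ray Z 0).
    apply: (@left_lim_le R (fun r => ray Z r - ray fv r)) => //.
      by apply: continuousB; [exact: cZ|exact: crv].
    move=> r hr; have le0 : ray fu 0 <= ray W 0 by rewrite W0.
    have [_ + _ _] := system_order lam0 lamp lamm n0 mP mQ pu pv pW pZ le0 lt hr.
    by lra.
  by have [_] := posW rho; move: H; rewrite zv0; lra.
- have H : ray W rho - ray fu rho <= 0.
    apply: (@left_lim_le R (fun r => ray W r - ray fu r)) => //.
      by apply: continuousB; [exact: cW|exact: cru].
    move=> r hr; have le0 : ray W 0 <= ray fu 0 by rewrite W0.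
    have [+ _ _ _] := system_order lam0 lamp lamm n0 mP mQ pW pZ pu pv le0 gt hr.
    by lra.
  by have [+ _] := posW rho; move: H; rewrite zu0; lra.
have H : ray W rho - ray fu rho <= 0.
  apply: (@left_lim_le R (fun r => ray W r - ray fu r)) => //.
    by apply: continuousB; [exact: cW|exact: cru].
  move=> r hr.
  have [->] := system_unique lam0 lamp lamm n0 (pospow_loc_lip p0) (pospow_loc_lip q0)
    pW pZ pu pv W0 e0 (fun r _ => posW r) hr.
  by rewrite subrr.
by have [+ _] := posW rho; move: H; rewrite zu0; lra.
Qed.

Lemma ball_or_global rho : 0 < rho ->
  (exists u v, [/\ regular_solution M p q (@eball R n.+1 rho) u v,
     {within @ecball R n.+1 rho, continuous u}, {within @ecball R n.+1 rho, continuous v} &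
     forall x, @esphere R n.+1 rho x -> u x = 0 /\ v x = 0]) \/
  (exists u v, [/\ regular_solution M p q [set: 'rV[R]_n.+1] u v, radial u & radial v]).
Proof.
move=> rho0; pose K := Num.bound (n%:R * cm / lam).
have cm0 : 0 < cm by exact: lt_le_trans lamm.
have hK : n%:R * cm / lam <= K%:R.
  by apply: ltW; apply: archi_boundP; rewrite divr_ge0 ?mulr_ge0 ?ler0n ?ltW.
have nP := pospow_nonlinearity p0; have nQ := pospow_nonlinearity q0.
have [xi [eta [c [c' [y [z [hs alt]]]]]]] :=
  shooting lam0 lamp lamm n0 hK nP nQ (pospow_unbounded p0).
pose u (x : 'rV[R]_n.+1) := from xi y (enorm x).
pose v (x : 'rV[R]_n.+1) := from eta z (enorm x).
have [Cu eu] : C2_on setT u /\ forall x, M (hessian u x) = - pospow p (v x).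
  exact: (sys_radial lam0 lamp lamm hK nP hs).
have [Cv ev] : C2_on setT v /\ forall x, M (hessian v x) = - pospow q (u x).
  exact: (sys_radial lam0 lamp lamm hK nQ (sys_swap hs)).
have sol A := @regular_solution_pospow A u v Cu Cv eu ev.
have rad (f : R -> R) : radial (fun x : 'rV[R]_n.+1 => f (enorm x)) by move=> x x' ->.
case: alt => [[r0 r00 [pos [ur vr]]]|pos]; last first.
  right; exists u, v; split; [|exact: rad|exact: rad].
  by apply: sol => x _; apply: pos; exact: enorm_ge0.
(* The common zero occurs at some radius [r0]; the dilation by [r0 / rho] moves it to the prescribed
   one. *)
left; pose k := r0 / rho; have k0 : 0 < k by rewrite divr_gt0.
have solr : regular_solution M p q (@eball R n.+1 r0) u v.
  by apply: sol => x xr; apply: pos; rewrite enorm_ge0.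
have := regular_solution_dilate (@eball_open R n.+1 r0) k0 pq1 solr.
have ek (x : 'rV[R]_n.+1) : enorm (k *: x) = k * enorm x.
  by rewrite enormE dotZl dotZr mulrA -expr2 sqrtrM ?sqr_ge0// sqrtr_sqr gtr0_norm// -enormE.
have -> : (fun x : 'rV[R]_n.+1 => k *: x) @^-1` (eball r0) = eball rho.
  apply/seteqP; split=> x; rewrite /eball /= ek /k mulrAC.
    by rewrite ltr_pdivrMr// ltr_pM2l.
  by rewrite ltr_pdivrMr// ltr_pM2l.
pose w (x : 'rV[R]_n.+1) := k `^ (2 * (p + 1) / (p * q - 1)) * u (k *: x).
pose w' (x : 'rV[R]_n.+1) := k `^ (2 * (q + 1) / (p * q - 1)) * v (k *: x).
move=> hw.
exists w, w'.
have cont (a : R) (f : 'rV[R]_n.+1 -> R) : C2_on setT f ->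
    {within @ecball R n.+1 rho, continuous (fun x => a * f (k *: x))}.
  move=> [Cf _]; apply: continuous_subspaceT => x.
  apply: continuousM; first exact: cst_continuous.
  by apply: dilate_continuous; have [] := Cf (k *: x) I.
split=> //; [exact: cont|exact: cont|].
move=> x xr; rewrite /w /w' /u /v ek (xr : enorm x = rho) /k divfK ?gt_eqF//.
by rewrite ur vr !mulr0.
Qed.

End decomposition.

Theorem theorem1p6 (R : realType) (N : nat) (lam Lam : R) (M : 'M[R]_N -> R)
    (rho : R) :
  (3 <= N)%N -> 0 < lam -> lam <= Lam ->
  M = pucci_sup lam Lam \/ M = pucci_inf lam Lam ->
  0 < rho ->
  @superlinear_pairs R = calC M rho `|` calG M /\
  calC M rho `&` calG M = set0.
Proof.
case: N M => // n M; rewrite ltnS => n2 lam0 lL hM rho0.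
have n0 : (0 < n)%N by exact: ltn_trans n2.
have [cp [cm [cpm ->]]] : exists cp cm,
    ((cp = Lam /\ cm = lam) \/ (cp = lam /\ cm = Lam)) /\ M = @pucci R cp cm n.+1.
  case: hM => ->; [exists Lam, lam|exists lam, Lam]; split; [by left|exact: pucci_supE|
    by right|exact: pucci_infE].
split; apply/seteqP; split=> -[p q].
- move=> [/= p0 q0 pq1]; have [C|G] := ball_or_global lam0 lL n0 cpm p0 q0 pq1 rho0; [left|right].
    by split.
  by split.
- by move=> [[]|[]].
- move=> [[[/= p0 q0 pq1] [u [v [h1 h2 h3 h4]]]] [_ [U [V [h5 h6 h7]]]]].
  exact: (ball_global_disjoint lam0 lL n0 cpm p0 q0 pq1 rho0 h1 h2 h3 h4 h5 h6 h7).
- by [].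
Qed.
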